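(* Let $\ell$ be a prime and $k$ a number field. Then for every finite subset $S\subset\mathbb{P}(k)$ there exists a constant $c(\ell,S)>0$ such that $$c(\ell,S)\,x^{\frac{1}{\ell-1}}\le Z(k,S,C_\ell;x)\quad\text{for all sufficiently large }x.$$
   Context: $\mathbb{P}(k)$ is the set of prime ideals of $k$. $Z(k,S,C_\ell;x)$ is the number of cyclic Galois extensions $K/k$ of degree $\ell$ inside a fixed algebraic closure which are unramified at all primes of $S$ and satisfy $\mathcal{N}_{k/\mathbb{Q}}(d_{K/k})\le x$. *)

(* Defs.v *)
From HB Require Import structures.
From mathcomp Require Import all_boot all_order all_algebra.
From mathcomp Require Import all_fingroup all_solvable all_field.
From mathcomp Require Import all_classical all_reals all_analysis.

Set Implicit Arguments.
Unset Strict Implicit.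
Unset Printing Implicit Defensive.

Import Order.TTheory GRing.Theory Num.Theory.

Local Open Scope classical_set_scope.
Local Open Scope ring_scope.

Definition is_int (F : fieldType) : {pred F} :=
  fun z => `[< integralOver (intr : int -> F) z >].

Lemma is_int_subring_closed (F : fieldType) : subring_closed (@is_int F).
Proof.
split; first by apply/asboolP; exact: integral1.
- by move=> x y /asboolP ix /asboolP iy; apply/asboolP; exact: integral_sub.
- by move=> x y /asboolP ix /asboolP iy; apply/asboolP; exact: integral_mul.
Qed.

HB.instance Definition _ (F : fieldType) :=
  GRing.isSubringClosed.Build F (@is_int F) (@is_int_subring_closed F).

Record int_ring (F : fieldType) : Type :=
  IntRing { int_val : F; int_valP : int_val \in @is_int F }.

HB.instance Definition _ (F : fieldType) := [isSub for @int_val F].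
HB.instance Definition _ (F : fieldType) := [Choice of int_ring F by <:].
HB.instance Definition _ (F : fieldType) :=
  [SubChoice_isSubComNzRing of int_ring F by <:].

Section Ideals.
Variable A : comNzRingType.

(* The unit ideal is allowed, unlike in [idealr_closed]. *)
Definition is_ideal (I : set A) : Prop :=
  submod_closed ([in I] : {pred A^o}).

Definition ideal_gen (G : set A) : set A := smallest is_ideal G.

Definition ideal_mul (I J : set A) : set A :=
  ideal_gen [set z | exists x y, [/\ I x, J y & z = x * y]].

Definition ideal_prod (s : seq (set A)) : set A := foldr ideal_mul setT s.

(* The nonzero prime ideals; [idealr_closed] contains properness. *)
Definition primes_of : set (set A) :=
  [set P : set A | [/\ idealr_closed [in P], prime_idealr_closed [in P]
             & P != [set 0]]].

(* The index of [I] in [A] as an additive subgroup; [counting] is the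
   cardinality, with value [+oo] on infinite sets. *)
Definition ideal_norm (R : realType) (I : set A) : \bar R :=
  counting [set C : set A | exists a, C = [set b | I (b - a)]].

End Ideals.

Section Extension.
Variables (k : fieldType) (K : fieldExtType k).

Definition ideal_ext (I : set (int_ring k)) : set (int_ring K) :=
  ideal_gen [set y | exists2 x, I x & int_val y = (int_val x)%:A].

Definition unramified_at (p : set (int_ring k)) : Prop :=
  exists s : seq (set (int_ring K)),
    [/\ uniq s, {in s, forall P, primes_of P} & ideal_ext p = ideal_prod s].

Definition field_trace (a : K) : k :=
  \tr (passmx.mxof (vbasis {:K}) (vbasis {:K}) (amull a)).

Definition tuple_disc (n : nat) (w : n.-tuple K) : k :=
  \det (\matrix_(i < n, j < n) field_trace (tnth w i * tnth w j)).

(* Generated by the discriminants of all bases of [K] over [k] which consist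
   of integers; the ring of integers of [K] need not be free over that of
   [k]. *)
Definition rel_disc : set (int_ring k) :=
  ideal_gen [set d | exists w : (\dim {:K}).-tuple K,
    [/\ basis_of {:K} w, {in w, forall z, z \in @is_int K}
      & int_val d = tuple_disc w]].

End Extension.

Definition algebraic_closure (k : fieldType) (L : closedFieldType)
    (iota : {rmorphism k -> L}) : Prop :=
  forall z : L, algebraicOver iota z.

Section Counting.
Variables (R : realType) (k : fieldExtType rat).
Variables (L : closedFieldType) (iota : {rmorphism k -> L}).
Variables (S : set (set (int_ring k))) (l : nat).

(* An extension of [k] inside [L] is a subset of [L]: the range of an embedding
   over [k] of some abstract extension [K].  Conjugate embeddings have the same
   range and distinct subfields are counted separately. *)
Definition cyclic_subfields (x : R) : set (set L) :=
  [set E | exists (K : splittingFieldType k) (j : {rmorphism K -> L}),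
     [/\ forall a : k, j a%:A = iota a, range j = E
       & [/\ \dim {:K} = l, galois 1 {:K}, cyclic 'Gal({:K} / 1),
             forall p, S p -> unramified_at K p
           & (ideal_norm R (rel_disc K) <= x%:E)%E]]].

Definition Z_cyclic (x : R) : \bar R := counting (cyclic_subfields x).

End Counting.

(* Main.v *)
(* Let E = k(z), with z a primitive l-th root of unity, and let G = Gal(E/k) act
   on z through chi : G -> 'F_l.  An integer beta of E congruent to 1 modulo a
   suitable M yields a cyclic extension of k of degree l: with B_g ^+ l = g beta,
   the resolvents A_i = \prod_g B_g ^+ (i / chi g) have Fourier transforms
   w_a = l^-1 \sum_i z^(a i) A_i which span over k a field whose automorphisms
   shift the index a.  The w_a are integral, their multiplication table tau has
   entries in k, their discriminant is b ^+ l.-1 with b = \prod_g g beta, and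
   modulo every prime which contains a divisor of M they are orthogonal
   idempotents, so that S is unramified.

   Let beta run over a box of A ^ n integers, n = [E : Q].  A sieve shows that at
   least half of them have a squarefree norm; then b is radical, and equality of
   the fields of beta and beta' forces beta' to divide some g beta.  All absolute
   values of elements of the box are large and differ little from each other, so
   beta' = g beta.  This gives A ^ n / (2 #|G|) fields, whose discriminants have
   norm at most C A ^ (n (l - 1)). *)
Require Import Defs.
From HB Require Import structures.
From mathcomp Require Import all_boot all_order all_algebra.
From mathcomp Require Import all_fingroup all_solvable all_field.
From mathcomp Require Import finmap all_classical all_reals all_analysis.
From mathcomp Require Import ring lra zify.

Set Implicit Arguments.
Unset Strict Implicit.
Unset Printing Implicit Defensive.

Import Order.TTheory GRing.Theory Num.Theory.

Local Open Scope classical_set_scope.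
Local Open Scope ring_scope.

(** * Algebraic integers *)

(** The exponents [i / chi g] are forced by descent to k: with them, h in G carries the structure
    constant of A_i A_j to the one at (chi h i, chi h j), and the Fourier transform absorbs this
    relabelling, so that the table is G-invariant although z need not lie in k. The table has the
    denominator l^2, which is why M must contain l^2 besides multiples of the primes in S. No
    factorization of ideals is used. Squarefreeness of an ideal becomes a property of an element x:
    x divides t as soon as it divides a power of t. For a rational integer this follows from
    squarefreeness away from a fixed denominator D, because modulo a prime not dividing D the
    integers form a reduced ring. All valuation arguments then are divisibilities between elements.
    The discriminant need not be computed either. That it contains b^(l-1) bounds its index by that
    of a principal ideal, and every conjugate of b is a product of #|G| conjugates of beta. *)

Lemma is_intE (F : fieldType) (z : F) :
  reflect (integralOver (intr : int -> F) z) (z \in @is_int F).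
Proof. exact: asboolP. Qed.

(** Integrality refers to [int] and not to a base field, so it can be tested after any embedding, in
    [k], [E], [K], [L] or [algC] alike. *)
Lemma is_int_rmorph (F E : fieldType) (f : {rmorphism F -> E}) (x : F) :
  (f x \in @is_int E) = (x \in @is_int F).
Proof.
have eqp (p : {poly int}) : map_poly intr p = map_poly f (map_poly intr p).
  by rewrite -map_poly_comp; apply: eq_map_poly => i /=; rewrite rmorph_int.
by apply/is_intE/is_intE => -[p mp px]; exists p => //; move: px; rewrite eqp fmorph_root.
Qed.

Lemma is_int_root (F : fieldType) (p : {poly F}) (u : F) :
  p \is monic -> root p u -> p \is a polyOver (@is_int F) -> u \in @is_int F.
Proof.
move=> mp pu /allP op; apply/is_intE; apply: (integral_root_monic mp pu).
by move=> x /op /is_intE.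
Qed.

Lemma is_int_expr_root (F : fieldType) (m : nat) (t : F) :
  (0 < m)%N -> t ^+ m \in @is_int F -> t \in @is_int F.
Proof.
move=> m0 tm; apply: (@is_int_root _ ('X^m - (t ^+ m)%:P)).
- by rewrite monicXnsubC.
- by rewrite /root !hornerE subrr.
- by rewrite rpredB ?polyOverXn ?polyOverC.
Qed.

Lemma is_int_algC_ratr (q : rat) : ratr q \in @is_int algC -> q \is a Num.int.
Proof.
move=> /is_intE [p mp px]; rewrite -Cint_rat.
apply: Cint_rat_Aint; first exact: Crat_rat.
apply: (@root_monic_Aint _ _ px); first exact: monic_map.
by apply/polyOverP => i; rewrite coef_map /= intr_int.
Qed.

Lemma irreducible_common_root (F E : fieldType) (f : {rmorphism F -> E})
    (p q : {poly F}) (z : E) :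
  irreducible_poly p -> root (map_poly f p) z -> root (map_poly f q) z ->
  p %| q.
Proof.
move=> [sp irr] pz qz; have pn0 : p != 0 by rewrite -size_poly_gt0 ltnW.
have : root (map_poly f (gcdp p q)) z by rewrite gcdp_map root_gcd pz.
move=> gz; have s1 : size (gcdp p q) != 1%N.
  apply/eqP => /eqP/size_poly1P [c c0 e]; move: gz; rewrite e map_polyC rootC.
  by rewrite fmorph_eq0 (negPf c0).
have := irr _ s1 (dvdp_gcdl p q) => /eqp_dvdl <-; exact: dvdp_gcdr.
Qed.

(* A field embedding is prescribed by the image of a generator. *)
Lemma embed_adjoin (F : fieldType) (E : fieldExtType F) (L : fieldType)
    (iota : {rmorphism F -> L}) (z : E) (p : {poly F}) (r : L) :
  <<1; z>>%VS = fullv -> irreducible_poly p ->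
  root (map_poly (in_alg E) p) z -> root (map_poly iota p) r ->
  exists2 psi : {rmorphism E -> L}, forall a, psi a%:A = iota a & psi z = r.
Proof.
move=> gen irr pz pr.
have ex x : {q : {poly F} | x = (map_poly (in_alg E) q).[z]}.
  apply: cid; have /Fadjoin1_polyP [q ->] : x \in <<1; z>>%VS by rewrite gen memvf.
  by exists q.
pose g x := (map_poly iota (sval (ex x))).[r].
(* Polynomials with the same value at [z] differ by a multiple of [p], which vanishes at [r]; hence
   the choice made by [ex] does not matter. *)
have wd (q : {poly F}) x : x = (map_poly (in_alg E) q).[z] -> g x = (map_poly iota q).[r].
  move=> ex'; rewrite /g; case: (ex x) => q' /= eq'.
  have /dvdpP [c ec] : p %| q' - q.
    apply: (irreducible_common_root irr pz).
    by rewrite rmorphB /= /root hornerD hornerN -eq' -ex' subrr.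
  apply/eqP; rewrite -subr_eq0 -hornerN -hornerD -rmorphB ec rmorphM hornerM.
  by rewrite (rootP pr) mulr0.
have gB : {morph g : x y / x - y}.
  move=> x y; case: (ex x) (ex y) => [q ->] [q' ->].
  rewrite -hornerN -hornerD -rmorphB (wd _ _ erefl) (wd _ _ erefl) (wd _ _ erefl).
  by rewrite rmorphB hornerD hornerN.
have g1 : g 1 = 1 by rewrite (wd 1) ?rmorph1 ?hornerC.
have gM : {morph g : x y / x * y}.
  move=> x y; case: (ex x) (ex y) => [q ->] [q' ->].
  rewrite -hornerM -rmorphM (wd _ _ erefl) (wd _ _ erefl) (wd _ _ erefl).
  by rewrite rmorphM hornerM.
pose m1 := GRing.isZmodMorphism.Build E L g gB.
pose m2 := GRing.isMonoidMorphism.Build E L g (conj g1 gM).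
pose gm : {rmorphism E -> L} := HB.pack g m1 m2.
exists gm => [a|].
  by change (g a%:A = iota a); rewrite (wd a%:P) ?map_polyC ?hornerC.
by change (g z = r); rewrite (wd 'X) ?map_polyX ?hornerX.
Qed.

Lemma det_closed (R : comNzRingType) (S : subringClosed R) (n : nat) (A : 'M[R]_n) :
  (forall i j, A i j \in S) -> \det A \in S.
Proof.
move=> AS; rewrite /determinant rpred_sum // => s _.
by rewrite rpredMsign rpred_prod.
Qed.

(** The determinant trick: [a] is a root of a characteristic polynomial with integral coefficients.
    The matrix is transposed because eigenvectors are rows. *)
Lemma is_int_eigen (F : fieldType) (n : nat) (M : 'I_n -> 'I_n -> F)
    (x : 'I_n -> F) (a : F) (i0 : 'I_n) :
  x i0 != 0 -> (forall i, a * x i = \sum_j M i j * x j) ->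
  (forall i j, M i j \in @is_int F) -> a \in @is_int F.
Proof.
move=> x0 eM iM; pose A := (\matrix_(i, j) M j i) : 'M[F]_n.
have rA : root (char_poly A) a.
  rewrite -eigenvalue_root_char; apply/eigenvalueP; exists (\row_i x i).
    apply/rowP => i; rewrite !mxE eM; apply: eq_bigr => j _.
    by rewrite !mxE mulrC.
  by apply/eqP => /rowP /(_ i0) /eqP; rewrite !mxE (negPf x0).
apply: (is_int_root (char_poly_monic A) rA).
rewrite /char_poly; apply: det_closed => i j; rewrite !mxE.
by rewrite rpredB ?rpredMn ?polyOverX ?polyOverC.
Qed.

Lemma rat_common_denom (I : finType) (q : I -> rat) :
  exists2 D : nat, (0 < D)%N & forall i, D%:R * q i \is a Num.int.
Proof.
exists (\prod_i `|denq (q i)|)%N => [|i]; first by rewrite prodn_gt0 // => i; rewrite absz_gt0.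
rewrite (bigD1 i) //= mulnC natrM -mulrA rpredM ?natr_int //.
rewrite natr_absz gtr0_norm // -{2}[q i]divq_num_den mulrC divfK ?intr_int //.
by rewrite intr_eq0.
Qed.

(** * Embeddings and integral bases of number fields *)

Lemma int_is_int (F : fieldType) (q : int) : q%:~R \in @is_int F.
Proof. exact: rpred_int. Qed.

Lemma rat_int_is_int (E : fieldExtType rat) (q : rat) :
  q \is a Num.int -> q%:A \in @is_int E.
Proof. by move=> /intrP [m ->]; rewrite scaler_int rpred_int. Qed.

Lemma rat_int_scale (E : fieldExtType rat) (q : rat) (x : E) :
  q \is a Num.int -> x \in @is_int E -> q *: x \in @is_int E.
Proof.
by move=> qZ xi; rewrite -[x]mul1r scalerAl rpredM // rat_int_is_int.
Qed.

(* [psi] lists the complex embeddings, [v] is a basis of integers and [u] the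
   dual basis for the trace form. *)
Record frame (E : fieldExtType rat) (n : nat) (psi : 'I_n -> {rmorphism E -> algC})
    (v u : 'I_n -> E) (D : nat) : Prop := Frame {
  frame_gt0 : (0 < n)%N;
  frame_D : (0 < D)%N;
  frame_v : forall i, v i \in @is_int E;
  frame_u : forall i, D%:R *: u i \in @is_int E;
  frame_trace : forall z, exists t : rat, ratr t = \sum_m psi m z;
  frame_norm : forall z, exists t : rat, ratr t = \prod_m psi m z;
  frame_dual : forall i j, \sum_m psi m (v i * u j) = (i == j)%:R;
  frame_span : forall z, exists t : 'I_n -> rat, z = \sum_i t i *: v i;
  frame_all : forall phi : {rmorphism E -> algC}, exists i, phi =1 psi i }.

(** A common denominator [d] of the matrix of multiplication by a primitive element [th0] makes the
    matrix of [d th0] integral; the basis itself is the eigenvector for [is_int_eigen]. *)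
Lemma integral_generator (E : fieldExtType rat) :
  exists2 th : E, th \in @is_int E & <<1; th>>%VS = fullv.
Proof.
have pc : [pchar E] =i pred0 by move=> p; rewrite (pchar_lalg E) pchar_num.
pose th0 := separable_generator 1 {:E}.
have gen0 : <<1; th0>>%VS = fullv.
  symmetry; apply: eq_adjoin_separable_generator; rewrite ?sub1v //.
  by apply/separableP => y _; apply: pcharf0_separable.
pose e := vbasis {:E}.
have be : basis_of {:E} e := vbasisP _.
have [d d0 dM] := rat_common_denom
  (fun ij : 'I_(\dim {:E}) * 'I_(\dim {:E}) => coord e ij.2 (th0 * tnth e ij.1)).
exists (d%:R *: th0); last first.
  apply/eqP; rewrite eqEsubv subvf -{1}gen0; apply/FadjoinP; split.
    exact: subv_adjoin.
  have e1 : th0 = (d%:R)^-1 *: (d%:R *: th0).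
    by rewrite scalerA mulVf ?scale1r // pnatr_eq0 -lt0n.
  by rewrite [X in X \in _]e1 memvZ // memv_adjoin.
have n0 : (0 < \dim {:E})%N by rewrite adim_gt0.
pose M (i j : 'I_(\dim {:E})) : E := (d%:R * coord e j (th0 * tnth e i))%:A.
apply: (@is_int_eigen E _ M (tnth e) _ (Ordinal n0)) => /=.
- by apply: (basis_not0 be); rewrite mem_tnth.
- move=> i; rewrite -scalerAl {1}(coord_basis be (memvf (th0 * tnth e i))) scaler_sumr.
  by apply: eq_bigr => j _; rewrite scalerA -scalerAl mul1r -tnth_nth.
- by move=> i j; apply/rat_int_is_int/(dM (i, j)).
Qed.

(** The basis consists of the powers of an integral generator and the embeddings correspond to the
    roots of its minimal polynomial, so [V] is a Vandermonde matrix. It diagonalizes every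
    multiplication, which makes traces and norms rational. The Gram matrix of the trace form is
    [V *m V^T]; its inverse gives the dual basis and [D] clears the denominators of that inverse. *)
Lemma frame_exists (E : fieldExtType rat) :
  exists psi v u D, @frame E (\dim {:E}) psi v u D.
Proof.
have [th thi gen] := integral_generator E; set n := \dim {:E}.
have pc : [pchar E] =i pred0 by move=> p; rewrite (pchar_lalg E) pchar_num.
have [p Dp] : exists p, minPoly 1 th = map_poly (in_alg E) p.
  exact/polyOver1P/minPolyOver.
have szp : size p = n.+1.
  rewrite -(size_map_poly (in_alg E)) -Dp size_minPoly; congr _.+1.
  by have := dim_Fadjoin 1 th; rewrite gen dimv1 muln1.
have mp : p \is monic by rewrite -(map_monic (in_alg E)) -Dp monic_minPoly.
have p0 : p != 0 by rewrite monic_neq0.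
have irr : irreducible_poly p.
  split=> [|q sq qp]; first by rewrite szp ltnS adim_gt0.
  have : map_poly (in_alg E) q %| minPoly 1 th by rewrite Dp dvdp_map.
  move=> /(minPoly_irr (alg_polyOver _ _)); rewrite Dp eqp_map.
  by rewrite -(rmorph1 (map_poly (in_alg E))) eqp_map -size_poly_eq1 (negPf sq) orbF.
have rp : root (map_poly (in_alg E) p) th by rewrite -Dp root_minPoly.
pose Q : {rmorphism rat -> algC} := ratr.
have [r Dr] := closed_field_poly_normal (map_poly Q p).
rewrite lead_coef_map (monicP mp) rmorph1 scale1r in Dr.
have szr : size r = n.
  by apply/eqP; rewrite -eqSS -(size_prod_XsubC r id) -Dr size_map_poly szp.
have ur : uniq r.
  rewrite -separable_prod_XsubC -Dr separable_map -(separable_map (in_alg E)) -Dp.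
  exact: pcharf0_separable.
have rr (i : 'I_n) : root (map_poly Q p) r`_i.
  by rewrite Dr root_prod_XsubC mem_nth // szr.
have /choice [psi psiP] : forall i : 'I_n, exists psi : {rmorphism E -> algC}, psi th = r`_i.
  by move=> i; have [psi _ <-] := embed_adjoin gen irr rp (rr i); exists psi.
pose v (i : 'I_n) := th ^+ i.
have sp z : exists t : 'I_n -> rat, z = \sum_i t i *: v i.
  have /Fadjoin1_polyP [q qz] : z \in <<1; th>>%VS by rewrite gen memvf.
  exists (fun i : 'I_n => (q %% p)`_i); rewrite qz {1}(divp_eq q p) rmorphD rmorphM.
  rewrite !hornerE (rootP rp) mulr0 add0r (@horner_coef_wide _ n) ?size_map_poly; last first.
    by rewrite -ltnS -szp ltn_modp.
  by apply: eq_bigr => i _; rewrite coef_map /= -scalerAl mul1r.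
have [T TP] := choice sp.
pose V : 'M[algC]_n := \matrix_(i, j) psi j (v i).
have uV : V \in unitmx.
  have -> : V = Vandermonde n (\row_j r`_j).
    by apply/matrixP => i j; rewrite !mxE rmorphXn /= psiP.
  rewrite unitmxE det_Vandermonde unitfE; apply/prodf_neq0 => i _.
  apply/prodf_neq0 => j ij; rewrite !mxE subr_eq0 nth_uniq ?szr //.
  by rewrite neq_ltn ij orbT.
pose M z : 'M[rat]_n := \matrix_(i, j) T (z * v i) j.
have MV z : map_mx Q (M z) = V *m diag_mx (\row_j psi j z) *m invmx V.
  apply: (canRL (mulmxK uV)); apply/matrixP => i j; rewrite mul_mx_diag !mxE.
  rewrite mulrC -rmorphM [in RHS](TP (z * v i)) rmorph_sum; apply: eq_bigr => m _.
  by rewrite !mxE rmorphZ_num.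
have tr z : exists t : rat, ratr t = \sum_m psi m z.
  exists (\tr (M z)); rewrite -[ratr _]/(Q _) -trace_map_mx MV.
  rewrite mxtrace_mulC mulmxA mulVmx // mul1mx mxtrace_diag.
  by apply: eq_bigr => i _; rewrite mxE.
have no z : exists t : rat, ratr t = \prod_m psi m z.
  exists (\det (M z)); rewrite -[ratr _]/(Q _) -det_map_mx MV.
  rewrite !det_mulmx mulrAC -det_mulmx mulmxV // det1 mul1r det_diag.
  by apply: eq_bigr => i _; rewrite mxE.
have [t tP] := choice tr.
pose G : 'M[rat]_n := \matrix_(i, j) t (v i * v j).
have GV : map_mx Q G = V *m V^T.
  apply/matrixP => i j; rewrite !mxE [LHS]tP.
  by apply: eq_bigr => m _; rewrite !mxE rmorphM.
have uG : G \in unitmx.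
  by rewrite -(map_unitmx Q) GV unitmx_mul unitmx_tr uV.
pose u j := \sum_i invmx G i j *: v i.
have [D D0 DP] := rat_common_denom (fun ij : 'I_n * 'I_n => invmx G ij.1 ij.2).
have vi i : v i \in @is_int E by rewrite rpredX.
exists psi, v, u, D; split => //.
- exact: adim_gt0.
- move=> j; rewrite scaler_sumr rpred_sum // => i _; rewrite scalerA.
  apply: rat_int_scale; last exact: vi. by have := DP (i, j).
- move=> i j; have /matrixP/(_ i j) := mulmxV uG; rewrite !mxE.
  move=> /(congr1 Q); rewrite rmorph_nat => <-; rewrite rmorph_sum.
  under eq_bigr do rewrite mulr_sumr rmorph_sum.
  rewrite exchange_big; apply: eq_bigr => k _ /=; rewrite rmorphM mxE.
  rewrite -[Q (t _)]/(ratr _) tP mulr_suml; apply: eq_bigr => m _.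
  by rewrite -scalerAr rmorphZ_num mulrC.
- move=> phi; have : root (map_poly Q p) (phi th).
    have -> : map_poly Q p = map_poly phi (map_poly (in_alg E) p).
      by rewrite -map_poly_comp; apply: eq_map_poly => a /=; rewrite rmorphZ_num rmorph1 mulr1.
    by rewrite fmorph_root.
  rewrite Dr root_prod_XsubC => /(nthP 0) [i ir e]; rewrite szr in ir.
  exists (Ordinal ir) => z; have [tz ->] := sp z; rewrite !rmorph_sum.
  by apply: eq_bigr => j _; rewrite !rmorphZ_num !rmorphXn /= psiP -e.
Qed.

(** * Divisibility of algebraic integers *)

Definition idvd (F : fieldType) (x y : F) : Prop :=
  exists2 z, z \in @is_int F & y = x * z.

Lemma idvd0 (F : fieldType) (x : F) : idvd x 0.
Proof. by exists 0; rewrite ?rpred0 ?mulr0. Qed.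

Lemma idvdD (F : fieldType) (x y z : F) : idvd x y -> idvd x z -> idvd x (y + z).
Proof.
by move=> [a ai ->] [b bi ->]; exists (a + b); rewrite ?rpredD // mulrDr.
Qed.

Lemma idvdN (F : fieldType) (x y : F) : idvd x y -> idvd x (- y).
Proof. by move=> [a ai ->]; exists (- a); rewrite ?rpredN // mulrN. Qed.

Lemma idvdB (F : fieldType) (x y z : F) : idvd x y -> idvd x z -> idvd x (y - z).
Proof. by move=> xy xz; apply/idvdD/idvdN. Qed.

Lemma idvd_mulr (F : fieldType) (x y z : F) :
  z \in @is_int F -> idvd x y -> idvd x (y * z).
Proof. by move=> zi [a ai ->]; exists (a * z); rewrite ?rpredM ?mulrA. Qed.

Lemma idvd_mull (F : fieldType) (x y z : F) :
  z \in @is_int F -> idvd x y -> idvd x (z * y).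
Proof. by rewrite mulrC; apply: idvd_mulr. Qed.

Lemma idvd_sum (F : fieldType) (I : Type) (r : seq I) (P : pred I) (x : F) (f : I -> F) :
  (forall i, P i -> idvd x (f i)) -> idvd x (\sum_(i <- r | P i) f i).
Proof. by move=> xf; apply: big_ind => //; [exact: idvd0|exact: idvdD]. Qed.

Lemma idvd_trans (F : fieldType) (x y z : F) : idvd x y -> idvd y z -> idvd x z.
Proof. by move=> xy [a ai ->]; apply: idvd_mulr. Qed.

Lemma idvd_mulK (F : fieldType) (a x y : F) : a != 0 -> idvd (a * x) (a * y) -> idvd x y.
Proof. by move=> a0 [z zi e]; exists z => //; apply: (mulfI a0); rewrite e mulrA. Qed.

Lemma idvd_mul2l (F : fieldType) (a x y : F) : idvd x y -> idvd (a * x) (a * y).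
Proof. by move=> [z zi ->]; exists z => //; rewrite mulrA. Qed.

Lemma idvd_rmorph (F E : fieldType) (f : {rmorphism F -> E}) (x y : F) :
  x != 0 -> idvd (f x) (f y) <-> idvd x y.
Proof.
move=> x0; split=> -[z zi e]; last first.
  by exists (f z); rewrite ?is_int_rmorph // e rmorphM.
exists (y / x); last by rewrite mulrC divfK.
by rewrite -(is_int_rmorph f) fmorph_div e mulrC mulKf ?fmorph_eq0.
Qed.

Lemma idvd_algC_int (p : nat) (m : int) :
  (0 < p)%N -> idvd (p%:R : algC) m%:~R -> (p %| m)%Z.
Proof.
move=> p0 [z zi e]; have pn0 : p%:R != 0 :> rat by rewrite pnatr_eq0 -lt0n.
have ez : z = ratr (m%:~R / p%:R : rat).
  rewrite fmorph_div /= ratr_int ratr_nat e mulrC mulKf //.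
  by rewrite pnatr_eq0 -lt0n.
move: zi; rewrite ez => /is_int_algC_ratr /intrP [q qe].
apply/dvdzP; exists q; apply: (@intr_inj rat).
by rewrite rmorphM /= -qe -pmulrn divfK.
Qed.

Lemma idvd_exprD_prime (F : fieldType) (p : nat) (x y : F) :
  prime p -> x \in @is_int F -> y \in @is_int F ->
  idvd p%:R ((x + y) ^+ p - (x ^+ p + y ^+ p)).
Proof.
move=> pp xi yi; case: p pp => // p pp.
rewrite exprDn big_ord_recl big_ord_recr /= subn0 bin0 expr0 mulr1 mulr1n.
rewrite /bump /= add1n subnn binn expr0 mul1r mulr1n.
set S := \sum_(i < p) _; have -> : x ^+ p.+1 + (S + y ^+ p.+1) - (x ^+ p.+1 + y ^+ p.+1) = S.
  by move: (x ^+ p.+1) (y ^+ p.+1) => a b; ring.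
apply: idvd_sum => i _; have /dvdnP [c ->] : (p.+1 %| 'C(p.+1, 0 + i.+1))%N.
  by apply: prime_dvd_bin => //; rewrite add0n /= ltnS ltn_ord.
exists (x ^+ (p.+1 - (0 + i.+1)) * y ^+ (0 + i.+1) *+ c).
  by rewrite rpredMn // rpredM // rpredX.
by rewrite mulrnA mulr_natl.
Qed.

Lemma idvdX (F : fieldType) (d x y : F) (n : nat) :
  x \in @is_int F -> y \in @is_int F -> idvd d (x - y) -> idvd d (x ^+ n - y ^+ n).
Proof.
move=> xi yi dxy; rewrite subrXX; apply: idvd_mulr => //.
by rewrite rpred_sum // => i _; rewrite rpredM // rpredX.
Qed.

(** Additivity of the iterated Frobenius modulo [p], by induction on [e]: a congruence survives the
    [p]-th power, and one further step is the binomial theorem. *)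
Lemma idvd_expr_sum_prime (F : fieldType) (I : Type) (r : seq I) (p e : nat) (x : I -> F) :
  prime p -> (forall i, x i \in @is_int F) ->
  idvd p%:R ((\sum_(i <- r) x i) ^+ (p ^ e) - \sum_(i <- r) x i ^+ (p ^ e)).
Proof.
move=> pp xi; elim: e => [|e IH].
  by under [X in _ - X]eq_bigr do rewrite expr1; rewrite expr1 subrr; apply: idvd0.
have IHp := @idvdX F p%:R _ _ p _ _ IH.
rewrite expnSr exprM; set y := \sum_(i <- r) x i ^+ (p ^ e).
have si : \sum_(i <- r) x i \in @is_int F by rewrite rpred_sum.
have yi : y \in @is_int F by rewrite rpred_sum // => i _; rewrite rpredX.
rewrite -(subrKA (y ^+ p)); apply: idvdD; first by apply: IHp; rewrite ?rpredX.
rewrite /y; elim: r {y IH IHp si yi} => [|i r IH].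
  by rewrite !big_nil expr0n; case: p pp => // p _; rewrite subrr; apply: idvd0.
rewrite !big_cons; set a := x i ^+ _; set b := \sum_(j <- r) _.
rewrite -(subrKA (a ^+ p + b ^+ p)); apply: idvdD.
  apply: idvd_exprD_prime => //; first by rewrite rpredX.
  by rewrite rpred_sum // => j _; rewrite rpredX.
rewrite exprM -/a opprD addrACA subrr add0r.
by move: IH; under eq_bigr do rewrite exprM.
Qed.

Section FrameTheory.

Variables (E : fieldExtType rat) (n : nat) (psi : 'I_n -> {rmorphism E -> algC}).
Variables (v u : 'I_n -> E) (D : nat) (fr : frame psi v u D).

Local Notation O := (@is_int E).

Lemma psi_int z m : z \in O -> psi m z \in @is_int algC.
Proof. by rewrite is_int_rmorph. Qed.

Lemma frame_trace_int z :
  z \in O -> exists m : int, m%:~R = \sum_i psi i z.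
Proof.
move=> zi; have [t et] := frame_trace fr z.
have : ratr t \in @is_int algC by rewrite et rpred_sum // => m _; exact: psi_int.
by move=> /is_int_algC_ratr /intrP [m em]; exists m; rewrite -et em ratr_int.
Qed.

Lemma frame_norm_int z :
  z \in O -> exists m : int, m%:~R = \prod_i psi i z.
Proof.
move=> zi; have [t et] := frame_norm fr z.
have : ratr t \in @is_int algC by rewrite et rpred_prod // => m _; exact: psi_int.
by move=> /is_int_algC_ratr /intrP [m em]; exists m; rewrite -et em ratr_int.
Qed.

(** The norm is a rational integer of absolute value below 1, hence zero. *)
Lemma frame_small_eq0 z :
  z \in O -> (forall i, `|psi i z| < 1) -> z = 0.
Proof.
move=> zi small; have [m em] := frame_norm_int zi.
have i0 := Ordinal (frame_gt0 fr).
have : `|m%:~R : algC| < 1.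
  rewrite em normr_prod (bigD1 i0) //=; apply: le_lt_trans (small i0).
  rewrite ler_piMr // prodr_ile1 // => i _; rewrite normr_ge0 /=; exact: ltW.
rewrite -intr_norm -[1]/(1%:~R) ltr_int => m1.
have m0 : m = 0 by lia.
move: em; rewrite m0 => /esym/eqP; rewrite prodf_seq_eq0 => /hasP [i _ /=].
by rewrite fmorph_eq0 => /eqP.
Qed.

Lemma frame_coord z (t : 'I_n -> rat) :
  z = \sum_i t i *: v i -> forall i, ratr (t i) = \sum_m psi m (z * u i).
Proof.
move=> -> j; under eq_bigr do rewrite mulr_suml rmorph_sum.
rewrite exchange_big /= (bigD1 j) //= [X in _ + X]big1 ?addr0 => [|i ij].
  under eq_bigr do rewrite -scalerAl rmorphZ_num.
  by rewrite -mulr_sumr (frame_dual fr) eqxx mulr1.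
under eq_bigr do rewrite -scalerAl rmorphZ_num.
by rewrite -mulr_sumr (frame_dual fr) (negPf ij) mulr0.
Qed.

(** The [v i] may span a proper subring of the integers, but [D z] lies in it: its coordinates are
    traces of [z] against the integral elements [D u_i]. *)
Lemma frame_int_coord z : z \in O -> exists a : 'I_n -> int,
  D%:R * z = \sum_i (a i)%:~R * v i /\
  forall i, (a i)%:~R = \sum_m psi m (z * (D%:R *: u i)).
Proof.
move=> zi; have [t ez] := frame_span fr z.
have /choice [a aP] i : exists m : int, m%:~R = \sum_m psi m (z * (D%:R *: u i)).
  by apply: frame_trace_int; rewrite rpredM // (frame_u fr).
exists a; split=> //; rewrite ez mulr_sumr; apply: eq_bigr => i _.
rewrite mulr_natl -scaler_nat scalerA [in RHS]mulrzl.
rewrite -scaler_int; congr (_ *: _); apply: (fmorph_inj (ratr : {rmorphism rat -> algC})).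
rewrite rmorphM /= ratr_nat ratr_int (frame_coord ez) aP mulr_sumr.
by apply: eq_bigr => m _; rewrite -scalerAr rmorphZ_num ratr_nat.
Qed.

Lemma natr_E_neq0 (m : nat) : (0 < m)%N -> m%:R != 0 :> E.
Proof.
move=> m0; rewrite -(fmorph_eq0 (psi (Ordinal (frame_gt0 fr)))) rmorph_nat.
by rewrite pnatr_eq0 -lt0n.
Qed.

(* Frobenius is additive modulo [p], hence the trace of a nilpotent modulo [p]
   vanishes modulo [p]. *)
Lemma frame_radical p z m : prime p -> ~~ (p %| D)%N -> z \in O ->
  idvd p%:R (z ^+ m) -> idvd p%:R z.
Proof.
move=> pp pD zi pz; have p0 : p%:R != 0 :> E by rewrite natr_E_neq0 // prime_gt0.
have pC0 : p%:R != 0 :> algC by rewrite pnatr_eq0 -lt0n prime_gt0.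
have [a [ez aP]] := frame_int_coord zi.
have pa i : (p %| a i)%Z.
  set w := D%:R *: u i in aP *; have wi : w \in O by rewrite (frame_u fr).
  (* [a i] is the trace of [z w]. Its power is congruent to the trace of [(z w) ^ (p ^ m)], and [p]
     divides [z ^ (p ^ m)] because [m <= p ^ m]. *)
  have : (p %| a i ^+ (p ^ m))%Z.
    apply: idvd_algC_int; first exact: prime_gt0.
    rewrite rmorphXn /= aP -/w -[X in idvd _ X](subrK (\sum_j (psi j (z * w)) ^+ (p ^ m))).
    apply: idvdD; first by apply: idvd_expr_sum_prime => // j; rewrite psi_int ?rpredM.
    apply: idvd_sum => j _; rewrite -rmorphXn -(rmorph_nat (psi j)); apply/idvd_rmorph => //.
    rewrite exprMn; apply: idvd_mulr; first by rewrite rpredX.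
    have /subnK <- : (m <= p ^ m)%N by rewrite ltnW // ltn_expl // prime_gt1.
    by rewrite exprD; apply: idvd_mull; rewrite ?rpredX.
  by rewrite !dvdzE abszX /= Euclid_dvdX // => /andP [].
have /choice [b bP] i : exists b, a i = b * p%:Z by apply/dvdzP.
have Dz : idvd p%:R (D%:R * z).
  exists (\sum_i (b i)%:~R * v i).
    by rewrite rpred_sum // => i _; rewrite rpredM ?int_is_int ?(frame_v fr).
  rewrite ez mulr_sumr; apply: eq_bigr => i _.
  by rewrite bP rmorphM /= -pmulrn mulrA [_ * p%:R]mulrC.
have cop : coprime D p by rewrite coprime_sym prime_coprime.
have D0 := frame_D fr.
have [s t e _] := egcdnP p D0; move: e; rewrite (eqP cop) => e.
have -> : z = s%:R * (D%:R * z) - p%:R * (t%:R * z).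
  by rewrite !mulrA -!natrM e natrD [(p * t)%N]mulnC mulrDl mul1r addrAC subrr add0r.
apply: idvdB; first by apply: idvd_mull => //; rewrite rpred_nat.
by exists (t%:R * z) => //; rewrite rpredM ?rpred_nat.
Qed.

Lemma frame_pigeonhole (x : nat -> E) m : (0 < m)%N -> (forall i, x i \in O) ->
  exists i j, (i < j)%N /\ idvd m%:R (x j - x i).
Proof.
move=> m0 xi; have /choice [a aP] i := frame_int_coord (xi i).
(* The coordinates are those of [D x_i], so they must agree modulo [D m] for the [x_i] to agree
   modulo [m]. *)
pose d := (D * m)%N; have d0 : (0 < d)%N by rewrite muln_gt0 (frame_D fr).
have lt i k : (`|a i k %% d|%Z < d)%N.
  by rewrite -ltz_nat gez0_abs ?modz_ge0 ?ltz_pmod // -?lt0n // eqz_nat -lt0n.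
pose c (i : nat) : {ffun 'I_n -> 'I_d} := [ffun k => Ordinal (lt i k)].
have : ~ injective (fun i : 'I_(#|{ffun 'I_n -> 'I_d}|.+1) => c i).
  by move=> /leq_card; rewrite card_ord ltnn.
apply: contra_notP => nex.
have key (i j : nat) : (i < j)%N -> c i <> c j.
  move=> ij eij; apply: nex; exists i, j; split => //.
  have /choice [b bP] k : exists b, a j k - a i k = b * d%:Z.
    have /ffunP/(_ k) := eij; rewrite !ffunE => -[/eqP].
    rewrite -eqz_nat !gez0_abs ?modz_ge0 -?lt0n // eq_sym => /eqP.
    by move=> e; apply/dvdzP; rewrite -eqz_mod_dvd e.
  exists (\sum_k (b k)%:~R * v k).
    by rewrite rpred_sum // => k _; rewrite rpredM ?int_is_int ?(frame_v fr).
  apply: (mulfI (natr_E_neq0 (frame_D fr))).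
  rewrite mulrBr (proj1 (aP i)) (proj1 (aP j)) mulrA -natrM mulr_sumr -sumrB.
  apply: eq_bigr => k _; rewrite -mulrBl -rmorphB bP rmorphM /= -pmulrn.
  by rewrite mulrA [_ * d%:R]mulrC.
move=> i j eij; apply: val_inj; apply/eqP.
by case: (ltngtP i j) => // /key; rewrite eij // => /(_ erefl).
Qed.

(** The integers modulo [p] form a finite reduced ring. By finiteness two iterates of Frobenius
    agree on [z], that is, [z ^ q - z] is nilpotent modulo [p] with [q = p ^ (j - i)]; reducedness
    removes the exponent. The gain is a multiplier [z ^ (q - 1) - 1] which annihilates [z] modulo
    [p]. *)
Lemma frame_power_fixed p z : prime p -> ~~ (p %| D)%N -> z \in O ->
  exists2 q, (1 < q)%N & idvd p%:R (z ^+ q - z).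
Proof.
move=> pp pD zi; have zXi i : z ^+ i \in O by rewrite rpredX.
have [i [j [ij]]] := frame_pigeonhole (prime_gt0 pp) (fun i => zXi (p ^ i)%N).
have /subnKC <- := ltnW ij; rewrite expnD mulnC exprM => dv.
have q1 : (1 < p ^ (j - i))%N by rewrite -(expn0 p) ltn_exp2l ?subn_gt0 ?prime_gt1.
exists (p ^ (j - i))%N => //.
apply: (frame_radical (m := p ^ i) pp pD); first by rewrite rpredB ?rpredX.
set y := z ^+ _ in dv *; have yi : y \in O by rewrite rpredX.
(* The sum over [bool] is the two-term case, with summands [y - z] and [z]. *)
have /(idvd_expr_sum_prime (index_enum bool) i pp) : forall b : bool, (if b then y - z else z) \in O.
  by case; rewrite ?rpredB.
rewrite !big_bool /= subrK => dv2.
have -> : (y - z) ^+ (p ^ i) =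
  (y ^+ (p ^ i) - z ^+ (p ^ i)) - (y ^+ (p ^ i) - ((y - z) ^+ (p ^ i) + z ^+ (p ^ i))).
  by move: (y ^+ _) (z ^+ _) ((y - z) ^+ _) => a b c; ring.
exact: idvdB.
Qed.

End FrameTheory.

(** * Squarefree norms in a box *)

(** A prime ideal of the integers of [F], as a subset of [F]. It is used for [F := algC]: a single
    prime of the ring of all algebraic integers can be tested on all conjugates of an element of
    [E], although [E] need not be normal over the rationals. *)
Record prime_over (F : fieldType) (p : F) (P : set F) : Prop := PrimeOver {
  prime_over_int : forall x, P x -> x \in @is_int F;
  prime_overB : forall x y, P x -> P y -> P (x - y);
  prime_overM : forall x y, x \in @is_int F -> P y -> P (x * y);
  prime_over_p : P p;
  prime_over1 : ~ P 1;
  prime_overP : forall x y, x \in @is_int F -> y \in @is_int F ->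
    P (x * y) -> P x \/ P y }.

(** Zorn's lemma for the ideals that do not generate 1 together with [p]; a maximal one contains [p]
    and is prime. *)
Lemma prime_over_exists (F : fieldType) (p : F) :
  p \in @is_int F -> ~ idvd p 1 -> exists P, prime_over p P.
Proof.
move=> pint pu.
pose good (I : set F) :=
  [/\ forall x, I x -> x \in @is_int F, forall x y, I x -> I y -> I (x - y),
      forall x y, x \in @is_int F -> I y -> I (x * y)
    & forall x y, I x -> y \in @is_int F -> x + p * y <> 1].
have [A [gA mA]] : exists A, good A /\ forall B, A `<` B -> ~ good B.
  apply: Zorn_bigcup => X gX tX; split.
  - by move=> x [I XI Ix]; case: (gX _ XI) => h _ _ _; apply: h.
  - move=> x y [I XI Ix] [J XJ Jy].
    have [IJ|JI] := tX _ _ XI XJ.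
      by exists J => //; case: (gX _ XJ) => _ h _ _; apply: h => //; apply: IJ.
    by exists I => //; case: (gX _ XI) => _ h _ _; apply: h => //; apply: JI.
  - by move=> x y xi [I XI Ix]; exists I => //; case: (gX _ XI) => _ _ h _; apply: h.
  - by move=> x y [I XI Ix]; case: (gX _ XI) => _ _ _; apply.
have [iA subA mulA neA] := gA.
(* The union of the empty chain is empty, so [good] cannot ask for [0]; [A0] restores it until [A0A]
   is available. *)
pose A0 := A `|` [set 0].
have iA0 x : A0 x -> x \in @is_int F by case=> [/iA //|->]; rewrite rpred0.
have subA0 x y : A0 x -> A0 y -> A0 (x - y).
  move=> [Ax|->] [Ay|->]; rewrite ?subr0 ?sub0r; try by [left; auto|right].
  by left; rewrite -mulN1r; apply: mulA; rewrite ?rpredN1.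
have mulA0 x y : x \in @is_int F -> A0 y -> A0 (x * y).
  by move=> xi [Ay|->]; [left; auto|right; rewrite /= mulr0].
(* Maximality: the ideal generated by [A] and an integer outside it yields 1 together with [p]. *)
have ext w : w \in @is_int F -> ~ A w ->
    exists a z t, [/\ A0 a, z \in @is_int F, t \in @is_int F & a + w * z + p * t = 1].
  move=> wi nAw; apply: contrapT => nex.
  pose B := [set x | exists a z, [/\ A0 a, z \in @is_int F & x = a + w * z]].
  apply: (mA B).
    split.
      by move=> x Ax; exists x, 0; rewrite rpred0 mulr0 addr0; split=> //; left.
    move=> /(_ w) BA; apply: nAw; apply: BA.
    by exists 0, 1; rewrite rpred1 mulr1 add0r; split=> //; right.
  split.
  - by move=> _ [a [z [/iA0 ai zi ->]]]; rewrite rpredD ?rpredM.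
  - move=> _ _ [a [z [Aa zi ->]]] [b [y [Ab yi ->]]]; exists (a - b), (z - y).
    by split; [exact: subA0|rewrite rpredB|rewrite mulrBr opprD addrACA].
  - move=> x _ xi [a [z [Aa zi ->]]]; exists (x * a), (x * z).
    by split; [exact: mulA0|rewrite rpredM|rewrite mulrDr mulrCA].
  - by move=> _ t [a [z [Aa zi ->]]] ti e; apply: nex; exists a, z, t.
have Ap : A p.
  apply: contrapT => /(ext _ pint) [a [z [t [Aa zi ti]]]].
  rewrite -addrA -mulrDr => e; have zti : z + t \in @is_int F by rewrite rpredD.
  case: Aa => [Aa|a0]; first exact: (neA _ _ Aa zti).
  by apply: pu; exists (z + t) => //; rewrite -e a0 add0r.
have A0A x : A0 x -> A x by case=> // ->; rewrite -(subrr p); exact: subA.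
have n1 : ~ A 1.
  by move=> A1; apply: (neA _ 0 A1); rewrite ?rpred0 // mulr0 addr0.
have addA x y : A x -> A y -> A (x + y).
  move=> Ax Ay; rewrite -[y]opprK -[- y]sub0r; apply: (subA _ _ Ax).
  by apply: (subA _ _ _ Ay); apply: A0A; right.
exists A; split => // x y xi yi Axy; apply: contrapT => /not_orP [nx ny]; apply: n1.
have [a [z [t [/A0A Aa zi ti e]]]] := ext _ xi nx.
have [b [s [r [/A0A Ab si ri e']]]] := ext _ yi ny.
(* The product of the two representations of 1, sorted so that each term has a factor in [A] or the
   factor [x * y]. *)
have -> : 1 = (b + y * s + p * r) * (a + p * t) + (x * z) * (b + p * r) + (z * s) * (x * y) :> F.
  rewrite -[LHS]mulr1 -{1}e' -{1}e; ring.
have iap : A (a + p * t) by apply: addA => //; rewrite mulrC; apply: mulA.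
have ibp : A (b + p * r) by apply: addA => //; rewrite mulrC; apply: mulA.
have t1 : A ((b + y * s + p * r) * (a + p * t)) by apply: mulA => //; rewrite e' rpred1.
have t2 : A (x * z * (b + p * r)) by apply: mulA => //; rewrite rpredM.
have t3 : A (z * s * (x * y)) by apply: mulA => //; rewrite rpredM.
exact: (addA _ _ (addA _ _ t1 t2) t3).
Qed.

Lemma rpredX_gt0 (F : fieldType) (p : F) (P : set F) (x : F) (n : nat) :
  prime_over p P -> (0 < n)%N -> P x -> P (x ^+ n).
Proof.
case: n => // n pP _ Px; rewrite exprSr; apply: (prime_overM pP) => //.
by rewrite rpredX // (prime_over_int pP).
Qed.

Lemma prime_over_prod (F : fieldType) (p : F) (P : set F) (I : eqType) (r : seq I)
    (Q : pred I) (f : I -> F) :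
  prime_over p P -> (forall i, f i \in @is_int F) -> P (\prod_(i <- r | Q i) f i) ->
  exists2 i, Q i & P (f i).
Proof.
move=> pP fi; elim: r => [|i r IH]; first by rewrite big_nil => /(prime_over1 pP).
rewrite big_cons; case: ifP => // Qi.
move=> /(prime_overP pP) []; rewrite ?rpred_prod //; first by exists i.
Qed.

Section Sieve.

Variables (E : fieldExtType rat) (n : nat) (psi : 'I_n -> {rmorphism E -> algC}).
Variables (v u : 'I_n -> E) (D : nat) (fr : frame psi v u D).
Variables (p : nat) (pp : prime p) (pD : ~~ (p %| D)%N).

Local Notation O := (@is_int E).

Lemma prime_nonunit_algC : ~ idvd (p%:R : algC) 1.
Proof.
move=> /(@idvd_algC_int p 1 (prime_gt0 pp)); rewrite dvdzE /= dvdn1 => /eqP p1.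
by move: pp; rewrite p1.
Qed.

Variables (P : set algC) (pP : prime_over (p%:R : algC) P).

Lemma prime_over_intr (m : int) : P m%:~R -> (p %| m)%Z.
Proof.
move=> Pm; apply: contrapT => /negP npm.
have [[a b]] : exists ab : int * int, ab.1 * m + ab.2 * p = 1.
  have := Bezoutz m p; rewrite /gcdz.
  have -> : gcdn `|m| `|p| = 1%N.
    by apply/eqP; rewrite gcdnC -[_ == _]/(coprime _ _) prime_coprime.
  by move=> [a [b e]]; exists (a, b).
move=> /= /(congr1 (intr : int -> algC)); rewrite rmorphD !rmorphM /= => e.
apply: (prime_over1 pP); rewrite -[1]/(1%:~R) -e -[X in _ + X]opprK -mulNr.
by apply: (prime_overB pP); apply: (prime_overM pP);
  rewrite ?rpredN ?rpred_int //; exact: prime_over_p.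
Qed.

(* Divisibility by [p ^ 2] in the localization at [P]. *)
Definition loc_sq (x : algC) : Prop :=
  exists c, [/\ c \in @is_int algC, ~ P c & idvd ((p ^ 2)%:R) (c * x)].

Lemma loc_sqB x y : loc_sq x -> loc_sq y -> loc_sq (x - y).
Proof.
move=> [c [ci nc cx]] [d [di nd dy]]; exists (c * d); split; rewrite ?rpredM //.
  by move=> /(prime_overP pP) [].
rewrite mulrBr; apply: idvdB; last by rewrite -mulrA; apply: idvd_mull.
by rewrite mulrAC; apply: idvd_mulr.
Qed.

(** The rational integers in [P] are the multiples of [p], so a multiplier outside [P] does not hide
    divisibility by [p]; this is applied to [m] and then to [m / p]. *)
Lemma loc_sq_int (m : int) : loc_sq m%:~R -> ((p ^ 2)%N %| m)%Z.
Proof.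
have p0 : p%:R != 0 :> algC by rewrite pnatr_eq0 -lt0n prime_gt0.
have key (k : int) c : c \in @is_int algC -> ~ P c -> idvd (p%:R) (c * k%:~R) -> (p %| k)%Z.
  move=> ci nc [z zi e]; apply: prime_over_intr.
  have := prime_overM pP zi (prime_over_p pP); rewrite mulrC -e.
  by move=> /(prime_overP pP) []; rewrite ?rpred_int.
move=> [c [ci nc d]]; have /dvdzP [k ek] : (p %| m)%Z.
  by apply: (key _ c) => //; move: d => [z zi ->]; exists (p%:R * z);
    rewrite ?rpredM ?rpred_nat // mulrA -natrM mulnn.
have /dvdzP [k' ek'] : (p %| k)%Z.
  apply: (key _ c) => //; apply: (idvd_mulK p0); rewrite -natrM mulnn.
  by move: d; rewrite ek intrM -pmulrn mulrA mulrC.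
by apply/dvdzP; exists k'; rewrite ek ek' -mulrA -PoszM mulnn.
Qed.

(** Each of the two conjugates in [P] is divisible by [p] after multiplication by the conjugate of
    [z ^ (q - 1) - 1], which lies outside [P]. This is where it matters that [p] does not divide
    [D]. *)
Lemma loc_sq_mul i j z : i != j -> z \in O -> P (psi i z) -> P (psi j z) ->
  loc_sq (\prod_k psi k z).
Proof.
move=> ij zi; have half k : P (psi k z) ->
    exists c, [/\ c \in @is_int algC, ~ P c & idvd p%:R (c * psi k z)].
  move=> Pz; have [q q1 dq] := frame_power_fixed fr pp pD zi.
  exists (psi k (z ^+ q.-1 - 1)); split.
  - by rewrite is_int_rmorph rpredB ?rpredX ?rpred1.
  - rewrite rmorphB rmorph1 rmorphXn /= => h; apply: (prime_over1 pP).
    rewrite -(subKr (psi k z ^+ q.-1) 1); apply: (prime_overB pP) => //.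
    by apply: (rpredX_gt0 pP) => //; case: (q) q1 => [|[]].
  - rewrite -rmorphM mulrBl mul1r -exprSr prednK ?(ltnW q1) // -(rmorph_nat (psi k)).
    by apply/idvd_rmorph => //; apply: (natr_E_neq0 fr); rewrite prime_gt0.
move=> /half [c [ci nc cd]] /half [d [di nd dd]]; exists (c * d); split.
- by rewrite rpredM.
- by move=> /(prime_overP pP) [].
rewrite (bigD1 i) //= (bigD1 j) 1?eq_sym //= !mulrA.
have -> : c * d * psi i z * psi j z = (c * psi i z) * (d * psi j z) by ring.
apply: idvd_mulr; first by rewrite rpred_prod // => k _; rewrite is_int_rmorph.
case: cd dd => [x xi ->] [y yi ->]; exists (x * y); first by rewrite rpredM.
by rewrite -mulnn natrM mulrACA.
Qed.

(* When [p ^ 2] divides the norm of [z], some color [(i, j)] applies to [z].  Unlike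
   the divisibility, a color is stable under subtraction, which allows packing. *)
Definition sieve_color (i j : 'I_n) (z : E) : Prop :=
  if i == j then loc_sq (psi i z) else P (psi i z) /\ P (psi j z).

Lemma sieve_colorB i j z w :
  sieve_color i j z -> sieve_color i j w -> sieve_color i j (z - w).
Proof.
rewrite /sieve_color; case: ifP => _; first by rewrite rmorphB; apply: loc_sqB.
by move=> [zi zj] [wi wj]; rewrite !rmorphB; split; apply: (prime_overB pP).
Qed.

Lemma sieve_color_norm i j z (m : int) : z \in O -> sieve_color i j z ->
  m%:~R = \prod_k psi k z -> ((p ^ 2)%N %| m)%Z.
Proof.
move=> zi; rewrite /sieve_color; case: eqP => [_ [c [ci nc cz]] em|/eqP ij [zP zQ] em].
  apply: loc_sq_int; exists c; split => //; rewrite em (bigD1 i) //= mulrA.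
  by apply: idvd_mulr => //; rewrite rpred_prod // => k _; rewrite is_int_rmorph.
by apply: loc_sq_int; rewrite em; apply: (loc_sq_mul ij).
Qed.

(** Some conjugate lies in [P]. If a second one does, the pair is a color. Otherwise the product of
    all the others is outside [P] and serves as the multiplier that moves the divisibility by
    [p ^ 2] from the norm to a single conjugate. *)
Lemma norm_sieve_color z (m : int) : z \in O -> m%:~R = \prod_k psi k z ->
  ((p ^ 2)%N %| m)%Z -> exists i j, sieve_color i j z.
Proof.
move=> zi em pm; have zk k : psi k z \in @is_int algC by rewrite is_int_rmorph.
have dv : idvd ((p ^ 2)%:R) (\prod_k psi k z).
  move: pm => /dvdzP [q qe]; exists q%:~R; first by rewrite rpred_int.
  by rewrite -em qe intrM -pmulrn mulrC.
have [i _ Pi] : exists2 i, true & P (psi i z).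
  apply: (prime_over_prod pP (r := index_enum _) zk); case: dv => y yi ->.
  by rewrite -mulnn natrM -mulrA mulrC; apply: (prime_overM pP);
    rewrite ?rpredM ?rpred_nat //; apply: (prime_over_p pP).
have [[j ij Pj]|nex] := pselect (exists2 j, j != i & P (psi j z)).
  by exists i, j; rewrite /sieve_color eq_sym (negPf ij).
exists i, i; rewrite /sieve_color eqxx; exists (\prod_(k | k != i) psi k z); split.
- by rewrite rpred_prod.
- by move=> /(prime_over_prod pP zk) [k ki Pk]; apply: nex; exists k.
- by move: dv; rewrite (bigD1 i) //= mulrC.
Qed.

End Sieve.

(** * Packing of one color in the box *)

Section Packing.

Variables (E : fieldExtType rat) (n : nat) (psi : 'I_n -> {rmorphism E -> algC}).
Variables (v u : 'I_n -> E) (D : nat) (fr : frame psi v u D).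
Variables (C : nat) (C0 : (0 < C)%N).
Variable (vC : forall i, \sum_j `|psi i (v j)| <= C%:R).

Local Notation O := (@is_int E).

Definition lat (a : 'I_n -> int) : E := \sum_j (a j)%:~R * v j.

Lemma lat_int a : lat a \in O.
Proof. by rewrite rpred_sum // => j _; rewrite rpredM ?int_is_int ?(frame_v fr). Qed.

Lemma latB a b : lat a - lat b = lat (fun j => a j - b j).
Proof. by rewrite -sumrB; apply: eq_bigr => j _; rewrite -mulrBl rmorphB. Qed.

Lemma lat_inj0 a : lat a = 0 -> forall j, a j = 0.
Proof.
move=> a0 j; have e : 0 = \sum_i ((a i)%:~R : rat) *: v i.
  by rewrite -[LHS]a0 /lat; apply: eq_bigr => i _; rewrite scaler_int mulrzl.
have := frame_coord fr e j; rewrite ratr_int big1 => [|m _]; last by rewrite mul0r rmorph0.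
by move=> /eqP; rewrite intr_eq0 => /eqP.
Qed.

Lemma lat_bound a (B : nat) i :
  (forall j, (`|a j| <= B)%N) -> `|psi i (lat a)| <= (C * B)%:R.
Proof.
move=> aB; rewrite rmorph_sum; apply: le_trans (ler_norm_sum _ _ _) _.
rewrite mulnC natrM; apply: le_trans (ler_wpM2l (ler0n _ B) (vC i)).
rewrite mulr_sumr; apply: ler_sum => j _; rewrite rmorphM normrM rmorph_int.
by rewrite ler_wpM2r // -intr_norm -abszE pmulrn ler_nat.
Qed.

Lemma norm_bound z (X : algC) (m : int) : m%:~R = \prod_i psi i z ->
  (forall i, `|psi i z| <= X) -> (`|m|%N%:R : algC) <= X ^+ n.
Proof.
move=> em zX; rewrite pmulrn abszE intr_norm em normr_prod.
rewrite -[n in X ^+ n]card_ord -prodr_const; apply: ler_prod => i _.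
by rewrite normr_ge0 zX.
Qed.

(** The box is cut into cubes of side [s], the largest with [(C s) ^ n < p ^ 2]. Two points of the
    same color in one cube differ by an element whose norm is a multiple of [p ^ 2] and smaller than
    [p ^ 2], hence they coincide. So there are at most as many points as cubes, and maximality of
    [s] gives [p ^ 2 <= (2 C s) ^ n]. *)
Lemma color_count (p M A : nat) (c0 : E) (H : E -> Prop) :
  prime p -> ~~ (p %| M)%N -> (C ^ n < p ^ 2)%N ->
  (forall z w, H z -> H w -> H (z - w)) ->
  (forall z (m : int), z \in O -> H z -> m%:~R = \prod_k psi k z -> ((p ^ 2)%N %| m)%Z) ->
  (#|[set a : {ffun 'I_n -> 'I_A} | `[< H (c0 + M%:R * lat (fun j => (a j : nat)%:Z))%R >]]%SET|
     * p ^ 2 <= p ^ 2 + (4 * C * A) ^ n)%N.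
Proof.
move=> pp pM Cp HB Hn; set S := [set a | _]%SET.
have n0 := frame_gt0 fr; have p20 : (0 < p ^ 2)%N by rewrite expn_gt0 prime_gt0.
have ex : exists s, ((C * s) ^ n < p ^ 2)%N by exists 1%N; rewrite muln1.
have bd s : ((C * s) ^ n < p ^ 2)%N -> (s <= p ^ 2)%N.
  move=> h; apply: ltnW; apply: leq_ltn_trans h; apply: leq_trans (leq_pmull s C0) _.
  by rewrite -{1}[(C * s)%N]expn1; case: (C * s)%N => [|k]; [rewrite !exp0n|rewrite leq_pexp2l].
case: (ex_maxnP ex bd) => s sP smax.
have s1 : (0 < s)%N by apply: smax; rewrite muln1.
have s2 : (p ^ 2 <= (2 * C * s) ^ n)%N.
  rewrite leqNgt; apply/negP => h; have : ((C * s.+1) ^ n < p ^ 2)%N.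
    apply: leq_ltn_trans h; rewrite leq_exp2r // [(2 * C)%N]mulnC -mulnA leq_mul2l.
    by rewrite mul2n -addnn -addn1 leq_add2l s1 orbT.
  by move=> /smax; rewrite ltnn.
have lt (k : 'I_A) : (k %/ s < (A %/ s).+1)%N by rewrite ltnS leq_div2r // ltnW.
pose c (a : {ffun 'I_n -> 'I_A}) : {ffun 'I_n -> 'I_(A %/ s).+1} :=
  [ffun j => Ordinal (lt (a j))].
have gen (t q x y k k' : nat) : (x < t -> y < t -> k = q * t + x -> k' = q * t + y ->
    `|k%:Z - k'%:Z| <= t.-1)%N by move: (q * t)%N => z; lia.
have cinj : {in S &, injective c}.
  move=> a b; rewrite !inE => Ha Hb cab.
  pose d j : int := (a j : nat)%:Z - (b j : nat)%:Z.
  have ds j : (`|d j| <= s.-1)%N.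
    have /ffunP/(_ j) := cab; rewrite !ffunE => -[e].
    rewrite /d; apply: (gen _ _ _ _ _ _ (ltn_pmod _ s1) (ltn_pmod _ s1) _ (divn_eq _ _)).
    by rewrite -e; exact: divn_eq.
  have Hd : H (M%:R * lat d).
    by have := HB _ _ Ha Hb; rewrite opprD addrACA subrr add0r -mulrBr latB.
  have [m em] := frame_norm_int fr (lat_int d).
  (* The difference carries the factor [M], so its norm is [M ^ n m]; since [p] does not divide [M],
     the whole [p ^ 2] falls on [m]. *)
  have m0 : m = 0.
    have : ((p ^ 2)%N %| (M%:Z ^+ n * m))%Z.
      apply: (Hn _ _ _ Hd); first by rewrite rpredM ?rpred_nat ?lat_int.
      under eq_bigr do rewrite rmorphM rmorph_nat.
      by rewrite big_split /= prodr_const card_ord -em intrM rmorphXn /= -pmulrn.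
    rewrite dvdzE abszM abszX /= Gauss_dvdr; last first.
      by rewrite coprimeXl // coprimeXr // prime_coprime.
    move=> /dvdn_leq dl; have [/eqP|/dl] := posnP `|m|; first by rewrite absz_eq0 => /eqP.
    have : (`|m| < p ^ 2)%N; last by rewrite ltnNge => /negbTE ->.
    apply: leq_ltn_trans sP; rewrite -(ler_nat algC) natrX.
    apply: (norm_bound em) => i; apply: le_trans (lat_bound i ds) _.
    by rewrite ler_nat leq_mul2l leq_pred orbT.
  have d0 : lat d = 0.
    apply/eqP; move: em; rewrite m0 => /esym/eqP; rewrite prodf_seq_eq0.
    by move=> /hasP [i _ /=]; rewrite fmorph_eq0.
  apply/ffunP => j; apply: val_inj => /=; have := lat_inj0 d0 j.
  by rewrite /d => /eqP; rewrite subr_eq0 => /eqP [].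
have := card_in_imset cinj => e.
have : (#|S| <= (A %/ s).+1 ^ n)%N.
  by rewrite -e; apply: leq_trans (max_card _) _; rewrite card_ffun !card_ord.
(* A box smaller than a cube contains at most one point, which accounts for the summand [p ^ 2].
   Otherwise rounding up the number of cubes costs a factor 2 in each direction. *)
have [sA|As] := leqP s A; last first.
  by rewrite divn_small // exp1n => h; rewrite (leq_trans (leq_mul h (leqnn _))) // mul1n leq_addr.
move=> h; apply: leq_trans (leq_addl _ _).
apply: leq_trans (leq_mul h s2) _; rewrite -expnMn leq_exp2r //.
have h2 : ((A %/ s).+1 * s <= 2 * A)%N.
  by rewrite mulSn mul2n -addnn leq_add // leq_trunc_div.
move: (A %/ s).+1 h2 => x h2.
have -> : (x * (2 * C * s) = 2 * C * (x * s))%N by ring.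
have -> : (4 * C * A = 2 * C * (2 * A))%N by ring.
by rewrite leq_mul2l h2 orbT.
Qed.

End Packing.

Lemma card_bigcup_leq (T : finType) (I : Type) (r : seq I) (Q : pred I) (F : I -> {set T}) :
  (#|\bigcup_(i <- r | Q i) F i|%SET <= \sum_(i <- r | Q i) #|F i|)%N.
Proof.
elim/big_rec2: _ => [|i S k _ h]; first by rewrite cards0.
by rewrite (leq_trans (leq_card_setU _ _)) // leq_add2l.
Qed.

(** Telescoping with [(y + 1) ^- 2 <= y^-1 - (y + 1)^-1]; the induction carries the sharper bound
    [M0^-1 - Y^-1]. *)
Lemma sum_inv_sqr (M0 Y : nat) : (0 < M0)%N ->
  \sum_(p < Y.+1 | (M0 < p)%N) ((p : nat)%:R ^- 2 : rat) <= M0%:R^-1.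
Proof.
move=> M00; have [YM|MY] := ltnP Y M0.
  by rewrite big1 ?invr_ge0 // => p h; have := ltn_trans h (leq_ltn_trans (leq_ord p) YM); rewrite ltnn.
rewrite -(subnKC MY); move: (Y - M0)%N => k {Y MY}.
apply: (@le_trans _ _ (M0%:R^-1 - (M0 + k)%:R^-1)); last first.
  by rewrite lerBlDr lerDl invr_ge0.
elim: k => [|k IH].
  rewrite addn0 subrr big1 // => p h; have := leq_trans h (leq_ord p); by rewrite ltnn.
rewrite addnS big_mkcond big_ord_recr /= -big_mkcond /= ltnS leq_addr.
apply: le_trans (lerD IH (lexx _)) _.
have y0 : 0 < (M0 + k)%:R :> rat by rewrite ltr0n addn_gt0 M00.
rewrite -natr1; move: (M0 + k)%:R y0 (M0%:R^-1) => y y0 x.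
have y1 : 0 < y + 1 by rewrite addr_gt0.
rewrite -addrA lerD2l -subr_ge0.
have -> : - (y + 1)^-1 - (- y^-1 + (y + 1) ^- 2) = y^-1 * (y + 1) ^- 2.
  by field; rewrite !gt_eqF.
by rewrite mulr_ge0 // invr_ge0 ?exprn_ge0 // ltW.
Qed.

Section SieveCount.

Variables (E : fieldExtType rat) (n : nat) (psi : 'I_n -> {rmorphism E -> algC}).
Variables (v u : 'I_n -> E) (D : nat) (fr : frame psi v u D).
Variables (C : nat) (C0 : (0 < C)%N).
Variable (vC : forall i, \sum_j `|psi i (v j)| <= C%:R).

Local Notation O := (@is_int E).

(* The summand [N0 * A] makes all absolute values of the element large in
   comparison with the differences between two elements. *)
Definition box_elt (M N0 A : nat) (a : {ffun 'I_n -> 'I_A}) : E :=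
  1 + M%:R * ((N0 * A)%:R + lat v (fun j => (a j : nat)%:Z)).

Definition sqfree_norm (z : E) : Prop := forall (p : nat) (m : int),
  prime p -> m%:~R = \prod_i psi i z -> ~~ ((p ^ 2)%N %| m)%Z.

Lemma box_elt_int M N0 A (a : {ffun 'I_n -> 'I_A}) : box_elt M N0 a \in O.
Proof. by rewrite rpredD ?rpred1 // rpredM ?rpredD ?rpred_nat ?(lat_int fr). Qed.

Lemma box_elt_bound M N0 A (a : {ffun 'I_n -> 'I_A}) i : (0 < A)%N -> (0 < M)%N ->
  `|psi i (box_elt M N0 a)| <= (M * (N0 + C + 1) * A)%:R.
Proof.
move=> A0 M0; rewrite /box_elt rmorphD rmorph1 rmorphM rmorphD !rmorph_nat.
have aA j : (`|(a j : nat)%:Z| <= A)%N by rewrite absz_nat ltnW.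
apply: le_trans (ler_normD _ _) _; rewrite normr1 normrM normr_nat.
have h : `|(N0 * A)%:R + psi i (lat v (fun j => (a j : nat)%:Z))| <= (N0 * A + C * A)%:R.
  apply: le_trans (ler_normD _ _) _; rewrite normr_nat natrD lerD2l.
  exact: (lat_bound vC).
apply: le_trans (lerD (lexx _) (ler_wpM2l (ler0n _ M) h)) _.
rewrite -natrM -[1]/(1%:R) -natrD ler_nat.
have -> : (M * (N0 + C + 1) * A = M * A + M * (N0 * A + C * A))%N by ring.
by rewrite leq_add2r muln_gt0 M0 A0.
Qed.

Definition bad_set (p M N0 A : nat) : {set {ffun 'I_n -> 'I_A}} :=
  [set a | `[< exists2 m : int, m%:~R = \prod_i psi i (box_elt M N0 a) &
                 ((p ^ 2)%N %| m)%Z >]]%SET.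

(** One prime above [p] suffices and there are [n ^ 2] colors. The constant part of a box element
    drops out of the packing argument, which only sees differences. *)
Lemma card_bad (p M N0 A : nat) : prime p -> (D %| M)%N -> ~~ (p %| M)%N ->
  (C ^ n < p ^ 2)%N ->
  (#|bad_set p M N0 A| * p ^ 2 <= n ^ 2 * (p ^ 2 + (4 * C * A) ^ n))%N.
Proof.
move=> pp DM pM Cp.
have pD : ~~ (p %| D)%N by apply: contra pM => /dvdn_trans; apply.
have [P pP] := prime_over_exists (rpred_nat _ _) (prime_nonunit_algC pp).
pose S (ij : 'I_n * 'I_n) := [set a : {ffun 'I_n -> 'I_A} |
  `[< sieve_color psi p P ij.1 ij.2
        (1 + M%:R * (N0 * A)%:R + M%:R * lat v (fun j => (a j : nat)%:Z)) >]]%SET.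
have cS ij : (#|S ij| * p ^ 2 <= p ^ 2 + (4 * C * A) ^ n)%N.
  apply: (color_count fr C0 vC) => //.
    by move=> z w; apply: (sieve_colorB pP).
  by move=> z m zi; apply: (sieve_color_norm fr pp pD pP).
have sub : bad_set p M N0 A \subset (\bigcup_ij S ij)%SET.
  apply/fintype.subsetP => a; rewrite inE => /asboolP [m em pm].
  have [i [j col]] := norm_sieve_color pP (box_elt_int M N0 a) em pm.
  apply/bigcupP; exists (i, j) => //; rewrite inE; apply/asboolP => /=.
  by move: col; rewrite /box_elt mulrDr addrA.
apply: leq_trans (leq_mul (leq_trans (subset_leq_card sub) (card_bigcup_leq _ _ _)) (leqnn _)) _.
rewrite big_distrl /= (leq_trans (leq_sum _ (fun ij _ => cS ij))) //.
by rewrite sum_nat_const card_prod card_ord mulnn.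
Qed.

Lemma norm_box_elt_mod (p M N0 A : nat) (a : {ffun 'I_n -> 'I_A}) (m : int) :
  prime p -> (p %| M)%N -> m%:~R = \prod_i psi i (box_elt M N0 a) -> ~~ (p %| m)%Z.
Proof.
move=> pp pM em; apply/negP => /dvdzP [q qe].
apply: (prime_nonunit_algC pp).
have [c ci] : exists2 c, c \in @is_int algC & m%:~R = 1 + p%:R * c.
  rewrite em; apply: (big_ind (fun x : algC => exists2 c, c \in @is_int algC & x = 1 + p%:R * c)).
  - by exists 0; rewrite ?rpred0 // mulr0 addr0.
  - move=> _ _ [x xi ->] [y yi ->]; exists (x + y + p%:R * x * y); last by ring.
    by rewrite !rpredD // !rpredM ?rpred_nat.
  - move=> i _; have /dvdnP [k ->] := pM.
    exists (psi i (k%:R * ((N0 * A)%:R + lat v (fun j => (a j : nat)%:Z)))).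
      by rewrite is_int_rmorph rpredM ?rpredD ?rpred_nat ?(lat_int fr).
    by rewrite /box_elt natrM rmorphD rmorph1 !rmorphM !rmorph_nat; ring.
rewrite qe intrM -pmulrn => e; exists (q%:~R - c); first by rewrite rpredB ?rpred_int.
by rewrite mulrBr [_ * q%:~R]mulrC e addrK.
Qed.

(** Primes dividing [M] never divide the norm, as box elements are 1 modulo [M]. The remaining ones
    exceed [M0], and those above a cutoff [Y] have squares larger than the norm. The primes in
    between spoil at most [n ^ 2 (1 + (4 C A) ^ n / p ^ 2)] elements each. *)
Lemma sieve_exists : exists M0 : nat, forall M, (1 < M)%N -> (D %| M)%N ->
  (forall p, prime p -> (p <= M0)%N -> (p %| M)%N) ->
  forall N0, exists A0, forall A, (A0 <= A)%N -> (0 < A)%N /\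
    (A ^ n <= 2 * #|[set a : {ffun 'I_n -> 'I_A} | `[< sqfree_norm (box_elt M N0 a) >]]%SET|)%N.
Proof.
have n0 := frame_gt0 fr.
(* The first summand keeps the total [n ^ 2 (4 C A) ^ n / M0] below [A ^ n / 4]; the second gives
   the condition [C ^ n < p ^ 2] of the packing bound. *)
pose M0 := (4 * n ^ 2 * (4 * C) ^ n + C ^ n)%N.
exists M0 => M M1 DM Mp N0; pose B := (M * (N0 + C + 1))%N.
exists (64 * n ^ 4 * B)%N => A A0.
have B0 : (0 < B)%N by rewrite muln_gt0 (ltnW M1) addn1.
have Apos : (0 < A)%N by apply: leq_trans A0; rewrite !muln_gt0 n0 (ltnW M1) addn1.
split=> //; set G := [set a | _]%SET.
have AB : (64 * n ^ 4 * B ^ n <= A ^ n)%N.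
  rewrite -(leq_exp2r _ _ n0) in A0; apply: leq_trans A0; rewrite expnMn.
  rewrite leq_mul2r; apply/orP; right.
  by rewrite -{1}[(64 * n ^ 4)%N]expn1 leq_pexp2l // !muln_gt0 n0.
(* Small enough for the terms 1 of the bound to add up to at most [A ^ n / 4], and still so large
   that [Y ^ 2] exceeds the bound [(B A) ^ n] for the norm; the latter follows from
   [64 n ^ 4 B ^ n <= A ^ n]. *)
pose Y := (A ^ n %/ (4 * n ^ 2))%N.
have Y1 : (4 * n ^ 2 * Y <= A ^ n)%N by rewrite mulnC leq_trunc_div.
have n2 : (0 < 4 * n ^ 2)%N by rewrite !muln_gt0 n0.
have Bn : (0 < B ^ n)%N by rewrite expn_gt0 B0.
have An : (0 < A ^ n)%N by rewrite expn_gt0 Apos.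
have Y2 : ((B * A) ^ n <= Y ^ 2)%N.
  have Yp : (0 < Y)%N.
    rewrite divn_gt0 //; apply: leq_trans AB; rewrite -[X in (X <= _)%N]muln1 leq_mul // leq_mul //.
    by rewrite leq_pexp2l.
  have h : (A ^ n <= 8 * n ^ 2 * Y)%N.
    have := ltn_ceil (A ^ n) n2; rewrite -/Y => /ltnW /leq_trans; apply.
    by rewrite -addn1 mulnDl mul1n; nia.
  rewrite expnMn -(leq_pmul2r An) -mulnA mulnn.
  have h2 : ((A ^ n) ^ 2 <= (8 * n ^ 2 * Y) ^ 2)%N by rewrite leq_exp2r.
  apply: leq_trans (leq_mul (leqnn _) h2) _.
  have -> : (B ^ n * (8 * n ^ 2 * Y) ^ 2 = Y ^ 2 * (64 * n ^ 4 * B ^ n))%N by ring.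
  by rewrite leq_mul2l AB orbT.
pose Q p := prime p && ~~ (p %| M)%N.
pose Bad := (\bigcup_(p < Y.+1 | Q p) bad_set p M N0 A)%SET.
have GB : (~: Bad \subset G)%SET.
  apply/fintype.subsetP => a; rewrite !inE => nB p m pp em.
  apply/negP => pm; have pM : ~~ (p %| M)%N.
    apply/negP => /(norm_box_elt_mod pp) /(_ em) /negP; apply.
    by apply: dvdz_trans pm; rewrite dvdzE /= dvdn_exp.
  have m0 : `|m|%N != 0%N.
    rewrite absz_eq0; apply/eqP => m0; move: (norm_box_elt_mod (pdiv_prime M1) (pdiv_dvd M) em).
    by rewrite m0 dvdz0.
  have : (p ^ 2 <= Y ^ 2)%N.
    apply: leq_trans Y2; apply: leq_trans (dvdn_leq _ pm) _; first by rewrite lt0n.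
    rewrite -(ler_nat algC) natrX; apply: (norm_bound em) => i.
    by apply: box_elt_bound => //; exact: ltnW.
  rewrite leq_exp2r // => pY; move/negP: nB; apply.
  apply/bigcupP; exists (inord p); rewrite ?inE inordK ?ltnS // /Q ?pp //.
  by exists m.
have cB : (4 * #|Bad| <= 2 * A ^ n)%N.
  have h : (#|Bad| <= \sum_(p < Y.+1 | Q p) #|bad_set p M N0 A|)%N by exact: card_bigcup_leq.
  have QM p : Q p -> (M0 < p)%N.
    by move=> /andP [pp /negP pM]; rewrite ltnNge; apply/negP => /(Mp _ pp).
  have M00 : (0 < M0)%N by rewrite addn_gt0 !expn_gt0 C0 orbT.
  pose X : rat := ((4 * C * A) ^ n)%:R.
  have c1 : #|Bad|%:R <= \sum_(p < Y.+1 | Q p) ((n ^ 2)%:R * (1 + X * p%:R ^- 2)) :> rat.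
    apply: le_trans (_ : (\sum_(p < Y.+1 | Q p) #|bad_set p M N0 A|)%:R <= _).
      by rewrite ler_nat.
    rewrite natr_sum; apply: ler_sum => p Qp; have [pp pM] := andP Qp.
    have p0 : 0 < (p : nat)%:R :> rat by rewrite ltr0n prime_gt0.
    rewrite -(ler_pM2r (exprn_gt0 2 p0)) -mulrA mulrDl mul1r divfK ?gt_eqF ?exprn_gt0 //.
    rewrite -!natrX -natrM -natrD -natrM ler_nat; apply: card_bad => //.
    apply: leq_ltn_trans (leq_addl _ _) _; apply: (leq_trans (QM _ Qp)).
    by rewrite -{1}[p : nat]expn1 leq_pexp2l // prime_gt0.
  have c2 : \sum_(p < Y.+1 | Q p) ((n ^ 2)%:R * (1 + X * p%:R ^- 2)) <=
      (n ^ 2)%:R * (Y%:R + X * M0%:R^-1) :> rat.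
    rewrite -mulr_sumr ler_wpM2l // big_split /= -mulr_sumr lerD //.
      rewrite big_mkcond big_ord_recl /= add0r -[X in _ <= X%:R]card_ord.
      rewrite -sum1_card natr_sum; apply: ler_sum => i _; by case: ifP.
    rewrite ler_wpM2l // (le_trans _ (sum_inv_sqr Y M00)) // [leLHS]big_mkcond [leRHS]big_mkcond.
    apply: ler_sum => p _; have := QM p; case: ifP => [_ -> //|_ _].
    by case: ifP => _ //; rewrite invr_ge0 exprn_ge0.
  rewrite -(ler_nat rat) natrM; apply: le_trans (ler_wpM2l _ (le_trans c1 c2)) _ => //.
  rewrite mulrA -natrM mulrDr -natrM [leRHS]natrM mulr2n mulrDl mul1r lerD //.
    by rewrite ler_nat.
  rewrite mulrA ler_pdivrMr ?ltr0n // -!natrM ler_nat /M0 mulnDr.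
  apply: leq_trans (leq_addr _ _); rewrite expnMn.
  by rewrite [X in (_ <= X)%N]mulnC mulnA.
have := subset_leq_card GB; have := cardsC Bad; rewrite card_ffun !card_ord => <-.
have : (4 * #|Bad| <= 2 * (#|Bad| + #|~: Bad|%SET))%N by rewrite cardsC card_ffun !card_ord.
move: #|Bad| #|~: Bad|%SET #|G| => x y z; lia.
Qed.

End SieveCount.

(** * Index of an ideal *)

Lemma counting_le (R : realType) (T : choiceType) (U : finType) (S : set T) (f : U -> T) :
  S `<=` range f -> (counting S <= (#|U|%:R)%:E :> \bar R)%E.
Proof.
move=> Sf; have fS : finite_set S by apply: sub_finite_set Sf _; exact: finite_image.
rewrite /counting; case: asboolP => // _.
rewrite lee_fin ler_nat -(size_codom f); apply: uniq_leq_size.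
  exact: fset_uniq.
by move=> s; rewrite in_fset_set // inE => /Sf [u _ <-]; exact: codom_f.
Qed.

Lemma counting_ge (R : realType) (T : choiceType) (U : finType) (S : set T)
    (f : U -> T) (m : nat) : (0 < m)%N -> (forall x, S (f x)) ->
  (forall x, #|[set y | f y == f x]%SET| <= m)%N ->
  ((#|U|%:R / m%:R)%:E <= counting S :> \bar R)%E.
Proof.
move=> m0 Sf fm; rewrite /counting; case: asboolP => [fS|_]; last by rewrite leey.
rewrite lee_fin ler_pdivrMr ?ltr0n // -natrM ler_nat cardfE.
have sub : ([set: U]%SET \subset (\bigcup_(s : fset_set S) [set y | f y == val s])%SET).
  apply/fintype.subsetP => x _; have xS : f x \in fset_set S by rewrite in_fset_set ?inE.
  by apply/bigcupP; exists [` xS]%fset; rewrite ?inE.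
rewrite -cardsT (leq_trans (subset_leq_card sub)) // (leq_trans (card_bigcup_leq _ _ _)) //.
rewrite -sum_nat_const; apply: leq_sum => -[s sS] _ /=.
have [->//|] := eqVneq #|[set y | f y == s]%SET| 0%N.
rewrite -lt0n => /card_gt0P [x]; rewrite inE => /eqP <-; exact: fm.
Qed.

Lemma int_valB (F : fieldType) (x y : int_ring F) :
  int_val (x - y) = int_val x - int_val y.
Proof. by []. Qed.

Lemma int_valM (F : fieldType) (x y : int_ring F) :
  int_val (x * y) = int_val x * int_val y.
Proof. by []. Qed.

Lemma int_valD (F : fieldType) (x y : int_ring F) :
  int_val (x + y) = int_val x + int_val y.
Proof. by []. Qed.

Lemma int_val_inj (F : fieldType) : injective (@int_val F).
Proof. exact: val_inj. Qed.

Lemma is_idealP (A : comNzRingType) (I : set A) : is_ideal I <->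
  [/\ I 0, forall x y, I x -> I y -> I (x + y) & forall a x, I x -> I (a * x)].
Proof.
split=> [[I0 IM]|[I0 ID IM]].
  have {}I0 : I 0 by move: I0; rewrite inE.
  have {}IM a x y : I x -> I y -> I (a * x + y).
    by move=> Ix Iy; have := IM a x y; rewrite !inE => /(_ Ix Iy).
  split=> // [x y Ix Iy|a x Ix]; first by have := IM 1 _ _ Ix Iy; rewrite mul1r.
  by have := IM a _ _ Ix I0; rewrite addr0.
split; first by rewrite inE.
by move=> a x y; rewrite !inE => Ix Iy; apply: ID => //; apply: IM.
Qed.

Lemma sum_abs_bound n m (f : 'I_n -> 'I_m -> algC) : exists2 C : nat, (0 < C)%N &
  (forall i, \sum_j `|f i j| <= C%:R) /\ (forall j, \sum_i `|f i j| <= C%:R).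
Proof.
pose S := \sum_i \sum_j `|f i j|.
have S0 : 0 <= S by rewrite sumr_ge0 // => i _; rewrite sumr_ge0.
have SC := ltW (archi_boundP S0); exists (Num.bound S).+1 => //.
have SS : S <= (Num.bound S).+1%:R by apply: le_trans SC _; rewrite ler_nat.
split=> i; apply: le_trans SS; rewrite /S; last rewrite exchange_big /=.
  by rewrite [leRHS](bigD1 i) //= lerDl sumr_ge0 // => j _; rewrite sumr_ge0.
by rewrite [leRHS](bigD1 i) //= lerDl sumr_ge0 // => j _; rewrite sumr_ge0.
Qed.

Lemma floor_frac (q : rat) : exists m : int, 0 <= q - m%:~R < 1.
Proof.
by exists (Num.floor q); rewrite subr_ge0 ltrBlDl; have /andP [-> /=] := floor_itv q; rewrite rmorphD.
Qed.

(* Every residue class modulo [d] has a representative [d * sum_j q_j v_j] with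
   rational [0 <= q_j < 1]; such integers have bounded coordinates. *)
Lemma ideal_norm_bound (R : realType) (E : fieldExtType rat) n
    (psi : 'I_n -> {rmorphism E -> algC}) (v u : 'I_n -> E) (D : nat) :
  frame psi v u D -> exists C : nat, forall (I : set (int_ring E)) (d : int_ring E) (X : nat),
    is_ideal I -> I d -> int_val d != 0 -> (0 < X)%N ->
    (forall i, `|psi i (int_val d)| <= X%:R) ->
    (ideal_norm R I <= ((C * X ^ n)%:R)%:E)%E.
Proof.
move=> fr.
have [C1 C10 [C1P _]] := sum_abs_bound (fun i j => psi i (v j)).
have [C2 C20 [_ C2P]] := sum_abs_bound (fun m i => psi m (D%:R *: u i)).
exists ((3 * (C1 * C2)) ^ n)%N => I d X /is_idealP [I0 ID IM] Id d0 X0 dX.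
have IN x : I x -> I (- x) by move=> Ix; rewrite -mulN1r; apply: IM.
pose K := (C1 * C2 * X)%N; have K0 : (0 < K)%N by rewrite !muln_gt0 C10 C20.
pose T := {ffun 'I_n -> 'I_(2 * K).+1}.
(* A class is encoded by the coordinates of [D r] for its reduced representative [r], shifted by [K]
   to become nonnegative. *)
pose f (c : T) := [set b | exists2 r : int_ring E,
  D%:R * int_val r = lat v (fun j => (c j : nat)%:Z - K%:Z) & I (b - r)].
apply: (@le_trans _ _ (#|T|%:R%:E)%E); last first.
  rewrite lee_fin ler_nat card_ffun !card_ord -expnMn leq_exp2r ?(frame_gt0 fr) //.
  have h k : (0 < k -> (2 * k).+1 <= 3 * k)%N by lia.
  by apply: leq_trans (h _ K0) _; rewrite /K !mulnA.
apply: (@counting_le R _ _ _ f) => _ [a ->].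
have [t te] := frame_span fr (int_val a / int_val d).
have [m mP] := choice (fun i => floor_frac (t i)).
pose lam := IntRing (lat_int fr m); pose r := a - d * lam.
have re : int_val r = int_val d * \sum_i (t i - (m i)%:~R) *: v i.
  rewrite int_valB int_valM -[int_val a](divfK d0) te [_ * int_val d]mulrC -mulrBr.
  by congr (_ * _); rewrite -sumrB; apply: eq_bigr => i _; rewrite scalerBl scaler_int mulrzl.
have rb i : `|psi i (int_val r)| <= (X * C1)%:R.
  rewrite re rmorphM normrM natrM ler_pM //; apply: le_trans (C1P i).
  rewrite rmorph_sum; apply: le_trans (ler_norm_sum _ _ _) _; apply: ler_sum => j _.
  rewrite rmorphZ_num normrM ler_piMl //; have /andP [q0 q1] := mP j.
  by rewrite ger0_norm ?ler0q // -[leRHS](ratr_nat _ 1) ler_rat ltW.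
have [c [ce cP]] := frame_int_coord fr (int_valP r).
have cK j : (`|c j| <= K)%N.
  rewrite -(ler_nat algC) pmulrn abszE intr_norm cP.
  apply: le_trans (ler_norm_sum _ _ _) _.
  rewrite (_ : K = X * C1 * C2)%N; last by rewrite /K; ring.
  rewrite natrM; apply: le_trans (ler_wpM2l (ler0n _ _) (C2P j)).
  rewrite mulr_sumr; apply: ler_sum => i _; rewrite rmorphM normrM.
  by rewrite ler_wpM2r.
have cE j : (inord `|(c j + K%:Z)%R|%N : 'I_(2 * K).+1)%:Z - K%:Z = c j.
  have h (x : int) (k : nat) : (`|x| <= k)%N ->
      (`|(x + k%:Z)%R| < (2 * k).+1)%N /\ (`|(x + k%:Z)%R|%N)%:Z - k%:Z = x by lia.
  by have [h1 h2] := h _ _ (cK j); rewrite inordK.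
exists [ffun j => inord `|(c j + K%:Z)%R|%N] => //; apply/seteqP; split=> b /=.
  move=> [r' r'e Ir']; have er : r' = r.
    apply: int_val_inj; apply: (mulfI (natr_E_neq0 fr (frame_D fr))).
    by rewrite r'e ce; apply: eq_bigr => j _; rewrite ffunE cE.
  have -> : b - a = (b - r') + (- (lam * d)) by rewrite er /r mulrC; ring.
  by apply: ID => //; apply/IN/IM.
move=> Iba; exists r.
  by rewrite ce; apply: eq_bigr => j _; rewrite ffunE cE.
have -> : b - r = (b - a) + lam * d by rewrite /r mulrC; ring.
by apply: ID => //; apply: IM.
Qed.

(** * Cyclic fields from a multiplication table *)

Section Resolvent.

Variables (k : fieldExtType rat) (L : fieldType) (iota : {rmorphism k -> L}).
Variables (l : nat) (pl : prime l) (w : 'F_l -> L) (tau : 'F_l -> 'F_l -> k).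
Hypothesis sum_w : \sum_a w a = 1.
Hypothesis mul_w : forall a b, w a * w b = \sum_c iota (tau (a - c) (b - c)) * w c.
Hypothesis free_w : forall x : 'F_l -> k, \sum_a iota (x a) * w a = 0 -> forall a, x a = 0.

Let lin (x : 'F_l -> k) : L := \sum_a iota (x a) * w a.

(* [conj_graph s] is the graph of the automorphism [w c |-> w (c + s)]. *)
Let conj_graph (s : 'F_l) (y y' : L) : Prop :=
  exists2 x, y = lin x & y' = \sum_c iota (x c) * w (c + s).

Lemma conj_graphD s y y' z z' :
  conj_graph s y y' -> conj_graph s z z' -> conj_graph s (y + z) (y' + z').
Proof.
move=> [x -> ->] [t -> ->]; exists (fun c => x c + t c); rewrite /lin -big_split /=;
  by apply: eq_bigr => c _; rewrite rmorphD mulrDl.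
Qed.

Lemma conj_graphZ s a y y' :
  conj_graph s y y' -> conj_graph s (iota a * y) (iota a * y').
Proof.
move=> [x -> ->]; exists (fun c => a * x c); rewrite /lin mulr_sumr;
  by apply: eq_bigr => c _; rewrite rmorphM mulrA.
Qed.

Lemma conj_graph_sum s (I : Type) (r : seq I) (y y' : I -> L) :
  (forall i, conj_graph s (y i) (y' i)) ->
  conj_graph s (\sum_(i <- r) y i) (\sum_(i <- r) y' i).
Proof.
move=> h; elim: r => [|i r IH]; last by rewrite !big_cons; apply: conj_graphD.
by rewrite !big_nil; exists (fun=> 0); rewrite /lin big1 // => c _; rewrite rmorph0 mul0r.
Qed.

Lemma sum_w_shift s : \sum_a w (a + s) = 1.
Proof. by rewrite -sum_w [RHS](reindex_inj (addIr s)). Qed.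

Lemma conj_graph_w s c : conj_graph s (w c) (w (c + s)).
Proof.
exists (fun d => (d == c)%:R); rewrite /lin (bigD1 c) //= eqxx rmorph1 mul1r big1 ?addr0 // => d;
  by move=> /negPf ->; rewrite rmorph0 mul0r.
Qed.

Lemma conj_graph1 s : conj_graph s 1 1.
Proof. by rewrite -{1}sum_w -(sum_w_shift s); apply: conj_graph_sum => c; apply: conj_graph_w. Qed.

(** The structure constants depend on differences of indices only, so the table is invariant under a
    common shift. *)
Lemma conj_graph_ww s c d : conj_graph s (w c * w d) (w (c + s) * w (d + s)).
Proof.
rewrite !mul_w [X in conj_graph _ _ X](reindex_inj (addIr s)).
apply: conj_graph_sum => e; have sK x : x + s - (e + s) = x - e.
  by rewrite opprD addrACA subrr addr0.
by rewrite !sK; apply/conj_graphZ/conj_graph_w.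
Qed.

Lemma conj_graphM s y y' z z' :
  conj_graph s y y' -> conj_graph s z z' -> conj_graph s (y * z) (y' * z').
Proof.
move=> [x -> ->] [t -> ->]; rewrite /lin !mulr_suml; apply: conj_graph_sum => c.
rewrite !mulr_sumr; apply: conj_graph_sum => d.
rewrite [X in conj_graph _ X]mulrACA [X in conj_graph _ _ X]mulrACA -!rmorphM.
exact/conj_graphZ/conj_graph_ww.
Qed.

Lemma conj_graph_horner s (g : {poly k}) y y' : conj_graph s y y' ->
  conj_graph s (map_poly iota g).[y] (map_poly iota g).[y'].
Proof.
move=> yy; elim/poly_ind: g => [|g c IH].
  by rewrite rmorph0 !horner0 -(mul0r 1) -(rmorph0 iota); apply/conj_graphZ/conj_graph1.
rewrite rmorphD rmorphM /= map_polyX map_polyC;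
rewrite !hornerD !hornerM !hornerX !hornerC; apply: conj_graphD.
  exact: conj_graphM.
by have := conj_graphZ c (conj_graph1 s); rewrite mulr1.
Qed.

(** By linear independence the additive relation [conj_graph s] is single-valued. This transports
    polynomial equations over [k] from an element to its conjugates before any field or automorphism
    has been built. *)
Lemma conj_graph0 s y' : conj_graph s 0 y' -> y' = 0.
Proof.
move=> [x /esym /free_w x0 ->]; rewrite big1 // => c _.
by rewrite x0 rmorph0 mul0r.
Qed.

Lemma w_inj : injective w.
Proof.
move=> a b eab; apply: contrapT => /eqP ab.
have := @free_w (fun c => (c == a)%:R - (c == b)%:R).
rewrite (bigD1 a) //= (bigD1 b) 1?eq_sym //= big1 ?addr0 => [|c /andP [/negPf -> /negPf ->]]; last first.
  by rewrite subrr rmorph0 mul0r.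
rewrite !eqxx [b == a]eq_sym (negPf ab) subr0 sub0r rmorph1 rmorphN1 mul1r mulN1r eab subrr.
move=> /(_ erefl a); rewrite eqxx (negPf ab) subr0 => /eqP; by rewrite oner_eq0.
Qed.

Local Notation q := (Zp_trunc (pdiv l)).+2.

(** A polynomial over [k] that vanishes at [w 0] vanishes at all its [l] distinct conjugates
    [w s]. *)
Lemma w_root_size (g : {poly k}) : g != 0 -> root (map_poly iota g) (w 0) -> (l < size g)%N.
Proof.
move=> g0 /rootP gw; have gws s : root (map_poly iota g) (w s).
  by apply/rootP; have := conj_graph_horner g (conj_graph_w s 0); rewrite gw add0r => /conj_graph0.
rewrite -(size_map_poly iota) -{1}(Fp_cast pl) -[q]card_ord -(size_codom w).
apply: max_poly_roots; first by rewrite map_poly_eq0.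
  by apply/allP => _ /codomP [s ->].
by rewrite map_inj_uniq ?enum_uniq //; apply: w_inj.
Qed.

(** The characteristic polynomial of multiplication by [w 0], read off the table. Its degree [l] is
    the least possible by [w_root_size], so it is irreducible. *)
Let minp : {poly k} := char_poly ((\matrix_(b, c) tau (0 - c) (b - c) : 'M[k]_q)^T).

Lemma minp_root : root (map_poly iota minp) (w 0).
Proof.
rewrite map_char_poly -eigenvalue_root_char; apply/eigenvalueP; exists (\row_c w c).
  apply/rowP => b; rewrite !mxE mul_w; apply: eq_bigr => c _.
  by rewrite !mxE mulrC.
apply/eqP => /rowP w0; have := oner_eq0 L; rewrite -sum_w big1 ?eqxx // => c _.
by have := w0 c; rewrite !mxE.
Qed.

Lemma minp_size : size minp = l.+1.
Proof. by rewrite size_char_poly Fp_cast. Qed.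

Lemma minp_irr : irreducible_poly minp.
Proof.
apply/(subfx_irreducibleP minp_root); first by rewrite monic_neq0 ?char_poly_monic.
by move=> g gr g0; rewrite minp_size; apply: w_root_size.
Qed.

(** The powers of [w 0] below the [l]-th are independent by [w_root_size]. Their coordinate matrix
    [M] with respect to [w] is therefore invertible, and the rows of its inverse are the polynomials
    sought. *)
Lemma w_polynomial a : exists g : {poly k}, w a = (map_poly iota g).[w 0].
Proof.
have pw i : exists x, (w 0) ^+ i = lin x.
  have := conj_graph_horner 'X^i (conj_graph_w 0 0).
  by rewrite map_polyXn !hornerXn => -[x -> _]; exists x.
have [x xP] := choice pw.
pose M : 'M[k]_q := \matrix_(i < q, c < q) x i c.
have uM : M \in unitmx.
  rewrite -row_free_unit -kermx_eq0; apply/rowV0P => u /sub_kermxP uM.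
  have /polyP u0 : \poly_(i < q) (u 0 (inord i)) = 0.
    apply/eqP; apply: contraT => /w_root_size wr.
    have sz : (size (\poly_(i < q) u 0 (inord i))%R <= l)%N.
      by apply: leq_trans (size_poly _ _) _; rewrite (Fp_cast pl).
    move: sz; rewrite leqNgt => /negP []; apply: wr;
    apply/rootP; rewrite (@horner_coef_wide _ q) ?size_map_poly ?size_poly //.
    transitivity (\sum_c iota ((u *m M) 0 c) * w c); last first.
      by rewrite uM big1 // => c _; rewrite mxE rmorph0 mul0r.
    under [RHS]eq_bigr do rewrite mxE rmorph_sum mulr_suml.
    rewrite exchange_big; apply: eq_bigr => i _ /=.
    rewrite coef_map coef_poly ltn_ord inord_val xP /lin mulr_sumr.
    by apply: eq_bigr => c _; rewrite mxE rmorphM mulrA.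
  by apply/rowP => i; have := u0 i; rewrite coef_poly ltn_ord inord_val coef0 mxE.
exists (\poly_(i < q) (invmx M a (inord i))).
rewrite (@horner_coef_wide _ q) ?size_map_poly ?size_poly //.
transitivity (\sum_c iota ((invmx M *m M) a c) * w c).
  rewrite mulVmx // (bigD1 a) //= mxE eqxx rmorph1 mul1r big1 ?addr0 // => c ca.
  by rewrite mxE eq_sym (negPf ca) rmorph0 mul0r.
under eq_bigr do rewrite mxE rmorph_sum mulr_suml.
rewrite exchange_big; apply: eq_bigr => i _ /=.
rewrite coef_map coef_poly ltn_ord inord_val xP /lin mulr_sumr.
by apply: eq_bigr => c _; rewrite mxE rmorphM mulrA.
Qed.

Lemma conj_graph_int s y y' : conj_graph s y y' -> y \in @is_int L -> y' \in @is_int L.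
Proof.
have eqp (p : {poly int}) : map_poly intr p = map_poly iota (map_poly intr p).
  by rewrite -map_poly_comp; apply: eq_map_poly => i /=; rewrite rmorph_int.
move=> yy /is_intE [p mp /rootP py]; apply/is_intE; exists p => //; apply/rootP.
by have := conj_graph_horner (map_poly intr p) yy; rewrite -eqp py => /conj_graph0.
Qed.

(* The sum of the conjugates of [\sum_a x a w_a] is [\sum_a x a]. *)
Lemma resolvent_trace_int (x : 'F_l -> k) :
  \sum_a iota (x a) * w a \in @is_int L -> \sum_a x a \in @is_int k.
Proof.
move=> xi; rewrite -(is_int_rmorph iota) rmorph_sum.
have -> : \sum_a iota (x a) = \sum_s \sum_c iota (x c) * w (c + s).
  rewrite exchange_big; apply: eq_bigr => c _ /=; rewrite -mulr_sumr.
  by under eq_bigr do rewrite addrC; rewrite sum_w_shift mulr1.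
rewrite rpred_sum // => s _; apply: (@conj_graph_int s (lin x)) => //.
by exists x.
Qed.

Lemma resolvent_field : exists (K : splittingFieldType k) (j : {rmorphism K -> L}) (om : 'F_l -> K),
  [/\ forall a, j a%:A = iota a, forall a, j (om a) = w a,
      forall y, exists x : 'F_l -> k, y = \sum_a x a *: om a
    & [/\ \dim {:K} = l, galois 1 {:K} & cyclic 'Gal({:K} / 1)]].
Proof.
have [K dimK [z rz gz]] := irredp_FAdjoin minp_irr.
have [j jA jz] := embed_adjoin gz minp_irr rz minp_root.
have jp (g : {poly k}) : j (map_poly (in_alg K) g).[z] = (map_poly iota g).[w 0].
  by rewrite -jz -horner_map -map_poly_comp; congr _.[_]; apply: eq_map_poly => a /=; rewrite jA.
have [g gP] := choice w_polynomial.
pose om a := (map_poly (in_alg K) (g a)).[z].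
have jom a : j (om a) = w a by rewrite jp -gP.
have om0 : om 0 = z by apply: (fmorph_inj j); rewrite jom jz.
have om_inj : injective om by move=> a b /(congr1 j); rewrite !jom => /w_inj.
have rom a : root (map_poly (in_alg K) minp) (om a).
  apply/rootP/(fmorph_inj j); rewrite rmorph0 -horner_map jom -map_poly_comp.
  rewrite (@eq_map_poly _ _ _ iota) => [|b /=]; last by rewrite jA.
  have := conj_graph_horner minp (conj_graph_w a 0).
  by rewrite (rootP minp_root) add0r => /conj_graph0.
have uom : uniq (codom om) by rewrite map_inj_uniq ?enum_uniq.
have fac : map_poly (in_alg K) minp = \prod_(x <- codom om) ('X - x%:P).
  rewrite [LHS](@all_roots_prod_XsubC _ _ (codom om)).
  - by rewrite lead_coef_map (monicP (char_poly_monic _)) rmorph1 scale1r.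
  - by rewrite size_map_poly minp_size size_codom card_ord Fp_cast.
  - by apply/allP => _ /codomP [a ->].
  - by rewrite uniq_rootsE.
have spl : splittingFieldFor 1 (map_poly (in_alg K) minp) {:K}.
  exists (codom om); first by rewrite fac eqpxx.
  apply/eqP; rewrite eqEsubv subvf -gz; apply/FadjoinP; split; first exact: subv_adjoin_seq.
  by rewrite -om0 seqv_sub_adjoin // codom_f.
have ax : SplittingField.axiom K.
  by exists (map_poly (in_alg K) minp) => //; apply: alg_polyOver.
pose KS : splittingFieldType k := HB.pack_for (splittingFieldType k) K
  (FieldExt_isSplittingField.Build k K ax).
have galK : galois 1 {:KS}.
  apply/splitting_galoisField; exists (map_poly (in_alg K) minp); split => //.
    exact: alg_polyOver.
  by rewrite fac separable_prod_XsubC.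
have dimKS : \dim {:KS} = l by rewrite dimK minp_size.
exists KS, j, om; split => //.
  move=> y; have /Fadjoin1_polyP [h hy] : y \in <<1; z>>%VS by rewrite gz memvf.
  have [x xe _] := conj_graph_horner h (conj_graph_w 0 0).
  exists x; apply: (fmorph_inj j); rewrite hy jp xe rmorph_sum; apply: eq_bigr => a _.
  by rewrite -mulr_algl rmorphM jA jom.
split=> //; apply: prime_cyclic; rewrite -(galois_dim galK) dimKS dimv1 divn1 //.
Qed.

End Resolvent.

(** The matrix is a scalar plus [c] times a column of ones times a row of ones. The bordered matrix
    [W] reduces it to a 1 by 1 determinant, up to a factor [b] that is cancelled at the end. *)
Lemma det_scalar_add_const (F : fieldType) (n : nat) (b c : F) : b != 0 -> (0 < n)%N ->
  \det (\matrix_(i < n, j < n) (b * (i == j)%:R + c)) = b ^+ n.-1 * (b + n%:R * c).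
Proof.
case: n => // n b0 _; set A := \matrix_(i, j) _.
pose U : 'cV[F]_n.+1 := const_mx 1; pose V : 'rV[F]_n.+1 := const_mx 1.
have AE : A = b%:M + c *: (U *m V).
  apply/matrixP => i j; rewrite !mxE (bigD1 ord0) //= !mxE mul1r big1 => [|k].
    by rewrite addr0 mulr1 mulr_natr.
  by rewrite [k]ord1.
pose W : 'M[F]_(1 + n.+1) := block_mx 1%:M (- V) (c *: U) b%:M.
have e1 : block_mx 1%:M 0 (c *: U) 1%:M *m block_mx 1%:M (- V) 0 A = W.
  rewrite mulmx_block !mul1mx !mul0mx ?mulmx0 ?addr0 ?mulmx1 AE -scalemxAl mulmxN.
  by rewrite addrC scalerN addrK.
have e2 : W *m block_mx b%:M 0 (- (c *: U)) 1%:M =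
    block_mx (b%:M + V *m (c *: U)) (- V) 0 b%:M.
  rewrite mulmx_block ?mulmx0 ?mul1mx ?mulmx1 ?add0r mulNmx !mulmxN opprK.
  by rewrite mul_mx_scalar mul_scalar_mx subrr.
move: (congr1 determinant e2); rewrite -e1 !det_mulmx det_lblock !det_ublock det_lblock.
rewrite !det1 !mul1r mulr1 det_scalar1 det_scalar => h.
apply: (mulIf b0); rewrite h det_mx11 !mxE mulr1n (eq_bigr (fun=> c)) => [|j _];
    last by rewrite !mxE mulr1 mul1r.
by rewrite sumr_const card_ord -mulr_natl exprSr /=; ring.
Qed.

Lemma field_traceE (k : fieldType) (K : fieldExtType k) (m : nat) (X : m.-tuple K) (a : K) :
  basis_of {:K} X -> field_trace a = \sum_i coord X i (a * X`_i).
Proof.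
move=> bX; set B := vbasis {:K}; have bB : basis_of {:K} B := vbasisP _.
pose P := \matrix_(c < m, i < \dim {:K}) coord B i X`_c.
pose Q := \matrix_(i < \dim {:K}, c < m) coord X c B`_i.
pose MX := \matrix_(c < m, d < m) coord X d (a * X`_c).
have PQ : P *m Q = 1%:M.
  apply/matrixP => c d; rewrite !mxE -(coord_free c d (basis_free bX)).
  rewrite [in RHS](coord_basis bB (memvf X`_c)) linear_sum.
  by apply: eq_bigr => i _; rewrite !mxE linearZ.
have MB : passmx.mxof B B (amull a) = Q *m (MX *m P).
  apply/matrixP => i j; rewrite !mxE /= passmx.vecof_delta lfunE /=.
  rewrite {1}(coord_basis bX (memvf B`_i)) mulr_sumr linear_sum.
  apply: eq_bigr => c _; rewrite !mxE -scalerAr linearZ /=; congr (_ * _).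
  rewrite {1}(coord_basis bX (memvf (a * X`_c))) linear_sum.
  by apply: eq_bigr => d _; rewrite !mxE linearZ.
rewrite /field_trace MB mxtrace_mulC -mulmxA PQ mulmx1.
by apply: eq_bigr => i _; rewrite mxE.
Qed.

(** * Discriminant and ramification *)

Lemma is_ideal_gen (A : comNzRingType) (G : set A) : is_ideal (ideal_gen G).
Proof.
apply/is_idealP; split.
- by move=> I [/is_idealP [I0 _ _] _].
- move=> x y Gx Gy I [iI GI]; have /is_idealP [_ ID _] := iI.
  by apply: ID; [apply: Gx|apply: Gy].
- move=> a x Gx I [iI GI]; have /is_idealP [_ _ IM] := iI.
  by apply: IM; apply: Gx.
Qed.

Lemma sub_ideal_gen (A : comNzRingType) (G : set A) : G `<=` ideal_gen G.
Proof. by move=> x Gx I [_ GI]; apply: GI. Qed.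

Lemma ideal_gen_sub (A : comNzRingType) (G I : set A) :
  is_ideal I -> G `<=` I -> ideal_gen G `<=` I.
Proof. by move=> iI GI x; apply; split. Qed.

Section IntegralResolvent.

Variables (k : fieldExtType rat) (K : fieldExtType k) (l : nat) (pl : prime l).
Variables (om : 'F_l -> K) (tau : 'F_l -> 'F_l -> k) (b : k).
Hypothesis dimK : \dim {:K} = l.
Hypothesis sum_om : \sum_a om a = 1.
Hypothesis mul_om : forall a c, om a * om c = \sum_d tau (a - d) (c - d) *: om d.
Hypothesis span_om : forall y, exists x : 'F_l -> k, y = \sum_a x a *: om a.
Hypothesis trace_int : forall x : 'F_l -> k,
  \sum_a x a *: om a \in @is_int K -> \sum_a x a \in @is_int k.
Hypothesis tau_int : forall x y, tau x y \in @is_int k.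
Hypothesis b_int : b \in @is_int k.
Hypothesis tau0 : \sum_x tau x 0 = 1.
Hypothesis tau_sum : forall a c,
  \sum_d tau (a - d) (c - d) = b * (a == c)%:R + (1 - b) / l%:R.

Local Notation q := (Zp_trunc (pdiv l)).+2.

Let X : q.-tuple K := [tuple om i | i < q].

Lemma nth_om (i : 'F_l) : X`_i = om i.
Proof. by rewrite -tnth_nth tnth_mktuple. Qed.

Lemma basis_om : basis_of {:K} X.
Proof.
rewrite basisEdim size_tuple dimK; apply/andP; split; last by have ql := Fp_cast pl; lia.
apply/subvP => y _; have [x ->] := span_om y; apply: memv_suml => a _.
by apply/memvZ/memv_span; rewrite -nth_om mem_nth // size_tuple.
Qed.

Lemma coord_om (x : 'F_l -> k) d : coord X d (\sum_a x a *: om a) = x d.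
Proof.
have cX (a : 'F_l) : coord X d (om a) = (a == d)%:R.
  by rewrite -nth_om coord_free ?(basis_free basis_om).
rewrite linear_sum (bigD1 d) //= linearZ /= cX eqxx mulr1.
by rewrite big1 ?addr0 // => a ad; rewrite linearZ /= cX (negPf ad) mulr0.
Qed.

Lemma om_span y : y = \sum_a coord X a y *: om a.
Proof. by have [x ->] := span_om y; apply: eq_bigr => a _; rewrite coord_om. Qed.

(** The trace of [K] over [k]: the conjugates of each [om a] are all the [om c], whose sum is 1. *)
Let tr (y : K) : k := \sum_a coord X a y.

Lemma tr_om c : tr (om c) = 1.
Proof.
rewrite /tr (bigD1 c) //= -nth_om coord_free ?(basis_free basis_om) // eqxx.
rewrite big1 ?addr0 // => a ac; rewrite coord_free ?(basis_free basis_om) //.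
by rewrite eq_sym (negPf ac).
Qed.

Lemma trD : {morph tr : x y / x + y}.
Proof. by move=> x y; rewrite -big_split; apply: eq_bigr => a _; rewrite linearD. Qed.

Lemma trZ c : {morph tr : x / c *: x >-> c * x}.
Proof. by move=> x; rewrite mulr_sumr; apply: eq_bigr => a _; rewrite linearZ. Qed.

Lemma tr_sum (x : 'F_l -> k) : tr (\sum_a x a *: om a) = \sum_a x a.
Proof. by apply: eq_bigr => a _; rewrite coord_om. Qed.

Lemma tr_int y : y \in @is_int K -> tr y \in @is_int k.
Proof. by move=> yi; apply: trace_int; rewrite -om_span. Qed.

Lemma tr_mul_om a c : tr (om a * om c) = b * (a == c)%:R + (1 - b) / l%:R.
Proof. by rewrite mul_om tr_sum tau_sum. Qed.

Lemma field_trace_om y : field_trace y = tr y.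
Proof.
rewrite (field_traceE _ basis_om) {1}(om_span y).
have e (i : 'F_l) : coord X i ((\sum_a coord X a y *: om a) * X`_i) =
    \sum_a coord X a y * tau (a - i) 0.
  rewrite nth_om mulr_suml linear_sum; apply: eq_bigr => a _.
  by rewrite -scalerAl linearZ /= mul_om coord_om subrr.
rewrite (eq_bigr _ (fun i _ => e i)) exchange_big; apply: eq_bigr => a _ /=.
by rewrite -mulr_sumr -[RHS]mulr1 -tau0 [in RHS](reindex_inj (subrI a)).
Qed.

Lemma om_neq0 a : om a != 0.
Proof. by rewrite -nth_om (basis_not0 basis_om) // mem_nth // size_tuple. Qed.

Lemma alg_int x : x \in @is_int k -> x%:A \in @is_int K.
Proof. by move=> xi; rewrite -[x%:A]/(in_alg K x) is_int_rmorph. Qed.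

Lemma om_int a : om a \in @is_int K.
Proof.
apply: (@is_int_eigen K q (fun c d => (tau (a - d) (c - d))%:A) om _ 0 (om_neq0 0)).
  by move=> c; rewrite mul_om; apply: eq_bigr => d _; rewrite mulr_algl.
by move=> c d; apply: alg_int.
Qed.

(** The Gram matrix of the trace form is [b] times the identity plus the constant [(1 - b) / l], so
    the second factor of its determinant is [b + (1 - b) = 1]. *)
Lemma rel_disc_om (b0 : b != 0) (d : int_ring k) :
  int_val d = b ^+ l.-1 -> @rel_disc k K d.
Proof.
move=> de; apply: sub_ideal_gen => /=.
have dq : \dim {:K} = q by rewrite dimK Fp_cast.
pose Y := [tuple om (cast_ord dq i) | i < \dim {:K}].
exists Y; split.
- have -> : (Y : seq K) = X; last exact: basis_om.
  apply: (@eq_from_nth _ 0); rewrite !size_tuple // => i iK.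
  rewrite -[i]/(nat_of_ord (Ordinal iK)) -tnth_nth tnth_mktuple.
  have iq : (i < q)%N by rewrite -dq.
  by rewrite -[nat_of_ord _]/(nat_of_ord (Ordinal iq)) nth_om; congr om; apply: val_inj.
- by move=> _ /mapP [i _ ->]; apply: om_int.
rewrite de /tuple_disc.
have -> : \matrix_(i < \dim {:K}, j < \dim {:K}) field_trace (tnth Y i * tnth Y j) =
    \matrix_(i, j) (b * (i == j)%:R + (1 - b) / l%:R).
  by apply/matrixP => i j; rewrite !mxE !tnth_mktuple field_trace_om tr_mul_om
      (inj_eq (@cast_ord_inj _ _ dq)).
have dim0 : (0 < \dim {:K})%N by rewrite dimK prime_gt0.
rewrite (det_scalar_add_const _ b0 dim0) dimK.
have l0 : l%:R != 0 :> k.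
  by rewrite -[l%:R](rmorph_nat (in_alg k)) fmorph_eq0 pnatr_eq0 -lt0n prime_gt0.
by rewrite [_ * (_ / _)]mulrC divfK // [b + _]addrC subrK mulr1.
Qed.

Local Notation A := (int_ring k).
Local Notation B := (int_ring K).

Definition int_alg (x : A) : B := IntRing (alg_int (int_valP x)).

Definition Om (a : 'F_l) : B := IntRing (om_int a).

Variables (p : set A) (m : nat).
Hypothesis p_prime : primes_of p.
Hypothesis p_max : forall x, ~ p x -> exists y, p (x * y - 1).
Hypothesis p_m : p m%:R.
Hypothesis tau_mod : forall x y, idvd (m%:R : k) (tau x y - ((x == 0) && (y == 0))%:R).
Hypothesis b_mod : idvd (m%:R : k) (b - 1).

Local Notation J := (@ideal_ext k K p).

Lemma p_ideal : [/\ p 0, ~ p 1 & forall a x y, p x -> p y -> p (a * x + y)].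
Proof.
have [[p0 p1 pM] _ _] := p_prime; split.
- by move: p0; rewrite inE.
- by move=> p1'; move/negP: p1; apply; apply/mem_set.
- by move=> a x y px py; have := pM a x y; rewrite !inE; apply.
Qed.

Lemma J_ideal : is_ideal J. Proof. exact: is_ideal_gen. Qed.

Lemma JD x y : J x -> J y -> J (x + y).
Proof. by have /is_idealP [_ h _] := J_ideal; apply: h. Qed.

Lemma JM x y : J y -> J (x * y).
Proof. by have /is_idealP [_ _ h] := J_ideal; apply: h. Qed.

Lemma J0 : J 0. Proof. by have /is_idealP [] := J_ideal. Qed.

Lemma JN x : J x -> J (- x).
Proof. by rewrite -mulN1r; apply: JM. Qed.

Lemma J_alg x : p x -> J (int_alg x).
Proof. by move=> px; apply: sub_ideal_gen; exists x. Qed.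

Lemma J_idvd (z : B) : idvd (m%:R : K) (int_val z) -> J z.
Proof.
move=> [y yi e]; have -> : z = IntRing yi * int_alg m%:R.
  apply: int_val_inj; rewrite e int_valM /= mulrC; congr (_ * _).
  by rewrite -[LHS](rmorph_nat (in_alg K)); congr (_%:A); elim: m => // n IH; rewrite !mulrS IH.
by apply: JM; apply: J_alg.
Qed.

Lemma J_OmOm a c : J (Om a * Om c - (if a == c then Om a else 0)).
Proof.
apply: J_idvd; have /choice [t tP] : forall d, exists t,
    t \in @is_int k /\ tau (a - d) (c - d) = ((d == a) && (d == c))%:R + m%:R * t.
  move=> d; have [t ti te] := tau_mod (a - d) (c - d).
  exists t; split => //; move: te; rewrite !subr_eq0 => <-.
  by rewrite [d == a]eq_sym [d == c]eq_sym addrCA subrr addr0.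
exists (\sum_d t d *: om d).
  rewrite rpred_sum // => d _; rewrite -mulr_algl rpredM ?om_int ?alg_int //.
  by case: (tP d).
rewrite int_valB int_valM /= mul_om mulr_sumr.
under eq_bigr => d _ do rewrite (proj2 (tP d)) scalerDl.
rewrite big_split /= addrAC.
have -> : \sum_d ((d == a) && (d == c))%:R *: om d = int_val (if a == c then Om a else 0).
  rewrite (bigD1 a) //= eqxx andTb big1 ?addr0; last by move=> d /negPf ->; rewrite scale0r.
  by case: ifP => _; rewrite ?scale1r ?scale0r.
rewrite subrr add0r; apply: eq_bigr => d _.
by rewrite [in RHS]mulr_natl [in LHS]mulr_natl scalerMnl.
Qed.

Lemma sum_Om : \sum_a Om a = 1.
Proof.
apply: int_val_inj; rewrite -[RHS]sum_om.
by elim/big_rec2: _ => // a x y _ <-.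
Qed.

(* The trace form bounds denominators: [b x_a] is integral, and [b = 1] modulo [m]. *)
Lemma J_coord (z : B) : exists c : 'F_l -> A, J (z - \sum_a int_alg (c a) * Om a).
Proof.
pose x a := coord X a (int_val z).
have cl : (1 - b) / l%:R \in @is_int k.
  have : b * ((0 : 'F_l) == 1)%:R + (1 - b) / l%:R \in @is_int k.
    by rewrite -tau_sum rpred_sum.
  by rewrite eq_sym oner_eq0 mulr0 add0r.
have bx a : b * x a \in @is_int k.
  have -> : b * x a = tr (int_val z * om a) - (1 - b) / l%:R * tr (int_val z).
    rewrite {1}(om_span (int_val z)) mulr_suml.
    have -> : tr (\sum_d coord X d (int_val z) *: om d * om a) =
        \sum_d x d * (b * (d == a)%:R + (1 - b) / l%:R).
      rewrite (big_morph tr trD (_ : tr 0 = 0)); last first.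
        by rewrite /tr big1 // => d _; rewrite linear0.
      by apply: eq_bigr => d _; rewrite -scalerAl trZ tr_mul_om.
    under eq_bigr do rewrite mulrDr.
    rewrite big_split /= -mulr_suml -[\sum_i x i]/(tr (int_val z)).
    rewrite [tr _ * _]mulrC addrK (bigD1 a) //= eqxx mulr1 big1 ?addr0 ?[x a * b]mulrC //.
    by move=> d /negPf ->; rewrite !mulr0.
  apply: rpredB; last by apply: rpredM => //; apply: tr_int; exact: int_valP.
  by apply: tr_int; apply: rpredM; [exact: int_valP|exact: om_int].
exists (fun a => IntRing (bx a)).
apply: J_idvd; rewrite int_valB.
have -> : int_val (\sum_a int_alg (IntRing (bx a)) * Om a) = b *: int_val z.
  rewrite [in RHS](om_span (int_val z)) scaler_sumr.
  elim/big_rec2: _ => // a y y' _ <-; rewrite int_valD int_valM /= scalerA.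
  by rewrite mulr_algl.
have [b' bi be] := b_mod; exists (- (b'%:A * int_val z)).
  by rewrite rpredN rpredM ?alg_int //; exact: int_valP.
rewrite -{1}[int_val z]scale1r -scalerBl -opprB be scaleNr mulrN; congr (- _).
by rewrite mulrA -[LHS]mulr_algl; congr (_ * _); rewrite -[LHS]/(in_alg K _) rmorphM rmorph_nat.
Qed.

(** The trace sends [J] into [p], whereas [om a] has trace 1. The set [I] closes the condition under
    multiplication, so that only the generators of [J] have to be checked. *)
Lemma not_J_Om a : ~ J (Om a).
Proof.
have [p0 np1 pM] := p_ideal.
pose I := [set z : B | forall (y : B) (t : A), int_val t = tr (int_val (z * y)) -> p t].
have trB (z y : B) : tr (int_val (z * y)) \in @is_int k by apply: tr_int; exact: int_valP.
suff /(_ (Om a)) JI : J `<=` I.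
  by move=> /JI /(_ 1 1); rewrite mulr1 /= tr_om => /(_ erefl).
apply: ideal_gen_sub.
  apply/is_idealP; split.
  - move=> y t; rewrite mul0r /= => e; have -> : t = 0; last by [].
    by apply: int_val_inj; rewrite e /tr big1 // => i _; rewrite linear0.
  - move=> z w Iz Iw y t e.
    have -> : t = 1 * IntRing (trB z y) + IntRing (trB w y).
      by apply: int_val_inj; rewrite e mulrDl int_valD trD mul1r.
    by apply: pM; [apply: (Iz y)|apply: (Iw y)].
  - by move=> c z Iz y t e; apply: (Iz (c * y)); rewrite e mulrA [z * c]mulrC.
move=> z [x px ze] y t e; have -> : t = IntRing (tr_int (int_valP y)) * x + 0.
  by apply: int_val_inj; rewrite e addr0 !int_valM ze mulr_algl trZ mulrC.
by apply: pM.
Qed.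

(** The kernel of the projection of the integers modulo [J] onto the component of the idempotent
    [Om a]. These are the primes above [p]. *)
Let P (a : 'F_l) : set B := [set z | J (z * Om a)].

Lemma J_OmOm_eq a : J (Om a * Om a - Om a).
Proof. by have := J_OmOm a a; rewrite eqxx. Qed.

Lemma J_OmOm_neq a c : a != c -> J (Om a * Om c).
Proof. by move=> /negPf ac; have := J_OmOm a c; rewrite ac subr0. Qed.

Lemma JB x y : J x -> J y -> J (x - y).
Proof. by move=> Jx Jy; apply: JD => //; apply: JN. Qed.

Lemma JMr x y : J x -> J (x * y).
Proof. by rewrite mulrC; apply: JM. Qed.

(* Modulo [J], multiplication by [Om a] projects onto a copy of the residue field of [p]. *)
Lemma J_proj z a : exists c : A, J (z * Om a - int_alg c * Om a) /\ (P a z <-> p c).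
Proof.
have [c Jc] := J_coord z; exists (c a).
have h : J (z * Om a - int_alg (c a) * Om a).
  have -> : z * Om a - int_alg (c a) * Om a =
      (z - \sum_d int_alg (c d) * Om d) * Om a +
      (int_alg (c a) * (Om a * Om a - Om a) +
       (\sum_(d | d != a) int_alg (c d) * (Om d * Om a))).
    rewrite (bigD1 a) //= [in RHS]mulrBl mulrDl mulr_suml.
    under [\sum_(i | i != a) int_alg (c i) * Om i * Om a]eq_bigr do rewrite -mulrA.
    by move: (\sum_(d | _) _) => S; ring.
  apply: JD; first exact: JMr.
  apply: JD; first by (apply: JM; exact: J_OmOm_eq).
  apply: big_ind => [|x y|d da]; [exact: J0|exact: JD|].
  by apply: JM; apply: J_OmOm_neq.
split=> //; split=> [Pz|pc].
  apply: contrapT => /p_max [y py]; apply: (@not_J_Om a).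
  have -> : Om a = int_alg y * (z * Om a - (z * Om a - int_alg (c a) * Om a))
      - int_alg (c a * y - 1) * Om a.
    have -> : int_alg (c a * y - 1) = int_alg (c a) * int_alg y - 1.
      apply: int_val_inj => /=; rewrite -[LHS]/(in_alg K _) rmorphB rmorphM rmorph1 //.
    by ring.
  by apply: JB; [by apply: JM; apply: JB|(apply: JMr; exact: J_alg)].
rewrite /P /= -(subrK (int_alg (c a) * Om a) (z * Om a)).
by apply: JD => //; (apply: JMr; exact: J_alg).
Qed.

Lemma P_prime a : primes_of (P a).
Proof.
have PD x y : P a x -> P a y -> P a (x + y) by move=> Px Py; rewrite /P /= mulrDl; apply: JD.
have PM x y : P a y -> P a (x * y) by move=> Py; rewrite /P /= -mulrA; apply: JM.
split.
- split; first by apply/mem_set; rewrite /P /= mul0r; apply: J0.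
    apply/negP => /set_mem; rewrite /P /= mul1r; exact: not_J_Om.
  by move=> c x y /set_mem Px /set_mem Py; apply: mem_set; apply: PD => //; apply: PM.
- move=> x y /set_mem Pxy; have [c [Jc Pc]] := J_proj x a; have [d [Jd Pd]] := J_proj y a.
  have Jcd : J (int_alg (c * d) * Om a).
    have -> : int_alg (c * d) * Om a =
       (x * y) * Om a * 1 - (x * Om a - int_alg c * Om a) * y - int_alg c * (y * Om a - int_alg d * Om a).
      have -> : int_alg (c * d) = int_alg c * int_alg d.
        by apply: int_val_inj => /=; rewrite -[LHS]/(in_alg K _) rmorphM.
      by ring.
    apply: JB; last exact: JM.
    by apply: JB; [rewrite mulr1|apply: JMr].
  have pcd : p (c * d).
    apply: contrapT => /p_max [t pt]; apply: (@not_J_Om a).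
    have -> : Om a = int_alg t * (int_alg (c * d) * Om a) - int_alg (c * d * t - 1) * Om a.
      have -> : int_alg (c * d * t - 1) = int_alg (c * d) * int_alg t - 1.
        by apply: int_val_inj => /=; rewrite -[LHS]/(in_alg K _) rmorphB rmorphM rmorph1.
      by ring.
    by apply: JB; [apply: JM|(apply: JMr; exact: J_alg)].
  have [_ pp _] := p_prime; have /orP [/set_mem pc|/set_mem pd] := pp _ _ (mem_set pcd).
    by apply/orP; left; apply/mem_set/Pc.
  by apply/orP; right; apply/mem_set/Pd.
(* [P a] is not zero, since it contains every other idempotent, and these are nonzero in [K]. *)
- apply/eqP => P0; have : P a (Om (a + 1)).
    by apply: J_OmOm_neq; rewrite -subr_eq0 addrC addKr oner_eq0.
  by rewrite P0 /= => /(congr1 (@int_val K)) /= /eqP; rewrite (negPf (om_neq0 _)).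
Qed.

(** A partial sum of the orthogonal idempotents is idempotent modulo [J], and its annihilator modulo
    [J] is the product of the [P a]. For the full sum, which is 1, this annihilator is [J]
    itself. *)
Lemma P_sum (s : seq 'F_l) : uniq s ->
  ideal_prod [seq P a | a <- s] = [set z | J (z * \sum_(a <- s) Om a)].
Proof.
elim: s => [_|a s IH /= /andP [as_ us]].
  by apply/seteqP; split=> z //= _; rewrite big_nil mulr0; apply: J0.
rewrite (IH us) big_cons.
set S := \sum_(c <- s) Om c; have JaS : J (Om a * S).
  rewrite mulr_sumr big_seq; apply: big_ind => [|x y|d ds]; [exact: J0|exact: JD|].
  by apply: J_OmOm_neq; apply: contraNneq as_ => ->.
have JSS : J (S * S - S).
  rewrite mulr_suml -sumrB big_seq; apply: big_ind => [|x y|d ds]; [exact: J0|exact: JD|].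
  rewrite /S (bigD1_seq d) //= mulrDr addrAC; apply: JD; first exact: J_OmOm_eq.
  rewrite mulr_sumr; apply: big_ind => [|x y|e ed]; [exact: J0|exact: JD|].
  by apply: J_OmOm_neq; rewrite eq_sym.
apply/seteqP; split.
  apply: ideal_gen_sub.
    apply/is_idealP; split=> /= [|x y|x y]; first by rewrite mul0r; apply: J0.
      by rewrite mulrDl; apply: JD.
    by rewrite -mulrA; apply: JM.
  move=> _ [x [y [Px Py ->]]] /=; rewrite mulrDr.
  by apply: JD; [rewrite mulrAC; apply: JMr|rewrite -mulrA; apply: JM].
move=> z /= Jz; set Q := ideal_mul _ _.
have [_ QD QM] := proj1 (is_idealP _) (is_ideal_gen
  [set z | exists x y, [/\ P a x, [set z | J (z * S)] y & z = x * y]]).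
have gen x y : P a x -> J (y * S) -> Q (x * y).
  by move=> Px Py; apply: sub_ideal_gen; exists x, y.
have JQ x : J x -> Q x.
  move=> Jx; have -> : x = x * Om a + (1 - Om a) * x by ring.
  apply: QD; apply: gen; try exact: JMr; first by [].
  by rewrite /P /= mulrBl mul1r -opprB; apply: JN; exact: J_OmOm_eq.
have Jza : J (z * Om a).
  have -> : z * Om a = z * (Om a + S) * Om a - z * (Om a * Om a - Om a) - z * (Om a * S) by ring.
  by apply: JB; [apply: JB; [exact: JMr|(apply: JM; exact: J_OmOm_eq)]|exact: JM].
have JzS : J (z * S).
  have -> : z * S = z * (Om a + S) - z * Om a by ring.
  exact: JB.
(* The first term is a product of an element of [P a] and one annihilated by [S]; the other two lie
   in [J]. *)
have -> : z = (1 - Om a) * (z * (1 - S)) + (z * Om a * (1 - S) + z * S) by ring.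
apply: (QD); last by apply: (QD); [by apply: (JQ); apply: JMr|apply: (JQ)].
apply: gen; first by rewrite /P /= mulrBl mul1r -opprB; apply: JN; exact: J_OmOm_eq.
by rewrite -mulrA; apply: JM; rewrite mulrBl mul1r -opprB; apply: JN.
Qed.

Lemma unramified_om : unramified_at K p.
Proof.
exists [seq P a | a <- index_enum 'F_l]; split.
- rewrite map_inj_uniq ?index_enum_uniq // => a c Pac; apply: contrapT => /eqP ac.
  have : P c (Om a) by apply: J_OmOm_neq.
  rewrite -Pac /P /= => Jaa; apply: (@not_J_Om a).
  by rewrite -(subKr (Om a * Om a) (Om a)); apply: JB => //; apply: J_OmOm_eq.
- by move=> _ /mapP [a _ ->]; apply: P_prime.
- rewrite P_sum ?index_enum_uniq // sum_Om; apply/seteqP.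
  by split=> z /=; rewrite mulr1.
Qed.

End IntegralResolvent.

(** * Resolvents *)

Lemma prim_root_neq0 (F : fieldType) (l : nat) (z : F) : l.-primitive_root z -> z != 0.
Proof.
move=> zl; apply: contraTneq (oner_neq0 F) => z0; rewrite negbK eq_sym.
by rewrite -(prim_expr_order zl) z0 expr0n gtn_eqF ?(prim_order_gt0 zl).
Qed.

(** The gcd of [g] and [X ^ l - a] would have degree [r] with [0 < r < l], and its roots are among
    the [z ^ i x]. Its constant coefficient puts [x ^ r] in the image of [f]. As [r] is prime to [l]
    and [x ^ l] lies there too, so would [x]. *)
Lemma kummer_degree (F L : fieldType) (f : {rmorphism F -> L}) (l : nat) (z a : F)
    (x : L) (g : {poly F}) :
  prime l -> l.-primitive_root z -> x ^+ l = f a -> (forall y, x <> f y) ->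
  root (map_poly f g) x -> (size g <= l)%N -> g = 0.
Proof.
move=> pl zl xl nx gx sg; apply/eqP; apply: contraT => g0.
pose d := gcdp g ('X^l - a%:P).
have x0 : x != 0 by apply/eqP => x0; apply: (nx 0); rewrite rmorph0.
have dx : root (map_poly f d) x.
  rewrite gcdp_map root_gcd gx rmorphB /= map_polyXn map_polyC.
  by rewrite /root !hornerE xl subrr.
have d0 : d != 0 by rewrite gcdp_eq0 (negPf g0).
have sd1 : (1 < size d)%N.
  by rewrite -(size_map_poly f); apply: root_size_gt1 dx; rewrite map_poly_eq0.
have sdl : (size d <= l)%N by apply: leq_trans sg; apply: dvdp_leq => //; exact: dvdp_gcdl.
have zL : l.-primitive_root (f z) by rewrite fmorph_primitive_root.
pose rs := [seq f z ^+ i * x | i <- iota 0 l].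
have fac : map_poly f ('X^l - a%:P) = \prod_(y <- rs) ('X - y%:P).
  rewrite [LHS](@all_roots_prod_XsubC _ _ rs).
  - by rewrite lead_coef_map (monicP _) ?rmorph1 ?scale1r // monicXnsubC ?prime_gt0.
  - by rewrite size_map_poly size_map size_iota size_XnsubC ?prime_gt0.
  - apply/allP => _ /mapP [i _ ->]; rewrite rmorphB /= map_polyXn map_polyC /root !hornerE.
    by rewrite exprMn xl -exprM mulnC exprM (prim_expr_order zL) expr1n mul1r subrr.
  - rewrite uniq_rootsE map_inj_in_uniq ?iota_uniq // => i j.
    rewrite !mem_iota /= => il jl /(mulIf x0) /eqP.
    by rewrite (eq_prim_root_expr zL) !modn_small // => /eqP.
have : map_poly f d %| \prod_(y <- rs) ('X - y%:P) by rewrite -fac dvdp_map dvdp_gcdr.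
move=> /dvdp_prod_XsubC [mk dm].
pose r := size (mask mk rs).
have sr : size d = r.+1.
  by rewrite -(size_map_poly f) (eqp_size dm) size_prod_XsubC.
have sub y : y \in mask mk rs -> exists2 t, t != 0 & y = f t * x.
  move=> /mem_mask /mapP [i _ ->]; exists (z ^+ i); last by rewrite rmorphXn.
  by rewrite expf_neq0 // (prim_root_neq0 zl).
have [t t0 te] : exists2 t, t != 0 & (\prod_(y <- mask mk rs) ('X - y%:P)).[0] = f t * x ^+ r.
  rewrite /r; elim: (mask mk rs) sub => [_|y s IH sub].
    by exists 1; rewrite ?oner_neq0 // big_nil rmorph1 hornerC mulr1.
  have [|t t0 te] := IH; first by move=> y' ys; apply: sub; rewrite inE ys orbT.
  have [u u0 ue] := sub y (mem_head _ _); exists (- u * t).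
    by rewrite mulf_neq0 ?oppr_eq0.
  by rewrite big_cons hornerM te !hornerE ue rmorphM rmorphN /= exprS; ring.
have [u ue] : exists u, x ^+ r = f u.
  have := eqp_eq dm; rewrite (monicP (monic_prod_XsubC _ _ _)) scale1r => /(congr1 (horner^~ 0)) /=.
  rewrite hornerZ te lead_coef_map -(rmorph0 f) horner_map => e.
  exists (d.[0] / (lead_coef d * t)); apply: (@mulfI _ (f (lead_coef d * t))).
    by rewrite fmorph_eq0 mulf_neq0 // lead_coef_eq0.
  by rewrite -[RHS]rmorphM [X in _ = f X]mulrC divfK ?mulf_neq0 ?lead_coef_eq0 // e rmorphM mulrA.
have r0 : (0 < r)%N by move: sd1; rewrite sr.
have rl : (r < l)%N by move: sdl; rewrite sr.
have cop : coprime r l by rewrite coprime_sym prime_coprime // gtnNdvd.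
have [i j ij _] := egcdnP l r0; move: ij; rewrite (eqP cop) => ij.
have a0 : a != 0 by rewrite -(fmorph_eq0 f) -xl expf_neq0.
case: (nx (u ^+ i / a ^+ j)); rewrite fmorph_div !rmorphXn /= -ue -xl -!exprM.
apply: (mulIf (expf_neq0 (l * j) x0)); rewrite divfK ?expf_neq0 //.
by rewrite -exprS -addn1 addnC [(l * j)%N]mulnC [(r * i)%N]mulnC ij addnC.
Qed.

Section RootPowers.

Variables (F : fieldType) (l : nat) (pl : prime l) (z : F) (zl : l.-primitive_root z).

Definition zpow (i : 'F_l) : F := z ^+ i.

Lemma Fp_valD (i j : 'F_l) : (i + j : nat)%N = ((i + j)%R + l * ((i + j) %/ l))%N.
Proof.
have -> : ((i + j)%R : nat) = ((i + j) %% l)%N.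
  by transitivity ((i + j) %% (Zp_trunc (pdiv l)).+2)%N => //; congr (_ %% _)%N; exact: Fp_cast.
by rewrite [(l * _)%N]mulnC [RHS]addnC -divn_eq.
Qed.

Lemma Fp_ltn (i : 'F_l) : (i < l)%N.
Proof. by have := ltn_ord i; rewrite {2}Fp_cast. Qed.

Lemma zpowD i j : zpow (i + j) = zpow i * zpow j.
Proof.
rewrite /zpow -exprD Fp_valD exprD exprM (prim_expr_order zl) expr1n mulr1 //.
Qed.

Lemma zpow0 : zpow 0 = 1. Proof. by []. Qed.

Lemma zpow_nat (n : nat) : zpow n%:R = z ^+ n.
Proof. by rewrite /zpow val_Fp_nat // (prim_expr_mod zl). Qed.

Lemma zpowM i (j : 'F_l) : zpow (i * j) = zpow i ^+ j.
Proof. by rewrite -[i in LHS]natr_Zp -[j in LHS]natr_Zp -natrM zpow_nat /zpow exprM. Qed.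

Lemma zpow_inj : injective zpow.
Proof.
move=> i j /eqP; rewrite (eq_prim_root_expr zl) !modn_small ?Fp_ltn // => /eqP.
exact: val_inj.
Qed.

Lemma zpow_sum (a : 'F_l) : \sum_i zpow (a * i) = l%:R * (a == 0)%:R.
Proof.
case: eqP => [->|/eqP a0].
  under eq_bigr do rewrite mul0r.
  by rewrite sumr_const card_Fp // mulr1.
have h : zpow a * \sum_i zpow (a * i) = \sum_i zpow (a * i).
  rewrite mulr_sumr [RHS](reindex_inj (addIr 1)); apply: eq_bigr => i _.
  by rewrite mulrDr mulr1 zpowD mulrC.
apply/eqP; rewrite mulr0; apply: contraT => s0; move/eqP: h.
by rewrite -subr_eq0 -{2}[\sum_i _]mul1r -mulrBl mulf_eq0 (negPf s0) orbF subr_eq0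
  -zpow0 (inj_eq zpow_inj) (negPf a0).
Qed.

End RootPowers.

Section Kummer.

Variables (k F L : fieldType) (inc : {rmorphism k -> F}) (f : {rmorphism F -> L}).
Variables (l : nat) (pl : prime l) (z : F) (zl : l.-primitive_root z).
Variables (G : finGroupType) (sg : G -> {rmorphism F -> F}).
Hypothesis sgM : forall g h a, sg (g * h)%g a = sg h (sg g a).
Hypothesis sg_fix : forall a, (forall g, sg g a = a) -> exists x, a = inc x.
Hypothesis l_neq0 : l%:R != 0 :> F.
Variable (chi : G -> 'F_l).
Hypothesis chiP : forall g, sg g z = zpow z (chi g).

Local Notation Z := (zpow z).

Lemma sg_zpow g i : sg g (Z i) = Z (chi g * i).
Proof. by rewrite rmorphXn /= chiP mulrC zpowM // /zpow -!exprM mulnC. Qed.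

Lemma chiM g h : chi (g * h)%g = chi g * chi h.
Proof. by apply: (zpow_inj pl zl); rewrite -chiP sgM chiP sg_zpow mulrC. Qed.

Lemma chi_neq0 g : chi g != 0.
Proof.
apply/eqP => g0; have := chiP g; rewrite g0 zpow0 -(rmorph1 (sg g)) => /fmorph_inj e.
have := prim_order_dvd zl 1; rewrite expr1 e eqxx dvdn1 => /eqP l1.
by move: pl; rewrite l1.
Qed.

Variables (beta : F) (beta0 : beta != 0).

(* [i + j] and [(i + j)%R] differ by [l * carry i j] as natural numbers. *)
Definition carry (i j : 'F_l) : nat := ((i + j) %/ l)%N.

(** The factor set of the resolvents, [A i * A j = f (cocycle i j) * A (i + j)]: each carry in an
    exponent of [B g] leaves one factor [B g ^ l], the image of [sg g beta]. *)
Definition cocycle (i j : 'F_l) : F :=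
  \prod_g sg g beta ^+ carry (i / chi g) (j / chi g).

Lemma cocycle_neq0 i j : cocycle i j != 0.
Proof. by apply/prodf_neq0 => g _; rewrite expf_neq0 // fmorph_eq0. Qed.

Lemma sg_cocycle h i j : sg h (cocycle i j) = cocycle (chi h * i) (chi h * j).
Proof.
rewrite rmorph_prod [RHS](reindex_inj (mulIg h)); apply: eq_bigr => g _.
rewrite rmorphXn /= -sgM chiM; have e x : chi h * x / (chi g * chi h) = x / chi g.
  by rewrite [chi g * _]mulrC -mulf_div divff ?mul1r // chi_neq0.
by rewrite !e.
Qed.

Lemma cocycle0 j : cocycle 0 j = 1.
Proof.
rewrite /cocycle big1 // => g _; rewrite mul0r /carry add0n divn_small ?expr0 //.
exact: Fp_ltn.
Qed.

Lemma carryN (i : 'F_l) : i != 0 -> carry i (- i) = 1%N.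
Proof.
move=> i0; have := Fp_valD pl i (- i); rewrite addrN add0n -/(carry i (- i)).
have := Fp_ltn pl i; have := Fp_ltn pl (- i).
have : (0 < i)%N by rewrite lt0n; apply: contraNneq i0 => e; apply/eqP/val_inj.
move: (carry _ _) (nat_of_ord (- i)) (nat_of_ord i) => c x y; case: c => [|[|c]] //; rewrite ?muln0;
  first by lia.
by rewrite !mulnS; move: (l * c)%N => t; lia.
Qed.

Lemma cocycleN i : i != 0 -> cocycle i (- i) = \prod_g sg g beta.
Proof.
move=> i0; apply: eq_bigr => g _; rewrite mulNr carryN ?expr1 //.
by rewrite mulf_neq0 // invr_neq0 // chi_neq0.
Qed.

(** The double Fourier transform of the cocycle, which is the multiplication table of the [wvec]. *)
Definition tau' (x y : 'F_l) : F :=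
  l%:R ^- 2 * \sum_i \sum_j Z (x * i + y * j) * cocycle i j.

Lemma sg_tau' g x y : sg g (tau' x y) = tau' x y.
Proof.
rewrite /tau' rmorphM fmorphV rmorphXn rmorph_nat; congr (_ * _).
have inj : injective (fun i => chi g * i) by apply: mulfI; apply: chi_neq0.
rewrite rmorph_sum [RHS](reindex_inj inj); apply: eq_bigr => i _.
rewrite rmorph_sum [RHS](reindex_inj inj); apply: eq_bigr => j _.
rewrite rmorphM sg_zpow sg_cocycle; congr (Z _ * _).
by rewrite mulrDr [_ * (x * i)]mulrCA [_ * (y * j)]mulrCA.
Qed.

Lemma norm_fixed : exists b, \prod_g sg g beta = inc b.
Proof.
apply: sg_fix => h; rewrite rmorph_prod [RHS](reindex_inj (mulIg h)).
by apply: eq_bigr => g _; rewrite sgM.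
Qed.

Lemma tau_exists : exists tau : 'F_l -> 'F_l -> k, forall x y, inc (tau x y) = tau' x y.
Proof.
have /choice [t tP] : forall xy : 'F_l * 'F_l, exists t, inc t = tau' xy.1 xy.2.
  by move=> xy; have [t ->] := sg_fix (fun g => sg_tau' g xy.1 xy.2); exists t.
by exists (fun x y => t (x, y)) => x y; rewrite tP.
Qed.

Variables (B : G -> L) (BP : forall g, B g ^+ l = f (sg g beta)).

Definition resolvent (i : 'F_l) : L := \prod_g B g ^+ (i / chi g : 'F_l).

Local Notation A := resolvent.

Lemma resolvent0 : A 0 = 1.
Proof. by rewrite /resolvent big1 // => g _; rewrite mul0r expr0. Qed.

Lemma resolventM i j : A i * A j = f (cocycle i j) * A (i + j).
Proof.
have -> : A i * A j = \prod_g (B g ^+ (i / chi g) * B g ^+ (j / chi g)) by rewrite big_split.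
have -> : f (cocycle i j) * A (i + j) =
    \prod_g (f (sg g beta ^+ carry (i / chi g) (j / chi g)) * B g ^+ ((i + j) / chi g)%R).
  by rewrite big_split rmorph_prod.
apply: eq_bigr => g _; rewrite [(i + j) / _]mulrDl rmorphXn -BP -exprM -!exprD.
by congr (_ ^+ _); rewrite [RHS]addnC; apply: Fp_valD.
Qed.

Lemma resolvent_expr_l : A 1 ^+ l = f (\prod_g sg g beta ^+ ((chi g)^-1 : 'F_l)).
Proof.
rewrite /resolvent -prodrXl rmorph_prod; apply: eq_bigr => g _.
by rewrite exprAC BP rmorphXn mul1r.
Qed.

Lemma resolvent_expr n : exists2 u, u != 0 & A 1 ^+ n = f u * A n%:R.
Proof.
elim: n => [|n [u u0 IH]]; first by exists 1; rewrite ?oner_neq0 // rmorph1 mul1r resolvent0.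
exists (u * cocycle n%:R 1); first by rewrite mulf_neq0 ?cocycle_neq0.
by rewrite exprSr IH -mulrA resolventM mulrA -rmorphM natr1.
Qed.

Hypothesis A1_out : forall y, A 1 <> f y.

(** Up to nonzero factors from [F] the [A i] are the powers of [A 1], and [A 1] is a Kummer
    generator of degree [l]. *)
Lemma resolvent_free (y : 'F_l -> F) : \sum_i f (y i) * A i = 0 -> forall i, y i = 0.
Proof.
move=> h; have /choice [u uP] : forall n : nat, exists u, u != 0 /\ A 1 ^+ n = f u * A n%:R.
  by move=> n; have [u u0 e] := resolvent_expr n; exists u.
pose q := (Zp_trunc (pdiv l)).+2; have ql : q = l by exact: Fp_cast.
pose g := \poly_(i < q) (y i%:R / u i).
have g0 : g = 0.
  apply: (kummer_degree (f := f) pl zl resolvent_expr_l A1_out).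
    apply/rootP; rewrite (@horner_coef_wide _ q) ?size_map_poly ?size_poly //.
    rewrite -[RHS]h; apply: eq_bigr => i _; rewrite coef_map coef_poly ltn_ord /=.
    have [u0 ->] := uP i; rewrite mulrA -rmorphM divfK // natr_Zp //.
  by apply: leq_trans (size_poly _ _) _; rewrite ql.
move=> i; have /polyP/(_ i) := g0; rewrite coef_poly coef0 ltn_ord natr_Zp.
by have [u0 _] := uP i => /eqP; rewrite mulf_eq0 invr_eq0 (negPf u0) orbF => /eqP.
Qed.

Definition wvec (a : 'F_l) : L := (l%:R)^-1 * \sum_i f (Z (a * i)) * A i.

Lemma fl_neq0 : l%:R != 0 :> L.
Proof. by rewrite -(rmorph_nat f) fmorph_eq0. Qed.

Lemma Z_orth (i j : 'F_l) : \sum_a Z (- (i * a)) * Z (a * j) = l%:R * (i == j)%:R.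
Proof.
under eq_bigr => a _ do rewrite -(zpowD pl zl) [a * j]mulrC -mulNr -mulrDl.
by rewrite (zpow_sum pl zl) addrC subr_eq0 eq_sym.
Qed.

Lemma resolvent_wvec i : A i = \sum_a f (Z (- (i * a))) * wvec a.
Proof.
rewrite /wvec; under eq_bigr do rewrite mulrCA mulr_sumr.
rewrite -mulr_sumr exchange_big /=.
have e j : \sum_a f (Z (- (i * a))) * (f (Z (a * j)) * A j) = f (l%:R * (i == j)%:R) * A j.
  by rewrite -Z_orth rmorph_sum mulr_suml; apply: eq_bigr => a _; rewrite rmorphM mulrA.
rewrite (eq_bigr _ (fun j _ => e j)) (bigD1 i) //= eqxx mulr1 rmorph_nat.
rewrite big1 ?addr0 ?mulKf ?fl_neq0 // => j ji.
by rewrite eq_sym (negPf ji) mulr0 rmorph0 mul0r.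
Qed.

Lemma sum_wvec : \sum_a wvec a = 1.
Proof.
by rewrite -resolvent0 resolvent_wvec; apply: eq_bigr => a _; rewrite mul0r oppr0 zpow0 rmorph1 mul1r.
Qed.

Lemma mul_wvec a b : wvec a * wvec b = \sum_c f (tau' (a - c) (b - c)) * wvec c.
Proof.
have lf : l%:R^-1 * l%:R^-1 = f (l%:R ^- 2) :> L.
  by rewrite fmorphV rmorphXn rmorph_nat -invfM.
rewrite {1 2}/wvec mulrACA lf /tau'.
under [RHS]eq_bigr do rewrite rmorphM -mulrA.
rewrite -mulr_sumr; congr (_ * _).
under [RHS]eq_bigr do rewrite rmorph_sum mulr_suml.
rewrite exchange_big mulr_suml; apply: eq_bigr => i _ /=.
under [RHS]eq_bigr do rewrite rmorph_sum mulr_suml.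
rewrite exchange_big mulr_sumr; apply: eq_bigr => j _ /=.
rewrite mulrACA resolventM resolvent_wvec !mulr_sumr; apply: eq_bigr => c _.
rewrite !mulrA -!rmorphM; congr (f _ / _ * _).
by rewrite mulrAC -!(zpowD pl zl); congr (Z _ * _); ring.
Qed.

Lemma wvec_free (x : 'F_l -> F) : \sum_a f (x a) * wvec a = 0 -> forall a, x a = 0.
Proof.
move=> h; have y0 := @resolvent_free (fun i => \sum_a x a * Z (a * i)).
have {}y0 : forall i, \sum_a x a * Z (a * i) = 0.
  apply: y0; apply: (mulfI (invr_neq0 fl_neq0)); rewrite mulr0 -[RHS]h mulr_sumr.
  under eq_bigr do rewrite rmorph_sum mulr_suml mulr_sumr.
  rewrite exchange_big; apply: eq_bigr => a _ /=; rewrite /wvec mulrCA mulr_sumr mulr_sumr.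
  by apply: eq_bigr => i _; rewrite rmorphM -!mulrA mulrCA.
move=> a; apply: (mulfI l_neq0); rewrite mulr0.
transitivity (\sum_i Z (- (a * i)) * \sum_c x c * Z (c * i)); last first.
  by rewrite big1 // => i _; rewrite y0 mulr0.
under eq_bigr do rewrite mulr_sumr.
rewrite exchange_big /=.
have e c : \sum_i Z (- (a * i)) * (x c * Z (c * i)) = x c * (l%:R * (a == c)%:R).
  by rewrite -Z_orth mulr_sumr; apply: eq_bigr => i _; rewrite mulrCA [c * i]mulrC.
rewrite (eq_bigr _ (fun c _ => e c)) (bigD1 a) //= eqxx mulr1 mulrC big1 ?addr0 // => c ca.
by rewrite eq_sym (negPf ca) !mulr0.
Qed.

Lemma tau'_trace : \sum_x tau' x 0 = 1.
Proof.
have l20 : l%:R ^+ 2 != 0 :> F by rewrite expf_neq0.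
rewrite -mulr_sumr; apply: (mulfI l20); rewrite mulVKf // mulr1.
transitivity (\sum_i \sum_j cocycle i j * \sum_x Z (i * x)).
  rewrite exchange_big; apply: eq_bigr => i _ /=.
  rewrite exchange_big; apply: eq_bigr => j _ /=.
  by rewrite mulr_sumr; apply: eq_bigr => x _; rewrite mul0r addr0 mulrC [x * i]mulrC.
rewrite (bigD1 0) //= [X in _ + X]big1 ?addr0 => [|i i0]; last first.
  by rewrite big1 // => j _; rewrite (zpow_sum pl zl) (negPf i0) !mulr0.
have e j : cocycle 0 j * \sum_(x : 'F_l) Z (0 * x) = l%:R.
  by rewrite cocycle0 mul1r (zpow_sum pl zl) eqxx mulr1.
rewrite (eq_bigr _ (fun j _ => e j)).
by rewrite sumr_const card_Fp // -[LHS]mulr_natl expr2.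
Qed.

(** The sum over [d] leaves only the pairs with [j = - i]. There the cocycle is 1 for [i = 0] and
    the norm of [beta] otherwise, since [i] and [- i] always produce exactly one carry. *)
Lemma tau'_sum a c : \sum_d tau' (a - d) (c - d) =
  (\prod_g sg g beta) * (a == c)%:R + (1 - \prod_g sg g beta) / l%:R.
Proof.
have l20 : l%:R ^+ 2 != 0 :> F by rewrite expf_neq0.
rewrite -mulr_sumr; apply: (mulfI l20); rewrite mulVKf //.
transitivity (\sum_i \sum_j Z (a * i + c * j) * cocycle i j * \sum_d Z (- (i + j) * d)).
  rewrite exchange_big; apply: eq_bigr => i _ /=.
  rewrite exchange_big; apply: eq_bigr => j _ /=.
  rewrite mulr_sumr; apply: eq_bigr => d _; rewrite mulrAC -(zpowD pl zl).
  by congr (Z _ * _); ring.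
have inner i : \sum_j Z (a * i + c * j) * cocycle i j * \sum_d Z (- (i + j) * d) =
    l%:R * Z ((a - c) * i) * cocycle i (- i).
  rewrite (bigD1 (- i)) //= [X in _ + X]big1 ?addr0 => [|j ji]; last first.
    have -> : \sum_d Z (- (i + j) * d) = l%:R * (j == - i)%:R.
      by rewrite (zpow_sum pl zl) oppr_eq0 [i + j]addrC addr_eq0.
    by rewrite (negPf ji) !mulr0.
  rewrite (zpow_sum pl zl) subrr oppr0 eqxx mulr1 mulrC mulrA; congr (_ * Z _ * _); ring.
rewrite (eq_bigr _ (fun i _ => inner i)) (bigD1 0) //= mulr0 zpow0 mulr1 oppr0 cocycle0 mulr1.
set b := \prod_g _.
have -> : \sum_(i | i != 0) l%:R * Z ((a - c) * i) * cocycle i (- i) =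
    l%:R * b * (l%:R * (a == c)%:R - 1).
  transitivity (l%:R * b * \sum_(i | i != 0) Z ((a - c) * i)).
    by rewrite mulr_sumr; apply: eq_bigr => i i0; rewrite cocycleN // mulrAC.
  have := zpow_sum pl zl (a - c); rewrite (bigD1 0) //= mulr0 zpow0 subr_eq0 => <-.
  by rewrite addrC addrK.
by field.
Qed.

Lemma zpow_int (i : 'F_l) : Z i \in @is_int F.
Proof.
by rewrite rpredX // (is_int_expr_root (prime_gt0 pl)) // (prim_expr_order zl) rpred1.
Qed.

Lemma cocycle_mod d i j : d \in @is_int F -> (forall g, idvd d (sg g beta - 1)) ->
  idvd d (cocycle i j - 1).
Proof.
move=> di dg; apply: (big_ind (fun x => idvd d (x - 1))) => [|x y [x' xi xe] [y' yi ye]|g _].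
- by rewrite subrr; apply: idvd0.
- exists (d * x' * y' + x' + y'); first by rewrite !rpredD ?rpredM.
  have {}xe : x = d * x' + 1 by rewrite -xe subrK.
  have {}ye : y = d * y' + 1 by rewrite -ye subrK.
  by rewrite xe ye; ring.
- have := @idvdX F d (sg g beta) 1 (carry (i / chi g) (j / chi g)).
  rewrite expr1n; apply; rewrite ?rpred1 //.
  by have [x xi e] := dg g; rewrite -[sg g beta](subrK 1) e rpredD ?rpredM ?rpred1.
Qed.

(** Modulo [l ^ 2 m] the cocycle is constantly 1, and the transform of the constant 1 is [l ^ 2]
    times a delta function; dividing by [l ^ 2] leaves a congruence modulo [m]. *)
Lemma tau'_mod m x y : m \in @is_int F ->
  (forall g, idvd (l%:R ^+ 2 * m) (sg g beta - 1)) ->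
  idvd m (tau' x y - ((x == 0) && (y == 0))%:R).
Proof.
move=> mi dg; have l20 : l%:R ^+ 2 != 0 :> F by rewrite expf_neq0.
apply: (idvd_mulK l20); rewrite mulrBr /tau' mulrA mulfV // mul1r.
have -> : l%:R ^+ 2 * ((x == 0) && (y == 0))%:R = \sum_i \sum_j Z (x * i + y * j).
  have e : \sum_i \sum_j Z (x * i + y * j) = (\sum_i Z (x * i)) * (\sum_j Z (y * j)).
    rewrite mulr_suml; apply: eq_bigr => i _; rewrite mulr_sumr.
    by apply: eq_bigr => j _; rewrite -(zpowD pl zl).
  by rewrite -mulnb natrM e !(zpow_sum pl zl) expr2 mulrACA.
rewrite -sumrB; apply: idvd_sum => i _; rewrite -sumrB; apply: idvd_sum => j _.
rewrite -[X in _ - X]mulr1 -mulrBr; apply: idvd_mull; first exact: zpow_int.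
by apply: cocycle_mod => //; rewrite rpredM ?rpredX ?rpred_nat.
Qed.

Lemma norm_mod d : d \in @is_int F -> (forall g, idvd d (sg g beta - 1)) ->
  idvd d (\prod_g sg g beta - 1).
Proof. by move=> di dg; rewrite -(cocycleN (oner_neq0 _)); apply: cocycle_mod. Qed.

(* [y^l] is in [F], hence so is the quotient of [y] by its conjugate, which is a root of unity. *)
Lemma kummer_eigen (y : 'F_l -> F) (a : F) :
  (\sum_i f (y i) * A i) ^+ l = f a -> (forall x, \sum_i f (y i) * A i <> f x) ->
  exists r x, r != 0 /\ \sum_i f (y i) * A i = f x * A r.
Proof.
set Y := \sum_i _ => Yl nY; pose Y' := \sum_i f (y i * Z i) * A i.
have uniq_coef (c c' : 'F_l -> F) :
    \sum_i f (c i) * A i = \sum_i f (c' i) * A i -> forall i, c i = c' i.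
  move=> e i; apply/eqP; rewrite -subr_eq0; apply/eqP.
  apply: (resolvent_free (y := fun i => c i - c' i)).
  by apply/eqP; rewrite -[X in _ == X](subrr (\sum_i f (c i) * A i)) {2}e -sumrB;
    apply/eqP/eq_bigr => j _; rewrite rmorphB mulrBl.
have single (x : F) (r : 'F_l) : f x * A r = \sum_i f (x * (i == r)%:R) * A i.
  rewrite (bigD1 r) //= eqxx mulr1 big1 ?addr0 // => i /negPf ->.
  by rewrite mulr0 rmorph0 mul0r.
(* [Y'] plays the conjugate of [Y] under [A i |-> f (Z i) * A i]. Compatibility with products is the
   identity [Z d = Z (d - i) * Z i]. *)
have pw n : exists c : 'F_l -> F, Y ^+ n = \sum_i f (c i) * A i /\
    Y' ^+ n = \sum_i f (c i * Z i) * A i.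
  elim: n => [|n [c [e1 e2]]].
    exists (fun i => 1 * (i == 0)%:R); rewrite -single rmorph1 mul1r resolvent0; split=> //.
    rewrite expr0 -[LHS]resolvent0 -[LHS]mul1r -(rmorph1 f) single; apply: eq_bigr => i _.
    by case: eqP => [->|_]; rewrite ?mulr1 // !mulr0 mul0r.
  exists (fun d => \sum_i c i * y (d - i) * cocycle i (d - i)).
  have gen (c1 y1 : 'F_l -> F) : (\sum_i f (c1 i) * A i) * (\sum_j f (y1 j) * A j) =
      \sum_d f (\sum_i c1 i * y1 (d - i) * cocycle i (d - i)) * A d.
    under [RHS]eq_bigr do rewrite rmorph_sum mulr_suml.
    rewrite exchange_big mulr_suml; apply: eq_bigr => i _ /=.
    rewrite mulr_sumr [RHS](reindex_inj (addIr i)); apply: eq_bigr => j _ /=.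
    by rewrite addrK mulrACA resolventM [j + i]addrC !rmorphM !mulrA.
  split; rewrite exprSr ?e1 ?e2 gen //; apply: eq_bigr => d _; congr (f _ * _).
  rewrite mulr_suml; apply: eq_bigr => i _.
  have -> : Z d = Z (d - i) * Z i by rewrite -(zpowD pl zl) subrK.
  by ring.
have Y'l : Y' ^+ l = f a.
  have [c [e1 ->]] := pw l.
  have ce : forall i, c i = a * (i == 0)%:R.
    by apply: uniq_coef; rewrite -e1 Yl -single resolvent0 mulr1.
  rewrite -[RHS]mulr1 -resolvent0 single; apply: eq_bigr => i _; rewrite ce.
  by case: eqP => [->|_]; rewrite ?mulr1 // !mulr0 mul0r.
have Y0 : Y != 0 by apply/eqP => Y0; apply: (nY 0); rewrite rmorph0.
have zL : l.-primitive_root (f z) by rewrite fmorph_primitive_root.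
have [r0 re] : {r : 'I_l | Y' / Y = f z ^+ r}.
  apply: (prim_rootP zL); rewrite expr_div_n Y'l Yl divff //.
  by rewrite -Yl expf_neq0.
pose r : 'F_l := (r0 : nat)%:R.
have YY : Y' = f (Z r) * Y by rewrite /r zpow_nat // rmorphXn -re divfK.
(* The [Z i] are distinct, so the eigenvalue [Z r] singles out one coefficient. *)
have yr i : i != r -> y i = 0.
  move=> ir; have e : y i * Z i = Z r * y i.
    apply: (uniq_coef (fun i => y i * Z i) (fun i => Z r * y i)).
    by rewrite -/Y' YY mulr_sumr; apply: eq_bigr => j _; rewrite rmorphM mulrA.
  apply/eqP; apply: contraNT ir => yi0; apply/eqP/(zpow_inj pl zl)/(mulfI yi0).
  by rewrite e mulrC.
have Yr : Y = f (y r) * A r.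
  by rewrite /Y (bigD1 r) //= big1 ?addr0 // => i /yr ->; rewrite rmorph0 mul0r.
exists r, (y r); split => //; apply/eqP => r00; apply: (nY (y r)).
by rewrite Yr r00 resolvent0 mulr1.
Qed.

Lemma resolvent_expr_l_gen r :
  A r ^+ l = f (\prod_g sg g beta ^+ (r / chi g : 'F_l)).
Proof.
rewrite /resolvent -prodrXl rmorph_prod; apply: eq_bigr => g _.
by rewrite exprAC BP rmorphXn.
Qed.

End Kummer.

(** * Radical norms separate Kummer fields *)

Section Radical.

Variable (F : fieldType).
Local Notation O := (@is_int F).

(** For an integral [x], the principal ideal of [x] is radical; this replaces squarefreeness without
    reference to prime ideals. *)
Definition radical (x : F) : Prop :=
  forall t m, t \in O -> idvd x (t ^+ m) -> idvd x t.

Lemma idvd_1 (x t : F) : t \in O -> idvd x 1 -> idvd x t.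
Proof. by move=> ti /(idvd_mulr ti); rewrite mul1r. Qed.

Lemma radical_factor x y : y \in O -> y != 0 -> radical (x * y) -> radical x.
Proof.
move=> yi y0 rxy t [|m] ti; first exact: idvd_1.
move=> [s si e]; apply: (idvd_mulK y0); rewrite mulrC [y * t]mulrC.
apply: (rxy _ m.+1); first by rewrite rpredM.
by exists (s * y ^+ m); rewrite ?rpredM ?rpredX // exprMn e [y ^+ m.+1]exprS; ring.
Qed.

(** If [x * c] is radical, then [x] and [c] share no prime: [x * c] divides a power of [c * z],
    hence [c * z] itself. *)
Lemma radical_coprime x c N z : c \in O -> c != 0 -> radical (x * c) -> z \in O ->
  idvd x (c ^+ N * z) -> idvd x z.
Proof.
move=> ci c0 rxc zi [s si e]; apply: (idvd_mulK c0); rewrite mulrC; apply: (rxc _ N.+1).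
  by rewrite rpredM.
exists (s * z ^+ N); first by rewrite rpredM ?rpredX.
have -> : (c * z) ^+ N.+1 = c * (c ^+ N * z) * z ^+ N by rewrite exprMn !exprS; ring.
by rewrite e; ring.
Qed.

Lemma radical_coprimeX x c N m z : x \in O -> x != 0 -> c \in O -> c != 0 -> radical (x * c) -> z \in O ->
  idvd (x ^+ m) (c ^+ N * z) -> idvd (x ^+ m) z.
Proof.
move=> xi x0 ci c0 rxc; elim: m z => [|m IH] z zi; first by exists z; rewrite ?expr0 ?mul1r.
move=> h; have [z' z'i ze] : idvd x z.
  apply: (radical_coprime ci c0 rxc zi (N := N)); apply: idvd_trans h.
  by exists (x ^+ m); rewrite ?rpredX ?exprS.
move: h; rewrite ze exprS mulrCA => /(idvd_mulK x0) /(IH _ z'i).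
exact: idvd_mul2l.
Qed.

(* Valuations above [b i0]: the left-hand factor occurs to the first power, so [l - 1] more
   factors come from the [b' i], and [b' i] supplies them only when [h i = l - 1]. *)
Lemma kummer_divisibility (I : finType) (i0 : I) (l : nat) (b b' : I -> F) (e h : I -> nat) (y : F) :
  (1 < l)%N -> (forall i, b i \in O) -> (forall i, b' i \in O) ->
  (forall i, b i != 0) -> (forall i, b' i != 0) ->
  radical (\prod_i b i) -> radical (\prod_i b' i) ->
  e i0 = 1%N -> (forall i, (h i <= l.-1)%N) ->
  y ^+ l = (\prod_i b i ^+ e i) * (\prod_i b' i ^+ h i) ->
  idvd (b i0) (\prod_(i | h i == l.-1) b' i).
Proof.
move=> l1 bi b'i b0 b'0 rb rb' ei0 hl yl; set B := b i0.
have yi : y \in O.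
  apply: (is_int_expr_root (ltnW l1)); rewrite yl rpredM // rpred_prod // => i _; by rewrite rpredX.
pose c := \prod_(i | i != i0) b i; have ci : c \in O by rewrite rpred_prod.
have c0 : c != 0 by apply/prodf_neq0 => i _.
have rBc : radical (B * c) by move: rb; rewrite (bigD1 i0).
pose U := \prod_(i | i != i0) b i ^+ e i; pose N := (\sum_i e i)%N.
pose Y' := \prod_i b' i ^+ h i; have Y'i : Y' \in O by rewrite rpred_prod // => i _; rewrite rpredX.
have Ui : U \in O by rewrite rpred_prod // => i _; rewrite rpredX.
have yl' : y ^+ l = B * U * Y' by rewrite yl (bigD1 i0) //= ei0 expr1.
have Uc : idvd U (c ^+ N).
  exists (\prod_(i | i != i0) b i ^+ (N - e i)).
    by rewrite rpred_prod // => i _; rewrite rpredX.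
  rewrite -big_split /= -prodrXl; apply: eq_bigr => i _.
  by rewrite -exprD subnKC // /N (bigD1 i) //= leq_addr.
(* [B] divides [y ^ l], and it is radical. Then [B ^ l] divides [y ^ l], while only one factor [B]
   is visible on the right. *)
have [y1 y1i y1e] : idvd B y.
  apply: (radical_factor ci c0 rBc yi (m := l)); rewrite yl' -mulrA.
  by exists (U * Y'); rewrite ?rpredM.
have BUY : idvd (B ^+ l.-1) (U * Y').
  exists (y1 ^+ l); first by rewrite rpredX.
  apply: (mulfI (b0 i0)); rewrite mulrA -[LHS]yl' y1e exprMn mulrA -/B -exprS prednK //.
  exact: ltnW.
(* [U] divides a power of [c], and [c] is coprime to [B]. *)
have BY : idvd (B ^+ l.-1) Y'.
  apply: (radical_coprimeX (bi i0) (b0 i0) ci c0 rBc Y'i (N := N)); case: Uc => u ui ->.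
  by rewrite mulrAC; apply: idvd_mulr.
pose x := \prod_(i | h i == l.-1) b' i; pose w := \prod_(i | h i != l.-1) b' i.
have xi : x \in O by rewrite rpred_prod.
have wi : w \in O by rewrite rpred_prod.
have w0 : w != 0 by apply/prodf_neq0 => i _.
have x0 : x != 0 by apply/prodf_neq0 => i _.
have rw : radical w.
  by apply: (radical_factor xi x0); move: rb'; rewrite (bigID (fun i => h i == l.-1)) /= mulrC.
have [s si se] : idvd (B ^+ l.-1) (x ^+ l.-1 * w ^+ l.-2).
  apply: idvd_trans BY _; exists (\prod_(i | h i != l.-1) b' i ^+ (l.-2 - h i)).
    by rewrite rpred_prod // => i _; rewrite rpredX.
  rewrite /Y' (bigID (fun i => h i == l.-1)) /= -mulrA -big_split /= -!prodrXl; congr (_ * _).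
    by apply: eq_bigr => i /eqP ->.
  apply: eq_bigr => i hi; rewrite -exprD subnKC //.
  by have := hl i; rewrite leq_eqVlt (negPf hi) /= -ltnS; case: (l) l1 => [|[]].
(* The power [t ^ (l - 1) = s w] is integral, so [t] is. Since [w] is radical it divides [t], and
   [t / w = x / B]. *)
pose t := x * w / B; have Bt : B * t = x * w by rewrite /t mulrC divfK ?b0.
have te : t ^+ l.-1 = s * w.
  apply: (mulfI (expf_neq0 l.-1 (b0 i0))); rewrite -exprMn Bt exprMn mulrA -se.
  by rewrite -mulrA -exprSr prednK // -ltnS prednK // ltnW.
have ti : t \in O.
  by apply: (@is_int_expr_root _ l.-1); rewrite ?te ?rpredM // -ltnS prednK // ltnW.
have [t' t'i t'e] : idvd w t.
  by apply: (rw _ l.-1 ti); rewrite te mulrC; exists s.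
by exists t' => //; apply: (mulIf w0); rewrite -/x -Bt t'e -mulrA [w * t']mulrC.
Qed.

End Radical.

(** * The cyclotomic extension *)

Lemma exists_min_root_poly (k : fieldType) (L : fieldType) (iota : {rmorphism k -> L}) (x : L)
    (q : {poly k}) : q != 0 -> root (map_poly iota q) x ->
  exists2 p, irreducible_poly p & root (map_poly iota p) x.
Proof.
move=> q0 qx; pose P n := `[< exists2 p : {poly k}, p != 0 /\ size p = n & root (map_poly iota p) x >].
have ex : exists n, P n by exists (size q); apply/asboolP; exists q.
case: (ex_minnP ex) => n /asboolP [p [p0 sp] px] nmin; exists p => //.
apply/(subfx_irreducibleP px p0) => r rx r0; rewrite sp; apply: nmin.
by apply/asboolP; exists r.
Qed.

Lemma closed_prim_root (L : closedFieldType) (l : nat) :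
  (0 < l)%N -> l%:R != 0 :> L -> exists z : L, l.-primitive_root z.
Proof.
move=> l0 ln0; have [r Dr] := closed_field_poly_normal ('X^l - 1 : {poly L}).
have m : ('X^l - 1 : {poly L}) \is monic by rewrite monicXnsubC.
rewrite (monicP m) scale1r in Dr.
have sr : size r = l.
  by apply/eqP; rewrite -eqSS -(size_prod_XsubC r id) -Dr size_XnsubC.
have ur : uniq r by rewrite -separable_prod_XsubC -Dr separable_Xn_sub_1.
have /hasP [z _ zl] : has l.-primitive_root r.
  apply: has_prim_root => //; last by rewrite sr.
  by apply/allP => z zr; rewrite /= unity_rootE -subr_eq0 -[z ^+ l - 1]/(_ - _); move: zr;
    rewrite -root_prod_XsubC -Dr /root !hornerE.
by exists z.
Qed.

(** [E] is the field obtained from [k] by adjoining a root of unity, viewed over the rationals. An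
    automorphism is determined by its value at [z], which makes the character on [G] injective. The
    degree formula and the extension of embeddings relate the conjugates of [b] in [k] to those of
    [beta] in [E]. *)
Lemma cyclotomic_extension (k : fieldExtType rat) (l : nat) (L : closedFieldType)
    (iota : {rmorphism k -> L}) : prime l ->
  exists (E : fieldExtType rat) (inc : {rmorphism k -> E}) (f : {rmorphism E -> L}) (z : E)
    (G : finGroupType) (sg : G -> {rmorphism E -> E}),
  [/\ l.-primitive_root z, forall a, f (inc a) = iota a,
      forall g h a, sg (g * h)%g a = sg h (sg g a),
      forall a, (forall g, sg g a = a) -> exists x, a = inc x
    & [/\ forall g h, (sg g =1 sg h) -> g = h,
      \dim {:E} = (#|G| * \dim {:k})%N,
      forall g h, sg g z = sg h z -> g = h
    & forall phi : {rmorphism k -> algC}, exists psi : {rmorphism E -> algC},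
        forall a, psi (inc a) = phi a]].
Proof.
move=> pl; have l0 := prime_gt0 pl.
have kl0 : l%:R != 0 :> k.
  by rewrite -(rmorph_nat (in_alg k)) fmorph_eq0 pnatr_eq0 -lt0n.
have [zeta zetal] : exists zeta : L, l.-primitive_root zeta.
  by apply: closed_prim_root => //; rewrite -(rmorph_nat iota) fmorph_eq0.
have [p irr pz] : exists2 p, irreducible_poly p & root (map_poly iota p) zeta.
  apply: (@exists_min_root_poly _ _ _ _ ('X^l - 1)); first by rewrite monic_neq0 ?monicXnsubC.
  by rewrite rmorphB rmorph1 /= map_polyXn /root !hornerE (prim_expr_order zetal) subrr.
have [K0 _ [z rz gz]] := irredp_FAdjoin irr.
have [f fA fz] := embed_adjoin gz irr rz pz.
have zl : l.-primitive_root z by rewrite -(fmorph_primitive_root f) fz.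
have fac := factor_Xn_sub_1 zl.
have ovr : 'X^l - 1 \is a polyOver (1%VS : {vspace K0}).
  by rewrite rpredB ?polyOverXn // rpred1.
have spl : splittingFieldFor 1 ('X^l - 1) {:K0}.
  exists [seq z ^+ i | i <- index_iota 0 l]; first by rewrite big_map fac eqpxx.
  apply/eqP; rewrite eqEsubv subvf -gz; apply/FadjoinP; split; first exact: subv_adjoin_seq.
  rewrite seqv_sub_adjoin //; apply/mapP; exists 1%N; rewrite ?expr1 //.
  by rewrite mem_index_iota prime_gt1.
have ax : SplittingField.axiom K0 by exists ('X^l - 1).
pose K := HB.pack_for (splittingFieldType k) K0 (FieldExt_isSplittingField.Build k K0 ax).
have galK : galois 1 {:K}.
  apply/splitting_galoisField; exists ('X^l - 1); split => //.
  by rewrite separable_Xn_sub_1 // -(rmorph_nat (in_alg K0)) fmorph_eq0.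
pose E := baseFieldType K.
have allG (g : gal_of {:K}) : g \in ('Gal({:K} / 1))%g.
  by rewrite gal_kAut ?sub1v // kAutfE k1AHom.
have gen (g h : gal_of {:K}) : g z = h z -> g = h.
  move=> e; apply/eqP/gal_eqP => x _.
  have /Fadjoin1_polyP [q ->] : x \in <<1; z>>%VS by rewrite gz memvf.
  have gq (s : gal_of {:K}) : s (map_poly (in_alg K0) q).[z] = (map_poly (in_alg K0) q).[s z].
    rewrite -horner_map -map_poly_comp; congr _.[_]; apply: eq_map_poly => a /=.
    by rewrite linearZ /= rmorph1.
  by rewrite !gq e.
pose inc : {rmorphism k -> E} := in_alg K.
pose sg (g : gal_of {:K}) : {rmorphism E -> E} := (gal_repr g : {rmorphism K -> K}).
exists E, inc, (f : {rmorphism K -> L}), z, (gal_of {:K}), sg; split=> //.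
- by move=> g h a; rewrite -[LHS]/((g * h)%g a) galM ?memvf.
- move=> a fa; have : a \in fixedField ('Gal({:K} / 1))%g.
    by apply/fixedFieldP; [exact: memvf | move=> g _; exact: fa].
  by rewrite (galois_fixedField galK) => /vlineP [x ->]; exists x.
split.
- by move=> g h e; apply: gen; apply: e.
- have dK : \dim {:K} = #|{: gal_of {:K}}|.
    have := galois_dim galK; rewrite dimv1 divn1 => ->.
    by apply: eq_card => g; rewrite !inE; exact: allG.
  rewrite -dK; have := dim_baseVspace {:K}; rewrite -[\dim {:k}]/(\dim {:k}) => <-.
  by congr (\dim _); apply/vspaceP => x; rewrite mem_baseVspace [LHS]memvf [RHS]memvf.
- exact: gen.
- move=> phi; have [r Dr] := closed_field_poly_normal (map_poly phi p).
  have sp : (1 < size (map_poly phi p))%N by rewrite size_map_poly; case: irr.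
  have [r0 rr] : exists r0, root (map_poly phi p) r0.
    by apply/closed_rootP; rewrite gtn_eqF.
  have [psi psiA _] := embed_adjoin gz irr rz rr.
  by exists (psi : {rmorphism K -> algC}).
Qed.

(** * From squarefree norms to radical elements *)

Section NormRadical.

Variables (E : fieldExtType rat) (n : nat) (psi : 'I_n -> {rmorphism E -> algC}).
Variables (v u : 'I_n -> E) (D : nat) (fr : frame psi v u D).

(** One prime factor is handled by [frame_radical], the cofactor by induction, and Bezout combines
    the two divisibilities because they are coprime. *)
Lemma sqfree_nat_radical (m : nat) : (0 < m)%N ->
  (forall p, prime p -> (p %| m)%N -> ~~ (p ^ 2 %| m)%N /\ ~~ (p %| D)%N) ->
  radical (m%:R : E).
Proof.
elim/ltn_ind: m => m IH m0 sq; have [->|m1] := eqVneq m 1%N.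
  by move=> t j ti _; exists t; rewrite // mul1r.
have pp : prime (pdiv m) by apply: pdiv_prime; lia.
set p := pdiv m in pp; have /dvdnP [q qe] := pdiv_dvd m; rewrite -/p in qe.
have [sqp pD] := sq p pp (pdiv_dvd m).
have pq : ~~ (p %| q)%N.
  by apply: contra sqp => /dvdnP [r re]; rewrite qe re -mulnA mulnn dvdn_mull.
have q0 : (0 < q)%N by move: m0; rewrite qe muln_gt0 => /andP [].
have qm : (q < m)%N by rewrite qe -[X in (X < _)%N]muln1 ltn_pmul2l // prime_gt1.
have rq : radical (q%:R : E).
  apply: IH => // p' pp' p'q.
  have p'm : (p' %| m)%N by rewrite qe dvdn_mulr.
  have [sq' p'D] := sq p' pp' p'm; split=> //.
  by apply: contra sq' => h; rewrite qe dvdn_mulr.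
move=> t j ti; rewrite qe natrM => mt.
have [a ai ae] : idvd (p%:R : E) t.
  apply: (frame_radical fr pp pD ti (m := j)); apply: idvd_trans mt.
  by exists q%:R; rewrite ?rpred_nat // mulrC.
have [b bi be] : idvd (q%:R : E) t.
  apply: (rq _ j ti); apply: idvd_trans mt.
  by exists p%:R; rewrite ?rpred_nat.
have [x y e _] := egcdnP p q0; move: e.
have -> : gcdn q p = 1%N by apply/eqP; rewrite gcdnC -[_ == _]/(coprime _ _) prime_coprime.
move=> e; exists (x%:R * a - y%:R * b); first by rewrite rpredB // rpredM ?rpred_nat.
have e' : x%:R * q%:R = y%:R * p%:R + 1 :> E by rewrite -!natrM e natrD.
transitivity ((x%:R * q%:R) * t - (y%:R * p%:R) * t); last by rewrite {1}ae be; ring.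
by rewrite e' mulrDl mul1r addrC addKr.
Qed.

(** Distinct elements of [G] give distinct embeddings [psi i0 \o sg g], so the product over [G]
    divides the full norm. That is a squarefree integer prime to [D], hence radical, and radicality
    passes to factors. *)
Lemma norm_radical (G : finGroupType) (sg : G -> {rmorphism E -> E}) (z : E) :
  (forall g h, sg g =1 sg h -> g = h) -> z \in @is_int E -> z != 0 -> sqfree_norm psi z ->
  (forall (p : nat) (m : int), prime p -> (p %| D)%N -> m%:~R = \prod_i psi i z -> ~~ (p %| m)%Z) ->
  radical (\prod_g sg g z).
Proof.
move=> sginj zi z0 sqz Dz; have [m em] := frame_norm_int fr zi.
have m0 : (0 < `|m|)%N.
  rewrite absz_gt0; apply/eqP => m0; move: em; rewrite m0 => /esym/eqP.
  rewrite prodf_seq_eq0 => /hasP [i _ /=]; by rewrite fmorph_eq0 (negPf z0).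
have rm : radical (`|m|%:R : E).
  apply: sqfree_nat_radical => // p pp pm; split; first exact: (sqz p m pp em).
  by apply/negP => pD; have /negP := Dz p m pp pD em; apply.
pose i0 := Ordinal (frame_gt0 fr).
have [c ci ce] : exists2 c, c \in @is_int E & m%:~R = (\prod_g sg g z) * c.
  have /choice [idx idxP] : forall g, exists i, forall a, psi i0 (sg g a) = psi i a.
    move=> g; have [i ie] := frame_all fr (psi i0 \o sg g : {rmorphism E -> algC}).
    by exists i => a; rewrite -ie.
  have inj : injective idx.
    move=> g h e; apply: sginj => a; apply: (fmorph_inj (psi i0)).
    by rewrite !idxP e.
  have b0 : \prod_g sg g z != 0 by apply/prodf_neq0 => g _; rewrite fmorph_eq0.
  exists (m%:~R / \prod_g sg g z); last by rewrite mulrC divfK.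
  rewrite -(is_int_rmorph (psi i0)) fmorph_div rmorph_int em.
  rewrite (bigID (fun i => i \in codom idx)) /=.
  have -> : \prod_(i in codom idx) psi i z = psi i0 (\prod_g sg g z).
    rewrite rmorph_prod; under [RHS]eq_bigr do rewrite idxP.
    have uc : uniq (codom idx) by rewrite map_inj_uniq ?enum_uniq.
    by rewrite -(big_uniq _ uc) big_map big_enum.
  rewrite mulrAC mulfV ?fmorph_eq0 // mul1r rpred_prod // => i _.
  by rewrite is_int_rmorph.
have c0 : c != 0.
  apply/eqP => c0; move: ce; rewrite c0 mulr0 => /(congr1 (psi i0)); rewrite rmorph_int rmorph0 => /eqP.
  by rewrite intr_eq0 -absz_eq0 -leqn0 leqNgt m0.
apply: (radical_factor ci c0); rewrite -ce => t j ti.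
have sgn : exists s : E, [/\ s \in @is_int E, s * s = 1 & m%:~R = s * `|m|%:R].
  exists ((-1) ^+ (m < 0)%R); rewrite -signr_addb addbb expr0 rpredX ?rpredN1 //; split=> //.
  by rewrite [in LHS](intEsign m) rmorphM rmorph_sign.
have [s [si ss ->]] := sgn => -[y yi ye].
have [y' y'i y'e] : idvd (`|m|%:R : E) t.
  by apply: (rm _ j ti); exists (s * y); rewrite ?rpredM // ye mulrCA mulrA.
by exists (s * y'); rewrite ?rpredM // y'e mulrACA ss mul1r.
Qed.

End NormRadical.

(** * Kummer fields *)

Section KummerField.

Variables (k : fieldExtType rat) (E : fieldExtType rat) (L : closedFieldType).
Variables (iota : {rmorphism k -> L}) (inc : {rmorphism k -> E}) (f : {rmorphism E -> L}).
Hypothesis f_inc : forall a, f (inc a) = iota a.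
Variables (l : nat) (pl : prime l) (z : E) (zl : l.-primitive_root z).
Variables (G : finGroupType) (sg : G -> {rmorphism E -> E}).
Hypothesis sgM : forall g h a, sg (g * h)%g a = sg h (sg g a).
Hypothesis sg_inj : forall g h, sg g z = sg h z -> g = h.
Variable (chi : G -> 'F_l).
Hypothesis chiP : forall g, sg g z = zpow z (chi g).

Local Notation O := (@is_int E).

Lemma l_neq0_E : l%:R != 0 :> E.
Proof. by rewrite -(rmorph_nat (in_alg E)) fmorph_eq0 pnatr_eq0 -lt0n prime_gt0. Qed.

Lemma sg1 a : sg 1%g a = a.
Proof. by apply: (fmorph_inj (sg 1%g)); rewrite -sgM mulg1. Qed.

Lemma chi1 : chi 1%g = 1.
Proof. by apply: (zpow_inj pl zl); rewrite -chiP sg1. Qed.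

Lemma chi_inj : injective chi.
Proof. by move=> g h e; apply: sg_inj; rewrite !chiP e. Qed.

Definition kummer_good (beta : E) : Prop :=
  [/\ beta \in O, beta != 0, radical (\prod_g sg g beta) & ~ idvd beta 1].

(** Otherwise the product of the [(sg g beta) ^ (1 / chi g)] would be an [l]-th power in [E]. With a
    trivial second family, [kummer_divisibility] would then make [beta] a unit: its own exponent is
    1. *)
Lemma resolvent_out beta (B : G -> L) : kummer_good beta ->
  (forall g, B g ^+ l = f (sg g beta)) -> forall y, resolvent chi B 1 <> f y.
Proof.
move=> [bi b0 rb nb] BP y e; apply: nb.
have yl : y ^+ l = \prod_g sg g beta ^+ ((chi g)^-1 : 'F_l).
  apply: (fmorph_inj f); rewrite rmorphXn -e /=.
  exact: resolvent_expr_l.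
have := @kummer_divisibility E G 1%g l (fun g => sg g beta) (fun=> 1)
  (fun g => ((chi g)^-1 : 'F_l)) (fun=> l.-1) y (prime_gt1 pl).
rewrite sg1 => dv.
suff : idvd beta (\prod_(g : G | l.-1 == l.-1) 1) by rewrite big1.
apply: dv => //.
- by move=> g; rewrite is_int_rmorph.
- by move=> _; rewrite rpred1.
- by move=> g; rewrite fmorph_eq0.
- by move=> _; rewrite oner_neq0.
- by rewrite big1 // => t m ti _; exists t; rewrite ?mul1r.
- by rewrite chi1 invr1.
- by rewrite yl [X in _ * X]big1 ?mulr1 // => g _; rewrite expr1n.
Qed.

Lemma resolvent_span_sum (B : G -> L) (I : Type) (r : seq I) (Y : I -> L) :
  (forall i, exists y : 'F_l -> E, Y i = \sum_j f (y j) * resolvent chi B j) ->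
  exists y : 'F_l -> E, \sum_(i <- r) Y i = \sum_j f (y j) * resolvent chi B j.
Proof.
move=> h; elim: r => [|i r [y ye]].
  by exists (fun=> 0); rewrite big_nil big1 // => j _; rewrite rmorph0 mul0r.
have [y' y'e] := h i; exists (fun j => y' j + y j).
by rewrite big_cons ye y'e -big_split; apply: eq_bigr => j _; rewrite rmorphD mulrDl.
Qed.

(** Equal fields force the resolvent of [beta2] to be a multiple of a single [A r] of [beta].
    Comparing [l]-th powers and completing the exponents [r / chi g] by [l - r / chi g] produces an
    [l]-th power to which [kummer_divisibility] applies. Its exponent condition selects the [g] with
    [chi g = r]: at most one, and not none, as [beta2] is no unit. *)
Lemma same_kummer_field beta beta2 (B B2 : G -> L) :
  kummer_good beta -> kummer_good beta2 ->
  (forall g, B g ^+ l = f (sg g beta)) -> (forall g, B2 g ^+ l = f (sg g beta2)) ->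
  (forall a, exists x : 'F_l -> k, wvec f z chi B2 a = \sum_c iota (x c) * wvec f z chi B c) ->
  exists g, idvd beta2 (sg g beta).
Proof.
move=> gb gb2 BP BP2 /choice [x xP].
have A_out := resolvent_out gb BP; have A2_out := resolvent_out gb2 BP2.
have [bi b0 rb nb] := gb; have [b2i b20 rb2 nb2] := gb2.
have [y ye] : exists y : 'F_l -> E, resolvent chi B2 1 = \sum_j f (y j) * resolvent chi B j.
  rewrite (resolvent_wvec f pl zl l_neq0_E chi B2 1); apply: resolvent_span_sum => a.
  rewrite xP mulr_sumr; apply: resolvent_span_sum => c.
  exists (fun i => zpow z (- (1 * a)) * inc (x a c) * l%:R^-1 * zpow z (c * i)).
  rewrite /wvec -f_inc !mulrA mulr_sumr; apply: eq_bigr => i _.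
  by rewrite !rmorphM fmorphV rmorph_nat !mulrA.
have A2l := resolvent_expr_l chi BP2.
have [r [t [r0 te]]] : exists r t, r != 0 /\ resolvent chi B2 1 = f t * resolvent chi B r.
  rewrite ye; apply: (kummer_eigen pl zl b0 BP A_out (a := \prod_g sg g beta2 ^+ ((chi g)^-1 : 'F_l))).
    by rewrite -ye A2l.
  by move=> c; rewrite -ye; apply: A2_out.
have te' : \prod_g sg g beta2 ^+ ((chi g)^-1 : 'F_l) =
    t ^+ l * \prod_g sg g beta ^+ (r / chi g : 'F_l).
  apply: (fmorph_inj f); rewrite -A2l te exprMn rmorphM rmorphXn.
  by rewrite (resolvent_expr_l_gen chi BP).
have h0 g : (0 < (r / chi g : 'F_l))%N.
  rewrite lt0n; apply/eqP => e; have : r / chi g = 0 by apply: val_inj.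
  by move/eqP; rewrite mulf_eq0 (negPf r0) invr_eq0 (negPf (chi_neq0 pl zl chiP g)).
have := @kummer_divisibility E G 1%g l (fun g => sg g beta2) (fun g => sg g beta)
  (fun g => ((chi g)^-1 : 'F_l)) (fun g => (l - (r / chi g : 'F_l))%N)
  (t * \prod_g sg g beta) (prime_gt1 pl).
rewrite sg1 => /(_ _ _ _ _ rb2 rb) dv.
have {}dv : idvd beta2 (\prod_(g | (l - (r / chi g : 'F_l))%N == l.-1) sg g beta).
  apply: dv => [g|g|g|g||g|]; rewrite ?is_int_rmorph ?fmorph_eq0 //.
  - by rewrite chi1 invr1.
  - by have := h0 g; lia.
  rewrite te' exprMn -prodrXl -mulrA; congr (_ * _); rewrite -big_split; apply: eq_bigr => g _.
  transitivity (sg g beta ^+ ((r / chi g : 'F_l) + (l - (r / chi g : 'F_l)))%N); last exact: exprD.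
  by rewrite subnKC //; exact: (ltnW (Fp_ltn pl (r / chi g))).
have hE g : ((l - (r / chi g : 'F_l))%N == l.-1) = (chi g == r).
  have -> : ((l - (r / chi g : 'F_l))%N == l.-1) = ((r / chi g : 'F_l) == 1%N :> nat).
    have := h0 g; have := Fp_ltn pl (r / chi g); have := prime_gt1 pl.
    by move: (nat_of_ord _) => c h1 h2 h3; apply/eqP/eqP; lia.
  apply/eqP/eqP => [e|<-]; last by rewrite divff // (chi_neq0 pl zl chiP).
  have : r / chi g = 1 by apply: val_inj.
  by move/(canRL (divfK (chi_neq0 pl zl chiP g))); rewrite mul1r.
move: dv; rewrite (eq_bigl _ _ hE) => dv.
have [[g gr]|ng] := pselect (exists g, chi g = r).
  exists g; move: dv; rewrite (big_pred1 g) // => h /=.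
  by rewrite -gr (inj_eq chi_inj).
case: nb2; move: dv; rewrite big1 // => g /eqP gr; by case: ng; exists g.
Qed.

End KummerField.

Lemma closed_root (L : closedFieldType) n (c : L) : (0 < n)%N -> exists y, y ^+ n = c.
Proof.
move=> n0; have /closed_rootP [y ry] : size ('X^n - c%:P) != 1%N.
  by rewrite size_XnsubC // -lt0n.
by exists y; apply/eqP; move: ry; rewrite rootE !hornerE subr_eq0.
Qed.

Section KummerExtension.

Variables (k : fieldExtType rat) (E : fieldExtType rat) (L : closedFieldType).
Variables (iota : {rmorphism k -> L}) (inc : {rmorphism k -> E}) (f : {rmorphism E -> L}).
Hypothesis f_inc : forall a, f (inc a) = iota a.
Variables (l : nat) (pl : prime l) (z : E) (zl : l.-primitive_root z).
Variables (G : finGroupType) (sg : G -> {rmorphism E -> E}).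
Hypothesis sgM : forall g h a, sg (g * h)%g a = sg h (sg g a).
Hypothesis sg_fix : forall a, (forall g, sg g a = a) -> exists x, a = inc x.
Variable (chi : G -> 'F_l).
Hypothesis chiP : forall g, sg g z = zpow z (chi g).

Lemma kummer_extension beta (M : nat) : kummer_good sg beta -> (0 < M)%N ->
  (forall g, idvd (l%:R ^+ 2 * M%:R) (sg g beta - 1)) ->
  exists (K : splittingFieldType k) (j : {rmorphism K -> L}) (B : G -> L),
  [/\ forall a, j a%:A = iota a, forall g, B g ^+ l = f (sg g beta),
      range j = [set y | exists x : 'F_l -> k, y = \sum_c iota (x c) * wvec f z chi B c],
      [/\ \dim {:K} = l, galois 1 {:K} & cyclic 'Gal({:K} / 1)]
    & (exists b (d : int_ring k), [/\ inc b = \prod_g sg g beta, int_val d = b ^+ l.-1 & rel_disc K d])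
      /\ forall (p : set (int_ring k)) m, primes_of p ->
        (forall x, ~ p x -> exists y, p (x * y - 1)) -> (m %| M)%N -> p m%:R -> unramified_at K p].
Proof.
move=> gb M0 dv; have [bi b0 rb nb] := gb; have l0 := l_neq0_E E pl.
have /choice [B BP] : forall g, exists y, y ^+ l = f (sg g beta).
  by move=> g; apply: closed_root; apply: prime_gt0.
have A_out := resolvent_out pl zl sgM chiP gb BP.
have [tau tauP] := tau_exists pl zl sgM sg_fix chiP beta.
have [b bP] := norm_fixed sgM sg_fix beta.
pose w := wvec f z chi B.
have sw : \sum_a w a = 1 := sum_wvec f pl zl l0 chi B.
have mw a c : w a * w c = \sum_d iota (tau (a - d) (c - d)) * w d.
  rewrite /w (mul_wvec pl zl l0 chi BP); apply: eq_bigr => d _.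
  by rewrite -tauP f_inc.
have fw (x : 'F_l -> k) : \sum_a iota (x a) * w a = 0 -> forall a, x a = 0.
  move=> e a; apply: (fmorph_inj inc); rewrite rmorph0.
  apply: (wvec_free pl zl l0 b0 BP A_out (x := inc \o x)).
  by rewrite -[RHS]e; apply: eq_bigr => c _; rewrite /= f_inc.
have [K [j [om [jA jom span_om [dimK gK cK]]]]] := resolvent_field pl sw mw fw.
have jlin (x : 'F_l -> k) : j (\sum_a x a *: om a) = \sum_a iota (x a) * w a.
  rewrite rmorph_sum; apply: eq_bigr => a _.
  by rewrite -[x a *: _]mulr_algl rmorphM jA jom.
have mul_om a c : om a * om c = \sum_d tau (a - d) (c - d) *: om d.
  by apply: (fmorph_inj j); rewrite rmorphM !jom mw jlin.
have sum_om : \sum_a om a = 1.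
  by apply: (fmorph_inj j); rewrite rmorph_sum rmorph1 -[RHS]sw; apply: eq_bigr => a _.
have tr_int (x : 'F_l -> k) : \sum_a x a *: om a \in @is_int K -> \sum_a x a \in @is_int k.
  by rewrite -(is_int_rmorph j) jlin; apply: resolvent_trace_int sw mw fw _.
have dvm m : (m %| M)%N -> forall g, idvd (l%:R ^+ 2 * m%:R) (sg g beta - 1).
  move=> /dvdnP [c Mc] g; apply: idvd_trans (dv g).
  by exists c%:R; rewrite ?rpred_nat // Mc natrM; ring.
have tau_mod m : (m %| M)%N -> forall x y, idvd (m%:R : k) (tau x y - ((x == 0) && (y == 0))%:R).
  move=> mM x y; have m0 : m%:R != 0 :> k.
    rewrite -(rmorph_nat (in_alg k)) fmorph_eq0 pnatr_eq0 -lt0n.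
    exact: dvdn_gt0 M0 mM.
  apply/(idvd_rmorph inc _ m0); rewrite rmorph_nat rmorphB rmorph_nat tauP.
  by apply: tau'_mod => //; [rewrite rpred_nat|apply: dvm].
have b_mod m : (m %| M)%N -> idvd (m%:R : k) (b - 1).
  move=> mM; have m0 : m%:R != 0 :> k.
    rewrite -(rmorph_nat (in_alg k)) fmorph_eq0 pnatr_eq0 -lt0n.
    exact: dvdn_gt0 M0 mM.
  apply/(idvd_rmorph inc _ m0); rewrite rmorph_nat rmorphB rmorph1 -bP.
  apply: (norm_mod pl zl l0 chiP b0) => [|g]; first by rewrite rpred_nat.
  apply: idvd_trans (dvm m mM g).
  by exists (l%:R ^+ 2); rewrite ?rpredX ?rpred_nat // mulrC.
(* The congruence modulo [m = 1] says exactly that the table is integral. *)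
have tau_int x y : tau x y \in @is_int k.
  have [t ti te] := tau_mod 1%N (dvd1n _) x y.
  rewrite -[tau x y](subrK ((x == 0) && (y == 0))%:R) te mul1r rpredD // rpred_nat //.
have b_int : b \in @is_int k.
  by rewrite -(is_int_rmorph inc) -bP rpred_prod // => g _; rewrite is_int_rmorph.
have tau0 : \sum_x tau x 0 = 1.
  apply: (fmorph_inj inc); rewrite rmorph_sum rmorph1 -[RHS](tau'_trace pl zl sg l0 chi beta).
  by apply: eq_bigr => x _; rewrite tauP.
have tau_sum a c : \sum_d tau (a - d) (c - d) = b * (a == c)%:R + (1 - b) / l%:R.
  apply: (fmorph_inj inc); rewrite rmorph_sum rmorphD !rmorphM rmorphB rmorph1 fmorphV !rmorph_nat -bP.
  rewrite -(tau'_sum pl zl l0 chiP b0 a c).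
  by apply: eq_bigr => x _; rewrite tauP.
have bn0 : b != 0.
  rewrite -(fmorph_eq0 inc) -bP; apply/prodf_neq0 => g _; by rewrite fmorph_eq0.
exists K, j, B; split => //.
  apply/seteqP; split => [_ [y _ <-]|_ [x ->]] /=.
    by have [x ->] := span_om y; exists x; rewrite jlin.
  by exists (\sum_a x a *: om a) => //; rewrite jlin.
split.
  have bl : b ^+ l.-1 \in @is_int k by rewrite rpredX.
  exists b, (IntRing bl); split => //.
  exact: (rel_disc_om pl dimK mul_om span_om tau_int b_int tau0 tau_sum bn0).
move=> p m pp pm mM pm0.
exact: (unramified_om pl dimK sum_om mul_om span_om tr_int tau_int b_int tau_sum
  pp pm pm0 (tau_mod m mM) (b_mod m mM)).
Qed.

End KummerExtension.

Lemma int_val_nat (F : fieldType) (m : nat) : int_val (m%:R : int_ring F) = m%:R.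
Proof. by elim: m => // m IH; rewrite !mulrS -IH. Qed.

Lemma int_valX (F : fieldType) (x : int_ring F) m : int_val (x ^+ m) = int_val x ^+ m.
Proof. by elim: m => // m IH; rewrite !exprS -IH. Qed.

(** * Nonzero primes contain a positive integer and are maximal *)

Section PrimeIdeals.

Variables (k : fieldExtType rat) (n : nat) (psi : 'I_n -> {rmorphism k -> algC}).
Variables (v u : 'I_n -> k) (D : nat) (fr : frame psi v u D).

Lemma idvd_norm z m : z \in @is_int k -> z != 0 -> m%:~R = \prod_i psi i z -> idvd z m%:~R.
Proof.
move=> zi z0 mz; exists (m%:~R / z); last by rewrite mulrC divfK.
pose i0 := Ordinal (frame_gt0 fr).
rewrite -(is_int_rmorph (psi i0)) rmorphM fmorphV rmorph_int mz (bigD1 i0) //= mulrC mulKf ?fmorph_eq0 //.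
by rewrite rpred_prod // => i _; rewrite is_int_rmorph.
Qed.

Variables (p : set (int_ring k)) (pp : primes_of p).

Lemma prime_contains_nat : exists2 m, (0 < m)%N & p m%:R.
Proof.
have [p0 p1 pI] := p_ideal pp.
have [x px x0] : exists2 x, p x & x != 0.
  apply: contrapT => h; case: pp => _ _ /eqP; apply; apply/seteqP; split => [x px|_ -> //] /=.
  by apply: contrapT => /eqP x0; apply: h; exists x.
have vx0 : int_val x != 0 by rewrite -[0]/(int_val (0 : int_ring k)) (inj_eq val_inj).
have [m mP] := frame_norm_int fr (int_valP x).
have [y yi e] := idvd_norm (int_valP x) vx0 mP.
have m0 : m != 0.
  by rewrite -(intr_eq0 algC) mP; apply/prodf_neq0 => i _; rewrite fmorph_eq0.
exists `|m|%N; first by rewrite absz_gt0.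
have yi' : (Num.sg m)%:~R * y \in @is_int k by rewrite rpredM // rpred_int.
have -> : `|m|%N%:R = IntRing yi' * x + 0 :> int_ring k.
  apply: int_val_inj; rewrite addr0 int_val_nat int_valM /=.
  by rewrite -mulrA [y * _]mulrC -e -intrM -normrEsg pmulrn abszE.
exact: pI.
Qed.

(** Two powers of [x] agree modulo a positive integer in [p]. As [p] is prime and contains no power
    of [x], it contains [x ^ (j - i) - 1]. *)
Lemma prime_maximal x : ~ p x -> exists y, p (x * y - 1).
Proof.
have [p0 p1 pI] := p_ideal pp; move=> px; have [m m0 pm] := prime_contains_nat.
have pX i : ~ p (x ^+ i).
  elim: i => [|i IH]; rewrite ?expr0 // exprS => h.
  case: pp => _ pr _; have := pr x (x ^+ i); rewrite !inE.
  by move=> /(_ h) /orP [/asboolP/px|/asboolP/IH].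
have [i [j [ij dv]]] := frame_pigeonhole fr m0 (fun i => rpredX i (int_valP x)).
have pij : p (x ^+ i * (x ^+ (j - i) - 1)).
  have [t ti e] := dv.
  have -> : x ^+ i * (x ^+ (j - i) - 1) = IntRing ti * m%:R + 0.
    apply: int_val_inj; rewrite addr0 mulrBr mulr1 -exprD subnKC ?(ltnW ij) //.
    by rewrite int_valM int_valB !int_valX int_val_nat e mulrC.
  exact: pI.
exists (x ^+ (j - i).-1); rewrite -exprS prednK ?subn_gt0 //.
case: pp => _ pr _; have := pr (x ^+ i) (x ^+ (j - i) - 1); rewrite !inE.
by move=> /(_ pij) /orP [/asboolP/pX|/asboolP].
Qed.

End PrimeIdeals.

(** * The family of fields *)

Section BoxSize.

Variables (E : fieldExtType rat) (n : nat) (psi : 'I_n -> {rmorphism E -> algC}).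
Variables (v u : 'I_n -> E) (D : nat) (fr : frame psi v u D).
Variables (C : nat) (vC : forall i, \sum_j `|psi i (v j)| <= C%:R).
Variables (M A : nat) (M0 : (0 < M)%N) (A0 : (0 < A)%N).
Implicit Types (a : {ffun 'I_n -> 'I_A}).

Local Notation beta := (@box_elt E n v M (3 * C + 2) A).

Let lat_le a i : `|psi i (lat v (fun j => a j : nat))| <= (C * A)%:R.
Proof. by apply: (lat_bound vC) => j; exact: ltnW (ltn_ord _). Qed.

Let psi_box a i : psi i (beta a) =
  (1 + M * ((3 * C + 2) * A))%N%:R + M%:R * psi i (lat v (fun j => a j : nat)).
Proof.
rewrite /box_elt mulrDr addrA -natrM -(natrD _ 1%N).
by rewrite rmorphD rmorphM rmorph_nat; congr (_ + _ * _); rewrite rmorph_nat.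
Qed.

(** The lattice part has size at most [M C A]. The shift [M (3 C + 2) A] leaves more than
    [2 M C A + 1] after subtracting it, and [2 M C A] bounds every difference of conjugates in the
    box. *)
Lemma box_elt_large a i : (2 * M * C * A + 1)%:R < `|psi i (beta a)|.
Proof.
have := lat_le a i; rewrite psi_box.
set t := psi i _ => tC; apply: lt_le_trans (lerB_normD _ _).
rewrite normr_nat normrM normr_nat ltrBrDr.
apply: le_lt_trans (lerD (lexx _) (ler_wpM2l (ler0n _ _) tC)) _.
by rewrite -natrM -natrD ltr_nat; nia.
Qed.

Lemma box_elt_close a b i i' :
  `|psi i (beta a) - psi i' (beta b)| <= (2 * M * C * A)%:R.
Proof.
have := lat_le a i; have := lat_le b i'; rewrite !psi_box.
set t := psi i' _; set t' := psi i _ => tC t'C.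
rewrite opprD addrACA subrr add0r -mulrBr normrM normr_nat.
apply: le_trans (ler_wpM2l (ler0n _ _) (le_trans (ler_normB _ _) (lerD t'C tC))) _.
by rewrite -natrD -natrM ler_nat; nia.
Qed.

Lemma box_elt_neq0 a : beta a != 0.
Proof.
have := box_elt_large a (Ordinal (frame_gt0 fr)); apply: contraTneq => ->.
by rewrite rmorph0 normr0 ltrn0.
Qed.

Lemma box_elt_nonunit a : ~ idvd (beta a) 1.
Proof.
move=> [t ti e]; have t0 : t = 0.
  apply: (frame_small_eq0 fr ti) => i.
  have := congr1 (fun x => `|psi i x|) e; rewrite rmorph1 normr1 rmorphM normrM => {}e.
  have b1 : 1 < `|psi i (beta a)|.
    by apply: le_lt_trans (box_elt_large a i); rewrite ler1n addn1.
  have T0 : 0 < `|psi i t|.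
    rewrite lt_def normr_ge0 andbT; apply/eqP => T0.
    by move/eqP: e; rewrite T0 mulr0 oner_eq0.
  by rewrite e ltr_pMl.
by move: e; rewrite t0 mulr0 => /eqP; rewrite oner_eq0.
Qed.

(** For the quotient [t], every conjugate of [t - 1] is a difference of box conjugates divided by a
    larger box conjugate, hence below 1; so [t = 1]. *)
Lemma box_elt_idvd (s : {rmorphism E -> E}) a b : idvd (beta b) (s (beta a)) -> s (beta a) = beta b.
Proof.
move=> [t ti e]; suff : t - 1 = 0 by move/eqP; rewrite subr_eq0 e => /eqP ->; rewrite mulr1.
apply: (frame_small_eq0 fr); first by rewrite rpredB ?rpred1.
move=> i; have [i' i'P] := frame_all fr (psi i \o s)%FUN.
have b0 : 0 < `|psi i (beta b)| by rewrite normr_gt0 fmorph_eq0 box_elt_neq0.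
rewrite -(ltr_pM2l b0) mulr1 -normrM -rmorphM mulrBr -e mulr1 rmorphB.
have -> : psi i (s (beta a)) = psi i' (beta a) by rewrite -i'P.
apply: le_lt_trans (box_elt_close a b i' i) _; apply: le_lt_trans (box_elt_large b i).
by rewrite ler_nat leq_addr.
Qed.

Lemma box_elt_inj : injective beta.
Proof.
move=> a b; rewrite /box_elt => /addrI /(mulfI (natr_E_neq0 fr M0)) /addrI e.
have := lat_inj0 fr; move: e => /eqP; rewrite -subr_eq0 latB => /eqP e /(_ _ e) h.
by apply/ffunP => j; apply: val_inj; have := h j => /= /eqP; rewrite subr_eq0 => /eqP [].
Qed.

Lemma box_elt_good (G : finGroupType) (sg : G -> {rmorphism E -> E}) a :
  (forall g h, sg g =1 sg h -> g = h) -> (D %| M)%N -> sqfree_norm psi (beta a) ->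
  kummer_good sg (beta a).
Proof.
move=> sg_inj DM sq; have bi : beta a \in @is_int E by exact: (box_elt_int fr).
split => //; [exact: box_elt_neq0| |exact: box_elt_nonunit].
apply: (norm_radical fr) => // [|p m pp pD mE]; first exact: box_elt_neq0.
by apply: (norm_box_elt_mod fr pp _ mE); apply: dvdn_trans DM.
Qed.

End BoxSize.

Lemma root_character (l : nat) (pl : prime l) (E : fieldType) (z : E) (zl : l.-primitive_root z)
    (G : Type) (sg : G -> {rmorphism E -> E}) :
  exists chi : G -> 'F_l, forall g, sg g z = zpow z (chi g).
Proof.
suff /choice [chi chiP] : forall g, exists i : 'F_l, sg g z = zpow z i by exists chi.
move=> g; have [i e] : {i : 'I_l | sg g z = z ^+ i}.
  by apply: (prim_rootP zl); rewrite -rmorphXn (prim_expr_order zl) rmorph1.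
by exists (i : nat)%:R; rewrite zpow_nat.
Qed.

Lemma finite_primes_nat (k : fieldExtType rat) (n : nat) (psi : 'I_n -> {rmorphism k -> algC})
    (v u : 'I_n -> k) (D : nat) (fr : frame psi v u D) (S : set (set (int_ring k))) :
  S `<=` @primes_of (int_ring k) -> finite_set S ->
  exists2 M, (0 < M)%N & forall p, S p -> exists2 m, (m %| M)%N & p m%:R.
Proof.
move=> Sp /finite_fsetP [X SX].
have /choice [m mP] : forall p : set (int_ring k), exists m, (0 < m)%N /\ (S p -> p m%:R).
  move=> p; have [Spp|nS] := pselect (S p); last by exists 1%N.
  by have [m m0 pm] := prime_contains_nat fr (Sp p Spp); exists m.
exists (\prod_(p <- X) m p)%N.
  by apply: prodn_cond_gt0 => p _; have [] := mP p.
move=> p Spp; exists (m p); last by have [_] := mP p; apply.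
have pX : p \in (X : seq _) by move: Spp; rewrite SX.
by rewrite (big_rem p pX) dvdn_mulr.
Qed.

Lemma cyclic_subfields_ge (R : realType) (l : nat) (pl : prime l) (k : fieldExtType rat)
    (L : closedFieldType) (iota : {rmorphism k -> L}) (S : set (set (int_ring k))) :
  S `<=` @primes_of (int_ring k) -> finite_set S ->
  exists n C m A0 : nat, [/\ (0 < n)%N, (0 < C)%N, (0 < m)%N &
    forall (A : nat) (x : R), (A0 <= A)%N -> (C * A ^ (n * l.-1))%:R <= x ->
      (((A ^ n)%:R / m%:R)%:E <= Z_cyclic iota S l x)%E].
Proof.
move=> Sp Sfin.
have [E [inc [f [z [G [sg [zl f_inc sgM sg_fix [sg_inj' dimE sg_inj ext]]]]]]]] :=
  cyclotomic_extension iota pl.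
have [chi chiP] := root_character pl zl sg.
have [psi [v [u [D fr]]]] := frame_exists E.
have [psik [vk [uk [Dk frk]]]] := frame_exists k.
have [C C0 [vC _]] := sum_abs_bound (fun i j => psi i (v j)).
have [M0 sieve] := sieve_exists fr C0 vC.
have [MS MS0 MSP] := finite_primes_nat frk Sp Sfin.
have [Ck CkP] := ideal_norm_bound R frk.
(* [D] ensures reducedness at the primes that remain, [MS] covers [S], the factorial removes the
   primes up to [M0], and [l ^ 2] is the denominator of the table. *)
pose M' := (D * (MS * M0`!))%N; pose M := (l ^ 2 * M')%N.
have M'0 : (0 < M')%N by rewrite !muln_gt0 MS0 fact_gt0 (frame_D fr).
have M1 : (1 < M)%N by have := prime_gt1 pl; rewrite /M; nia.
have DM : (D %| M)%N by rewrite dvdn_mull // dvdn_mulr.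
have {}sieve := sieve M M1 DM _ (3 * C + 2)%N.
have [A0 A0P] : exists A0 : nat, forall A : nat, (A0 <= A)%N -> (0 < A)%N /\
    (A ^ \dim {:E} <= 2 * #|[set a : {ffun 'I_(\dim {:E}) -> 'I_A} |
       `[< sqfree_norm psi (box_elt v M (3 * C + 2) a) >]]%SET|)%N.
  apply: sieve => p pp pM; do 3!apply: dvdn_mull; by rewrite dvdn_fact // prime_gt0.
set n := \dim {:E} in psi v u fr vC sieve A0P *.
pose P := (M * (3 * C + 2 + C + 1))%N.
(* [Ck.+1] makes the constant positive. In [2 * #|G|], the 2 is the loss of the sieve and [#|G|]
   bounds the number of elements with the same field. *)
exists n, (Ck.+1 * P ^ (n * l.-1))%N, (2 * #|G|)%N, A0.
have G0 : (0 < #|G|)%N by rewrite (cardD1 1%g).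
split => //; first exact: frame_gt0 fr.
- by rewrite muln_gt0 expn_gt0 /P muln_gt0 addn1 (ltnW M1).
- by rewrite muln_gt0.
move=> A x AA0 Ax; have [A_gt0 {}A0P] := A0P A AA0.
have M_gt0 : (0 < M)%N := ltnW M1.
pose beta := @box_elt E n v M (3 * C + 2) A.
pose good := [set a : {ffun 'I_n -> 'I_A} | `[< sqfree_norm psi (beta a) >]]%SET.
have good_k a : a \in good -> kummer_good sg (beta a).
  by move=> ga; apply: (box_elt_good fr vC M_gt0 A_gt0 sg_inj' DM); move: ga; rewrite inE => /asboolP.
pose field_of (B : G -> L) : set L :=
  [set y | exists x : 'F_l -> k, y = \sum_c iota (x c) * wvec f z chi B c].
have beta_dv a g : idvd (l%:R ^+ 2 * M'%:R) (sg g (beta a) - 1).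
  exists (sg g ((((3 * C + 2) * A)%:R + lat v (fun j => a j : nat)))).
    by rewrite is_int_rmorph rpredD ?rpred_nat // (lat_int fr).
  have -> : l%:R ^+ 2 * M'%:R = sg g M%:R by rewrite rmorph_nat /M natrM natrX.
  have -> : sg g (beta a) - 1 = sg g (beta a - 1) by rewrite rmorphB rmorph1.
  by rewrite -rmorphM /beta /box_elt addrC addKr.
have /choice [F FP] : forall a : {a | a \in good}, exists B : G -> L,
    (forall g, B g ^+ l = f (sg g (beta (val a)))) /\ cyclic_subfields iota S l x (field_of B).
  move=> [a ga] /=.
  have [K [j [B [jA BP rj [dimK gK cK] [[b [d [bP dP dK]]] unr]]]]] :=
    kummer_extension f_inc pl zl sgM sg_fix chiP (good_k a ga) M'0 (beta_dv a).
  exists B; split => //; exists K, j; split => //; split => //.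
    move=> p Spp; have [m mMS pm] := MSP p Spp; have pp := Sp p Spp.
    apply: (unr p m pp) => //; first by move=> y; apply: prime_maximal frk _ pp _.
    by rewrite dvdn_mull // dvdn_mulr.
  have b0 : b != 0.
    rewrite -(fmorph_eq0 inc) bP; apply/prodf_neq0 => g _.
    by rewrite fmorph_eq0 (box_elt_neq0 fr vC).
  have X0 : (0 < ((P * A) ^ #|G|) ^ l.-1)%N.
    by rewrite !expn_gt0 muln_gt0 A_gt0 /P muln_gt0 M_gt0 addn1.
  apply: le_trans (CkP _ d _ _ dK _ X0 _) _.
  - exact: is_ideal_gen.
  - by rewrite dP expf_neq0.
  (* An embedding of [k] extends to [E], where [b] becomes a product of [#|G|] conjugates of the box
     element, each at most [P A]. *)
  - move=> i; rewrite dP rmorphXn normrX natrX lerXn2r ?nnegrE ?ler0n //.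
    have [phi phiP] := ext (psik i).
    rewrite -phiP bP rmorph_prod normr_prod natrX -prodr_const ler_prod // => g _.
    rewrite normr_ge0 /=; have [i' i'P] := frame_all fr (phi \o sg g)%FUN.
    have -> : phi (sg g (beta a)) = psi i' (beta a) by rewrite -i'P.
    exact: (box_elt_bound vC).
  rewrite lee_fin; apply: le_trans Ax; rewrite ler_nat.
  rewrite -mulnA -expnMn -!expnM /n dimE -mulnA [(\dim _ * _)%N]mulnC mulnA.
  by rewrite leq_mul2r leqnSn orbT.
apply: (@le_trans _ _ ((#|{: {a | a \in good}}|%:R / #|G|%:R)%:E)).
  rewrite lee_fin natrM invfM mulrA ler_wpM2r ?invr_ge0 ?ler0n //.
  rewrite ler_pdivrMr ?ltr0n // mulrC -natrM ler_nat card_sig.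
  by apply: leq_trans A0P _; rewrite leq_mul2l /=; apply: eq_leq; apply: eq_card => a; rewrite !inE.
apply: (counting_ge (f := fun a : {a | a \in good} => field_of (F a)) R G0) => a.
  exact: (FP a).2.
(* Each element with the same field as [a] is [sg g] of the box element of [a]; recording [g] embeds
   the fibre into [G]. *)
have /choice [h hP] : forall y : {a | a \in good}, exists g : G,
    field_of (F y) = field_of (F a) -> sg g (beta (val a)) = beta (val y).
  move=> y; have [e|ne] := pselect (field_of (F y) = field_of (F a)); last by exists 1%g.
  have [g dv] : exists g, idvd (beta (val y)) (sg g (beta (val a))).
    apply: (same_kummer_field f_inc pl zl sgM sg_inj chiP (good_k _ (valP a))
      (good_k _ (valP y)) (FP a).1 (FP y).1).
    move=> c; suff : field_of (F a) (wvec f z chi (F y) c) by [].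
    rewrite -e; exists (fun d => (d == c)%:R).
    rewrite (bigD1 c) //= eqxx rmorph1 mul1r big1 ?addr0 // => d /negPf ->.
    by rewrite rmorph0 mul0r.
  by exists g => _; apply: (box_elt_idvd fr vC M_gt0 A_gt0).
rewrite -(card_in_imset (f := h)) ?max_card // => y y' /[!inE] ye y'e hh.
have e : beta (val y) = beta (val y') by rewrite -(hP y ye) -(hP y' y'e) hh.
exact/val_inj/(box_elt_inj fr M_gt0 e).
Qed.

Theorem theorem2p6 (R : realType) (l : nat) (l_prime : prime l)
    (k : fieldExtType rat)
    (L : closedFieldType) (iota : {rmorphism k -> L})
    (L_closure : algebraic_closure iota)
    (S : set (set (int_ring k))) (S_primes : S `<=` @primes_of (int_ring k))
    (S_fin : finite_set S) :
  exists c : R, 0 < c /\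
    exists x0 : R, forall x : R, x0 <= x ->
      ((c * x `^ ((l%:R - 1)^-1))%:E <= Z_cyclic iota S l x)%E.
Proof.
have [n [C [m [A0 [n0 C0 m0 hA]]]]] := cyclic_subfields_ge R l_prime iota S_primes S_fin.
have s0 : (0 < l.-1)%N by have := prime_gt1 l_prime; lia.
have -> : l%:R - 1 = l.-1%:R :> R by rewrite -(natrB _ (prime_gt0 l_prime)) subn1.
set e := (l.-1%:R)^-1 : R; have CR : 0 < C%:R :> R by rewrite ltr0n.
pose N := (n * l.-1)%N; have N0 : (0 < N)%N by rewrite muln_gt0 n0.
(* [2 ^ n] pays for rounding [y] down to [A], since [y < A + 1 <= 2 A]; the threshold chosen next
   forces [y >= A0 + 1], so that [A] is positive and at least [A0]. *)
exists ((2 ^+ n)^-1 * (C%:R^-1) `^ e / m%:R); split.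
  by rewrite !mulr_gt0 ?invr_gt0 ?ltr0n ?exprn_gt0 ?powR_gt0 ?invr_gt0.
exists (C%:R * A0.+1%:R ^+ N) => x x0.
have xC : A0.+1%:R ^+ N <= x / C%:R by rewrite ler_pdivlMr // mulrC.
have xC0 : 0 <= x / C%:R by apply: le_trans xC; rewrite exprn_ge0.
have x_ge0 : 0 <= x by move: xC0; rewrite pmulr_lge0 ?invr_gt0.
(* The real solution of [C y ^ (n (l - 1)) = x]; hence [y ^ n] is [x ^ (1 / (l - 1))] up to a
   constant. *)
pose y := (x / C%:R) `^ (N%:R^-1).
have y0 : 0 <= y by exact: powR_ge0.
have yN : y ^+ N = x / C%:R.
  by rewrite -powR_mulrn // -powRrM mulVf ?powRr1 // pnatr_eq0 -lt0n.
have yA0 : A0.+1%:R <= y by rewrite -(@ler_pXn2r _ N) ?nnegrE // yN.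
have yn : y ^+ n = (x / C%:R) `^ e.
  rewrite -powR_mulrn // -powRrM; congr (_ `^ _).
  by rewrite /N natrM invfM mulrAC mulVf ?mul1r // pnatr_eq0 -lt0n.
pose A := Num.truncn y.
have /andP [Ay yA] : A%:R <= y < A.+1%:R by exact: truncn_itv.
have A0A : (A0 < A.+1)%N
  by rewrite -(ltr_nat R); apply: lt_trans yA; apply: lt_le_trans yA0; rewrite ltr_nat.
have A1 : (0 < A)%N
  by rewrite -ltnS -(ltr_nat R); apply: le_lt_trans yA; apply: le_trans yA0; rewrite ler_nat.
apply: le_trans (hA A x A0A _).
  rewrite lee_fin mulrAC ler_wpM2r ?invr_ge0 ?ler0n //.
  rewrite -mulrA -powRM ?invr_ge0 ?ler0n // mulrC [C%:R^-1 * x]mulrC -yn ler_pdivrMr ?exprn_gt0 //.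
  rewrite natrX -exprMn lerXn2r ?nnegrE ?mulr_ge0 ?ler0n //.
  by apply: le_trans (ltW yA) _; rewrite -natrM ler_nat; lia.
rewrite natrM natrX mulrC -ler_pdivlMr // -yN lerXn2r ?nnegrE ?ler0n //.
Qed.
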